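(* Consider either the Racah (R) or the $q$-Racah ($q$R) case, let $M\ge 1$ and let $\mathcal D=\{d_1<\cdots<d_M\}$ be a set of $M$ positive integers for which hypothesis (A) of the context holds. Let $N$ be a positive integer, let $a=-N$ (R) or $a=q^{-N}$ ($q$R), and let $b,c,d$ be generic. For any polynomial $Y(\eta)\neq0$ put $$X(\eta)=I_{\lambda+M\delta}\bigl[\Xi_{\mathcal D}Y\bigr](\eta),\qquad L=\deg X=\ell_{\mathcal D}+\deg Y+1,$$ where $(\Xi_{\mathcal D}Y)(\eta)=\Xi_{\mathcal D}(\eta;\lambda)Y(\eta)$, and $\check X(x)=X(\eta(x;\lambda+M\delta))$. Then the multi-indexed ($q$-)Racah polynomials satisfy the following ($1+2L$ term) recurrence relations with constant coefficients: there exist constants $r^{X,\mathcal D}_{n,k}$ (independent of $x$) such that $$\check X(x)\check P_{\mathcal D,n}(x)=\sum_{k=-\min(L,n)}^{\min(L,N-n)}r^{X,\mathcal D}_{n,k}\,\check P_{\mathcal D,n+k}(x)\qquad(n=0,1,\dots,N;\ x=0,1,\dots,N).$$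
   Context: Notation. Two parallel cases, Racah (R) and $q$-Racah ($q$R, with fixed $0<q<1$). $(z)_k$ and $(z;q)_k$ are the (q-)shifted factorials and $(z_1,\dots,z_r)_k=\prod_i (z_i)_k$, $(z_1,\dots,z_r;q)_k=\prod_i(z_i;q)_k$. Parameters: $\lambda=(a,b,c,d)$ (R), $q^{\lambda}=(a,b,c,d)$ ($q$R), complex. With $\delta=(1,1,1,1)$, replacing $\lambda$ by $\lambda+\beta\delta$ means $(a,b,c,d)\to(a+\beta,b+\beta,c+\beta,d+\beta)$ (R), $(a,b,c,d)\to(aq^\beta,bq^\beta,cq^\beta,dq^\beta)$ ($q$R). ''Generic'' means outside a countable union of zero sets of nonzero polynomials in the parameters concerned (in particular no denominator below vanishes and the degrees below are as stated). $\eta(x;\lambda)=x(x+d)$ (R), $(q^{-x}-1)(1-dq^x)$ ($q$R). $\tilde d=a+b+c-d-1$ (R), $abcd^{-1}q^{-1}$ ($q$R). ($q$-)Racah polynomials: $\check P_n(x;\lambda)=P_n(\eta(x;\lambda);\lambda)={}_4F_3\bigl(-n,n+\tilde d,-x,x+d;\,a,b,c;\,1\bigr)$ (R), ${}_4\phi_3\bigl(q^{-n},\tilde dq^n,q^{-x},dq^x;\,a,b,c;\,q;q\bigr)$ ($q$R); the series is the finite sum over $0\le k\le n$, well defined for $n\le N$ when $a=-N$ (R), $a=q^{-N}$ ($q$R). Energies: $\mathcal E_n=n(n+\tilde d)$ (R), $(q^{-n}-1)(1-\tilde dq^n)$ ($q$R). Virtual energies: $\tilde{\mathcal E}_{v}=-(c+v)(\tilde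 d-c-v)$ (R), $-(1-cq^{v})(1-c^{-1}\tilde dq^{-v})$ ($q$R). $\alpha=1$ (R), $abd^{-1}q^{-1}$ ($q$R). Twist: $\mathfrak t$ replaces $(a,b,c,d)$ by $(d-a+1,d-b+1,c,d)$ (R), $(dq/a,dq/b,c,d)$ ($q$R). $\check\xi_v(x;\lambda)=\check P_v(x;\mathfrak t(\lambda))$. $B'(x;\lambda)=-\frac{(x+d-a+1)(x+d-b+1)(x+c)(x+d)}{(2x+d)(2x+1+d)}$ (R), $-\frac{(1-a^{-1}dq^{x+1})(1-b^{-1}dq^{x+1})(1-cq^x)(1-dq^x)}{(1-dq^{2x})(1-dq^{2x+1})}$ ($q$R). $\varphi_m(x;\lambda)=\prod_{1\le j<k\le m}\frac{\eta(x+k-1;\lambda)-\eta(x+j-1;\lambda)}{\eta(k-j;\lambda)}$. Normalization constants: $\mathcal C_{\mathcal D}(\lambda)=\frac1{\varphi_M(0;\lambda)}\prod_{1\le j<k\le M}\frac{\tilde{\mathcal E}_{d_j}-\tilde{\mathcal E}_{d_k}}{\alpha B'(j-1;\lambda)}$, $\mathcal C_{\mathcal D,n}(\lambda)=(-1)^M\mathcal C_{\mathcal D}(\lambda)\frac{\varphi_M(0;\lambda)}{\varphi_{M+1}(0;\lambda)}\prod_{j=1}^M\frac{\mathcal E_n-\tilde{\mathcal E}_{d_j}}{\alpha B'(j-1;\lambda)}$. Denominator polynomial and multi-indexed polynomials: with $x_j=x+j-1$, $\check\Xi_{\mathcal D}(x;\lambda)=\Xi_{\mathcal D}(\eta(x;\lambda+(M-1)\delta);\lambda)=\mathcal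 C_{\mathcal D}(\lambda)^{-1}\varphi_M(x;\lambda)^{-1}\det\bigl(\check\xi_{d_k}(x_j;\lambda)\bigr)_{1\le j,k\le M}$, $\check P_{\mathcal D,n}(x;\lambda)=P_{\mathcal D,n}(\eta(x;\lambda+M\delta);\lambda)=\mathcal C_{\mathcal D,n}(\lambda)^{-1}\varphi_{M+1}(x;\lambda)^{-1}\det\bigl(\check\xi_{d_1}(x_j),\dots,\check\xi_{d_M}(x_j),\,r_j(x_j)\check P_n(x_j)\bigr)_{1\le j\le M+1}$ (the $j$-th row is displayed), where $r_j(x_j)=\frac{(x+a,x+b)_{j-1}(x+d-a+j,x+d-b+j)_{M+1-j}}{(d-a+1,d-b+1)_M}$ (R), $r_j(x_j)=\frac{(aq^x,bq^x;q)_{j-1}(a^{-1}dq^{x+j},b^{-1}dq^{x+j};q)_{M+1-j}}{(abd^{-1}q^{-1})^{j-1}q^{Mx}(a^{-1}dq,b^{-1}dq;q)_M}$ ($q$R). $\Xi_{\mathcal D}(\eta;\lambda)$ and $P_{\mathcal D,n}(\eta;\lambda)$ are polynomials in $\eta$ of degrees $\ell_{\mathcal D}$ and $\ell_{\mathcal D}+n$, $\ell_{\mathcal D}=\sum_jd_j-\frac12M(M-1)$, with value $1$ at $\eta=0$, and $\check P_{\mathcal D,0}(x;\lambda)=\check\Xi_{\mathcal D}(x;\lambda+\delta)$. Map $I_\lambda$: for a polynomial $p(\eta)$, $I_{\lambda}[p]=P$ is the unique polynomial with $P(0)=0$, $\deg P=\deg p+1$, and $\frac{P(\eta(x;\lambda))-P(\eta(x-1;\lambda))}{\eta(x;\lambda)-\eta(x-1;\lambda)}=p(\eta(x;\lambda-\delta))$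 identically in $x\in\mathbb C$. Hypothesis (A): for generic $(a,b,c,d)\in\mathbb C^4$ (here $a$ is also a free parameter), (i) all zeros of $\Xi_{\mathcal D}(\eta;\lambda)$ and all zeros of $\Xi_{\mathcal D}(\eta;\lambda+\delta)$ are simple; (ii) for every $n\ge1$, $P_{\mathcal D,0}(\eta;\lambda)$ and $P_{\mathcal D,n}(\eta;\lambda)$ have no common root. *)

(* Defs.v *)
From HB Require Import structures.
From mathcomp Require Import all_boot all_order all_algebra.
From mathcomp Require Import complex.
From mathcomp Require Import boolp classical_sets reals sequences exp trigo.
(* The notations of multinomials clash with those of MathComp-Analysis:
   {mpoly C[n]} is written [mpoly n C] and p.@[v] is written [meval v p]. *)
From mathcomp Require Import -(notations) mpoly.

Set Implicit Arguments.
Unset Strict Implicit.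
Unset Printing Implicit Defensive.

Import Order.TTheory GRing.Theory Num.Theory.

Local Open Scope ring_scope.
Local Open Scope complex_scope.

Definition cexp (R : realType) (z : R[i]) : R[i] :=
  (expR (complex.Re z))%:C * (cos (complex.Im z) +i* sin (complex.Im z)).

Definition qpow (R : realType) (q : R) (x : R[i]) : R[i] :=
  cexp (x * (ln q)%:C).

(* Multi-argument shifted factorials: (z_1, ..., z_r)_k, (z_1, ..., z_r; q)_k. *)
Definition pochs (F : fieldType) (zs : seq F) (k : nat) : F :=
  \prod_(z <- zs) \prod_(i < k) (z + i%:R).

Definition qpochs (F : fieldType) (q : F) (zs : seq F) (k : nat) : F :=
  \prod_(z <- zs) \prod_(i < k) (1 - z * q ^+ i).

(* P holds outside a countable union of zero sets of nonzero polynomials. *)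
Definition generically (C : fieldType) (n : nat) (P : ('I_n -> C) -> Prop) : Prop :=
  exists F : nat -> mpoly n C,
    (forall i, F i != 0) /\
    forall v : 'I_n -> C, (forall i, meval v (F i) != 0) -> P v.

Variant racah_case (R : realType) : Type :=
| Racah
| qRacah (q : R) of 0 < q < 1.

Arguments Racah {R}.

(* The four numbers are (a, b, c, d) in both cases; in the q-Racah case
   they are the components of q^lambda. *)
Record params (C : Type) : Type := Params { pa : C; pb : C; pc : C; pd : C }.

Section MultiIndexed.

Variables (R : realType) (fam : racah_case R).
Local Notation C := R[i].
Implicit Types (l : params C) (x : C) (n v m : nat) (p : {poly C}).

(* lambda + beta delta *)
Definition shift_params l (beta : int) : params C :=
  let: Params a b c d := l in
  match fam with
  | Racah => let t := beta%:~R in Params (a + t) (b + t) (c + t) (d + t)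
  | qRacah q _ => let t := q%:C ^ beta in Params (a * t) (b * t) (c * t) (d * t)
  end.

Definition etax x l : C :=
  let d := pd l in
  match fam with
  | Racah => x * (x + d)
  | qRacah q _ => (qpow q (- x) - 1) * (1 - d * qpow q x)
  end.

Definition dtilde l : C :=
  let: Params a b c d := l in
  match fam with
  | Racah => a + b + c - d - 1
  | qRacah q _ => a * b * c * d^-1 * (q%:C)^-1
  end.

(* \check P_n(x; lambda), as a terminating 4F3 or 4phi3 *)
Definition checkP0 n x l : C :=
  let: Params a b c d := l in
  let dt := dtilde l in
  match fam with
  | Racah =>
      \sum_(k < n.+1)
        pochs [:: - n%:R; n%:R + dt; - x; x + d] k
        / (pochs [:: a; b; c] k * k`!%:R)
  | qRacah q _ =>
      \sum_(k < n.+1)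
        qpochs q%:C [:: q%:C ^- n; dt * q%:C ^+ n; qpow q (- x); d * qpow q x] k
        / (qpochs q%:C [:: a; b; c] k * qpochs q%:C [:: q%:C] k) * q%:C ^+ k
  end.

Definition energy n l : C :=
  match fam with
  | Racah => n%:R * (n%:R + dtilde l)
  | qRacah q _ => (q%:C ^- n - 1) * (1 - dtilde l * q%:C ^+ n)
  end.

Definition venergy v l : C :=
  let c := pc l in
  match fam with
  | Racah => - (c + v%:R) * (dtilde l - c - v%:R)
  | qRacah q _ =>
      - (1 - c * q%:C ^+ v) * (1 - c^-1 * dtilde l * q%:C ^- v)
  end.

Definition alpha l : C :=
  let: Params a b c d := l in
  match fam with
  | Racah => 1
  | qRacah q _ => a * b * d^-1 * (q%:C)^-1
  end.

Definition twist l : params C :=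
  let: Params a b c d := l in
  match fam with
  | Racah => Params (d - a + 1) (d - b + 1) c d
  | qRacah q _ => Params (d * q%:C / a) (d * q%:C / b) c d
  end.

Definition checkxi v x l : C := checkP0 v x (twist l).

Definition Bprime x l : C :=
  let: Params a b c d := l in
  match fam with
  | Racah =>
      - ((x + d - a + 1) * (x + d - b + 1) * (x + c) * (x + d)
         / ((2 * x + d) * (2 * x + 1 + d)))
  | qRacah q _ =>
      - ((1 - a^-1 * d * qpow q (x + 1)) * (1 - b^-1 * d * qpow q (x + 1))
         * (1 - c * qpow q x) * (1 - d * qpow q x)
         / ((1 - d * qpow q (2 * x)) * (1 - d * qpow q (2 * x + 1))))
  end.

(* From here on the indices j, k start at 0, so that x_j = x + j. *)

Definition varphi m x l : C :=
  \prod_(k < m) \prod_(j < m | (j < k)%N)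
    ((etax (x + k%:R) l - etax (x + j%:R) l) / etax (k - j)%N%:R l).

Section Indices.

Variables (M : nat) (D : M.-tuple nat).

Definition ell : nat := ((\sum_(j < M) tnth D j) - (M * (M - 1)) %/ 2)%N.

Definition constXi l : C :=
  (varphi M 0 l)^-1 *
  \prod_(k < M) \prod_(j < M | (j < k)%N)
    ((venergy (tnth D j) l - venergy (tnth D k) l)
     / (alpha l * Bprime j%:R l)).

Definition constP n l : C :=
  (-1) ^+ M * constXi l * (varphi M 0 l / varphi M.+1 0 l) *
  \prod_(j < M)
    ((energy n l - venergy (tnth D j) l) / (alpha l * Bprime j%:R l)).

(* r_{j+1}(x_{j+1}) as a function of x *)
Definition rcoef (j : nat) x l : C :=
  let: Params a b c d := l in
  match fam with
  | Racah =>
      pochs [:: x + a; x + b] j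
      * pochs [:: x + d - a + j.+1%:R; x + d - b + j.+1%:R] (M - j)
      / pochs [:: d - a + 1; d - b + 1] M
  | qRacah q _ =>
      qpochs q%:C [:: a * qpow q x; b * qpow q x] j
      * qpochs q%:C [:: a^-1 * d * qpow q (x + j.+1%:R);
                       b^-1 * d * qpow q (x + j.+1%:R)] (M - j)
      / ((a * b * d^-1 * (q%:C)^-1) ^+ j * qpow q (M%:R * x)
         * qpochs q%:C [:: a^-1 * d * q%:C; b^-1 * d * q%:C] M)
  end.

Definition checkXiD x l : C :=
  (constXi l)^-1 * (varphi M x l)^-1 *
  \det (\matrix_(j < M, k < M) checkxi (tnth D k) (x + j%:R) l).

Definition checkPD n x l : C :=
  (constP n l)^-1 * (varphi M.+1 x l)^-1 *
  \det (\matrix_(j < M.+1, k < M.+1)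
          if unlift ord_max k is Some i
          then checkxi (tnth D i) (x + j%:R) l
          else rcoef j x l * checkP0 n (x + j%:R) l).

(* The polynomials in eta.  For generic lambda the condition determines p,
   since eta is non-constant and varphi does not vanish identically in x. *)
Definition XiD l : {poly C} :=
  xget 0 [set p : {poly C} | forall x, varphi M x l != 0 ->
            p.[etax x (shift_params l (M%:Z - 1))] = checkXiD x l]%classic.

Definition PD n l : {poly C} :=
  xget 0 [set p : {poly C} | forall x, varphi M.+1 x l != 0 ->
            p.[etax x (shift_params l M%:Z)] = checkPD n x l]%classic.

Definition hypA : Prop :=
  generically (fun u : 'I_4 -> C =>
    let l := Params (u 0) (u 1) (u 2) (u 3) in
    [/\ forall z : C, root (XiD l) z -> mup z (XiD l) = 1%N,
        forall z : C, root (XiD (shift_params l 1)) z -> mup z (XiD (shift_params l 1)) = 1%N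
      & forall n, (1 <= n)%N ->
          ~ exists z : C, root (PD 0 l) z /\ root (PD n l) z]).

End Indices.

(* I_lambda[p]; the condition determines it uniquely for p != 0. *)
Definition Imap l p : {poly C} :=
  xget 0 [set Q : {poly C} |
    [/\ Q.[0] = 0, size Q = (size p).+1
      & forall x, etax x l - etax (x - 1) l != 0 ->
          (Q.[etax x l] - Q.[etax (x - 1) l]) / (etax x l - etax (x - 1) l)
          = p.[etax x (shift_params l (- 1))]]]%classic.

(* a = -N, respectively a = q^(-N) *)
Definition aN (N : nat) : C :=
  match fam with
  | Racah => - N%:R
  | qRacah q _ => q%:C ^- N
  end.

End MultiIndexed.

(* Main.v *)
Require Import Defs.
From HB Require Import structures.
From mathcomp Require Import all_boot all_order all_algebra.
From mathcomp Require Import complex.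
From mathcomp Require Import boolp classical_sets reals sequences exp trigo.
From mathcomp Require Import -(notations) mpoly.
From mathcomp Require Import perm ring zify.

Set Implicit Arguments.
Unset Strict Implicit.
Unset Printing Implicit Defensive.

Import Order.TTheory GRing.Theory Num.Theory.

Local Open Scope ring_scope.
Local Open Scope complex_scope.

(* Write xi_k for the virtual state polynomials, W(x) for det (xi_k(x + j)), and
   T f(x) for the determinant of order M + 1 obtained by adjoining a column f(x + j).
   Up to a factor depending only on x and one depending only on n, P_{D,n} is T(nu P_n),
   where nu is the factor of the (q-)Racah weight attached to the pair (a, b); nu
   vanishes beyond N.

   By construction X(x) - X(x - 1) = c(x) W(x) with an explicit c.  Summation by parts
   gives X T f = T g with g(x) = X(x) f(x) + sum_{z > x} K(x, z) f(z); the kernel K is a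
   sum over the windows of M consecutive nodes containing z of c times the determinant
   W in which the node z has been replaced by x.  On a quadratic lattice such a sum is,
   up to a fixed odd function of z, a polynomial in eta(x), eta(z) of total degree less
   than L, and Gosper summation shows that f = nu p yields g = nu p' with
   deg p' <= deg p + L.  The adjoint of p -> p' for the orthogonality weight nu rho of
   the P_n has the same shape, with rho attached to (c, d) in place of nu.  Hence
   p -> p' is a band operator in the basis P_n, and applying T gives the recurrence. *)

(** * Polynomial remainders and alternants *)

(** Parity under the reflection of the lattice carries the argument. The quotient of the replaced
    determinant by the Vandermonde product of its window is a polynomial divided by the differences
    between the node z and the other nodes of the window. Summation over the windows through z is
    therefore the transpose of a divided difference of order M - 1. Each order lowers the degree by
    one, because the increment of a polynomial in eta is odd about the midpoint; this returns the M
    - 1 degrees gained by replacing a node. In the operator itself, a telescoped Gosper sum leaves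
    an odd boundary term at x, which cancels against the odd part of X: telescoping X over the M
    windows through x gives K(x, x) = X(x) - X(x - M). A degree bound limits the band on one side
    only, and the adjoint supplies the other. It is Gosper summable because the orthogonality weight
    is an odd function times two halves, nu and rho, each with its own rational shift quotient; nu
    ends the sums at N and rho at 0. The determinant W may vanish on the grid, so no identity
    divides by it. *)

Lemma triangular_poly_basis (F : fieldType) (t : nat -> {poly F}) (p : {poly F}) :
  (forall i, (i < size p)%N -> size (t i) = i.+1) ->
  exists2 c : {poly F}, size c = size p & p = \sum_(i < size p) c`_i *: t i.
Proof.
have [n] := ubnP (size p); elim: n p => // n IHn p; rewrite ltnS => lepn ht.
have [->|p0] := eqVneq p 0.
  by exists 0; rewrite ?size_poly0 ?big_ord0.
case Ek: (size p) => [|k]; first by move/eqP: Ek; rewrite size_poly_eq0 (negPf p0).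
have tk : size (t k) = k.+1 by apply: ht; rewrite Ek.
have tk0 : (t k)`_k != 0.
  have : lead_coef (t k) != 0 by rewrite lead_coef_eq0 -size_poly_eq0 tk.
  by rewrite lead_coefE tk.
have pk0 : p`_k != 0 by move: p0; rewrite -lead_coef_eq0 lead_coefE Ek.
pose a := p`_k / (t k)`_k.
pose p1 := p - a *: t k.
have sp1 : (size p1 <= k)%N.
  apply/leq_sizeP => j; rewrite leq_eqVlt => /predU1P [<-|kj].
    by rewrite coefB coefZ /a mulfVK // subrr.
  by rewrite coefB coefZ !nth_default ?mulr0 ?subrr // ?tk ?Ek.
have [||c sc E] := IHn p1.
- by apply: leq_trans lepn; rewrite Ek ltnS.
- by move=> i ip1; apply: ht; rewrite Ek; apply: leq_trans ip1 (leqW sp1).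
exists (c + a *: 'X^k).
  have a0 : a != 0 by rewrite mulf_neq0 ?invr_eq0.
  by rewrite addrC size_polyDl size_scale // size_polyXn // sc ltnS.
have ck i : (k <= i)%N -> c`_i = 0.
  by move=> ki; rewrite nth_default // sc (leq_trans sp1).
rewrite big_ord_recr /= coefD coefZ coefXn eqxx mulr1 ck // add0r.
have -> : p = p1 + a *: t k by rewrite subrK.
congr (_ + _); rewrite {1}E (big_ord_widen _ (fun i => c`_i *: t i) sp1).
rewrite [LHS]big_mkcond /=; apply: eq_bigr => i _.
rewrite coefD coefZ coefXn (ltn_eqF (ltn_ord i)) mulr0 addr0.
by case: ltnP => // h; rewrite nth_default ?scale0r // sc.
Qed.

(* Coefficients of T^d modulo the monic polynomial
   T^M + g_(M-1) T^(M-1) + ... + g_0. *)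
Fixpoint rem_coef (A : comPzRingType) (M : nat) (g : nat -> A) (d j : nat) : A :=
  if d is d'.+1 then
    (if j is j'.+1 then rem_coef M g d' j' else 0) - rem_coef M g d' M.-1 * g j
  else (j == 0%N)%:R.

Lemma rem_coefP (A : comNzRingType) M (g : nat -> A) (z : A) d :
  z ^+ M.+1 = - \sum_(j < M.+1) g j * z ^+ j ->
  z ^+ d = \sum_(j < M.+1) rem_coef M.+1 g d j * z ^+ j.
Proof.
move=> hz; elim: d => [|d IHd].
  by rewrite expr0 big_ord_recl /= expr0 mulr1 big1 ?addr0 // => i _; rewrite mul0r.
rewrite exprSr {}IHd mulr_suml.
rewrite big_ord_recr /= -mulrA -exprSr hz.
under [RHS]eq_bigr do rewrite mulrBl.
rewrite sumrB [in RHS]big_ord_recl /= mul0r add0r mulrN mulr_sumr.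
congr (_ - _); apply: eq_bigr => i _; first by rewrite -mulrA -exprSr.
by rewrite mulrA.
Qed.

Lemma rmorph_rem_coef (A B : comNzRingType) (f : {rmorphism A -> B}) M g d j :
  f (rem_coef M g d j) = rem_coef M (f \o g) d j.
Proof.
elim: d j => [|d IHd] j /=; first by rewrite rmorph_nat.
by rewrite rmorphB rmorphM IHd /=; case: j => [|j]; rewrite ?rmorph0 ?IHd.
Qed.

Definition vdm (F : comPzRingType) n (u : 'I_n -> F) : F :=
  \prod_(b < n) \prod_(a < n | (a < b)%N) (u b - u a).

Lemma det_vdm (F : comPzRingType) n (u : 'I_n -> F) :
  \det (\matrix_(j < n, i < n) u j ^+ i) = vdm u.
Proof.
rewrite -det_tr.
transitivity (\det (Vandermonde n (\row_j u j))).
  by congr (\det _); apply/matrixP => i j; rewrite !mxE.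
rewrite det_Vandermonde.
rewrite (exchange_big_dep xpredT) //= /vdm; apply: eq_bigr => b _.
by apply: eq_bigr => a _; rewrite !mxE.
Qed.

Definition rem_mx (A : comNzRingType) M (g : nat -> A) (xi : 'I_M -> {poly A}) : 'M[A]_M :=
  \matrix_(l, k) \sum_(d < size (xi k)) (xi k)`_d * rem_coef M g d l.

(** Reducing each column modulo the monic polynomial that vanishes at the nodes factors the
    alternant matrix through the Vandermonde matrix. The cofactor depends on the nodes only through
    [g], and nothing is divided, so nodes may coincide. *)
Lemma det_alternant (A : comNzRingType) M (g : nat -> A) (xi : 'I_M -> {poly A})
    (u : 'I_M -> A) :
  (forall j, u j ^+ M = - \sum_(l < M) g l * u j ^+ l) ->
  \det (\matrix_(j, k) (xi k).[u j]) = vdm u * \det (rem_mx g xi).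
Proof.
case: M xi u => [|M] xi u hu; first by rewrite /vdm !det_mx00 big_ord0 mulr1.
rewrite -det_vdm -det_mulmx; congr (\det _); apply/matrixP => j k; rewrite !mxE.
rewrite horner_coef.
under eq_bigr do rewrite (rem_coefP _ (hu j)) mulr_sumr.
rewrite exchange_big; apply: eq_bigr => l _ /=; rewrite !mxE mulr_sumr.
by apply: eq_bigr => d _; rewrite mulrA mulrC.
Qed.

Lemma vdm_replace (A : comNzRingType) n (u w : 'I_n -> A) (i : 'I_n) :
  (forall j, j != i -> u j = w j) ->
  vdm u * \prod_(j < n | j != i) (w i - w j)
  = vdm w * \prod_(j < n | j != i) (u i - u j).
Proof.
move=> uw.
(* [s j] is the sign that turns the Vandermonde factor of the pair [i], [j] into [v i - v j]. *)
pose s (j : 'I_n) : A := if (j < i)%N then 1 else -1.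
have split_vdm v : vdm v = (\prod_(b < n | b != i) \prod_(a < n | (a < b)%N && (a != i)) (v b - v a))
    * (\prod_(j < n | j != i) s j) * \prod_(j < n | j != i) (v i - v j).
  rewrite /vdm (bigD1 i) //= mulrC -!mulrA.
  rewrite [X in _ = _ * X](_ : _ = \prod_(b < n | b != i) (if (i < b)%N then v b - v i else 1)
      * \prod_(a < n | (a < i)%N) (v i - v a)); last first.
    rewrite -big_split /= [X in _ = _ * X]big_mkcond /=.
    rewrite [X in _ = _ * X](bigD1 i) //= ltnn mul1r -big_split.
    apply: eq_bigr => b bi; rewrite /s; case: (ltngtP b i) bi => [_ _|_ _|/val_inj->]; last by rewrite eqxx.
      by [].
    by rewrite /= mulN1r opprB mulr1.
  rewrite mulrA; congr (_ * _); rewrite -big_split /=; apply: eq_bigr => b bi.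
  case: ifP => ib; last first.
    rewrite mulr1; apply: eq_bigl => a; apply/esym/andb_idr => ab.
    by apply: contraTneq ab => ->; rewrite ib.
  by rewrite (bigD1 i) //= mulrC.
rewrite !split_vdm mulrAC; congr (_ * _ * _).
  congr (_ * _); apply: eq_bigr => b bi; apply: eq_bigr => a /andP[_ ai].
  by rewrite !uw.
Qed.

(** * Casoratians *)

Section Casoratian.

Variables (F : comNzRingType) (M : nat) (xi : nat -> 'I_M -> F).

Definition cas_mx (y : nat) : 'M[F]_M := \matrix_(j, k) xi (y + j)%N k.

Definition cas_ext (f : nat -> F) (x : nat) : F :=
  \det (\matrix_(j < M.+1, k < M.+1)
          if unlift ord_max k is Some i then xi (x + j)%N i else f (x + j)%N).

(** Cramer numerators: divided by [\det (cas_mx y)] they are the coefficients of the combination of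
    the [xi] that agrees with [f] on the M nodes from [y] on. *)
Definition cas_coef (f : nat -> F) (k : 'I_M) (y : nat) : F :=
  \sum_(i < M) \adj (cas_mx y) k i * f (y + i)%N.

Let extmx (f : nat -> F) x := \matrix_(j < M.+1, k < M.+1)
          if unlift ord_max k is Some i then xi (x + j)%N i else f (x + j)%N.

Let cf x (j : 'I_M.+1) := cofactor (extmx (fun=> 0) x) j ord_max.

Let cas_extE f x : cas_ext f x = \sum_(j < M.+1) f (x + j)%N * cf x j.
Proof.
rewrite /cas_ext (expand_det_col _ ord_max); apply: eq_bigr => j _.
rewrite mxE unlift_none; congr (_ * _).
rewrite /cf /cofactor; congr (_ * \det _); apply/matrixP => a b.
by rewrite !mxE !liftK.
Qed.

Lemma cas_ext_sum I (s : seq I) (a : I -> F) (h : I -> nat -> F) (f : nat -> F) x :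
  (forall y, f y = \sum_(i <- s) a i * h i y) ->
  cas_ext f x = \sum_(i <- s) a i * cas_ext (h i) x.
Proof.
move=> fE; rewrite cas_extE; under eq_bigr do rewrite fE mulr_suml.
rewrite exchange_big; apply: eq_bigr => i _ /=; rewrite cas_extE mulr_sumr.
by apply: eq_bigr => j _; rewrite mulrA.
Qed.

Let cf_xi x k : \sum_(j < M.+1) xi (x + j)%N k * cf x j = 0.
Proof.
have -> : \sum_(j < M.+1) xi (x + j)%N k * cf x j = cas_ext (fun y => xi y k) x.
  by rewrite cas_extE.
rewrite /cas_ext -det_tr.
have mk : lift ord_max k != ord_max by rewrite eq_sym neq_lift.
apply: (determinant_alternate mk) => j.
by rewrite !mxE liftK unlift_none.
Qed.

Let cf_max x : cf x ord_max = \det (cas_mx x).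
Proof.
rewrite /cf /cofactor addnn -signr_odd odd_double mul1r; congr (\det _).
apply/matrixP => a b; rewrite !mxE !liftK.
by congr (xi (_ + _)%N _); rewrite -[RHS](lift_max a).
Qed.

Let adj_cramer y (j : 'I_M) (l : 'I_M) :
  \sum_k xi (y + j)%N k * \adj (cas_mx y) k l = \det (cas_mx y) *+ (j == l).
Proof.
have := congr1 (fun A : 'M_M => A j l) (mul_mx_adj (cas_mx y)).
rewrite [RHS]mxE => <-; rewrite [RHS]mxE; apply: eq_bigr => k _.
by congr (_ * _); rewrite mxE.
Qed.

Lemma cas_coef_cramer f y (j : 'I_M) :
  \sum_k xi (y + j)%N k * cas_coef f k y = \det (cas_mx y) * f (y + j)%N.
Proof.
rewrite /cas_coef; under eq_bigr do rewrite mulr_sumr.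
rewrite exchange_big /= (bigD1 j) //= [X in _ + X]big1 ?addr0 => [|i ij].
  under eq_bigr do rewrite mulrA.
  by rewrite -mulr_suml adj_cramer eqxx mulr1n.
under eq_bigr do rewrite mulrA.
by rewrite -mulr_suml adj_cramer eq_sym (negPf ij) mulr0n mul0r.
Qed.

(** The last factor is the Schur complement of the window matrix in the bordered one. The extra
    determinant on both sides replaces an inversion; it is absorbed later by the increment of [X],
    which carries the same factor. *)
Lemma cas_ext_bordered f x :
  \det (cas_mx x) * cas_ext f x
  = \det (cas_mx x) * (\det (cas_mx x) * f (x + M)%N
                       - \sum_k xi (x + M)%N k * cas_coef f k x).
Proof.
have row l : \det (cas_mx x) * cf x (widen_ord (leqnSn M) l)
   = - \det (cas_mx x) * \sum_k xi (x + M)%N k * \adj (cas_mx x) k l.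
  rewrite mulNr mulr_sumr -sumrN.
  transitivity (\sum_k (\sum_(j < M) xi (x + j)%N k * cf x (widen_ord (leqnSn M) j)) *
                  \adj (cas_mx x) k l).
    under [RHS]eq_bigr do rewrite mulr_suml.
    rewrite exchange_big /= (bigD1 l) //= [X in _ + X]big1 ?addr0 => [|j jl].
      under eq_bigr do rewrite mulrAC.
      by rewrite -mulr_suml adj_cramer eqxx.
    under eq_bigr do rewrite mulrAC.
    by rewrite -mulr_suml adj_cramer (negPf jl) mul0r.
  apply: eq_bigr => k _.
  have := cf_xi x k; rewrite big_ord_recr /= cf_max => /eqP.
  rewrite addr_eq0 => /eqP ->; rewrite mulNr mulrA; congr (- (_ * _)).
  exact: mulrC.
rewrite cas_extE big_ord_recr /= cf_max mulrDr addrC mulrBr [f _ * _]mulrC.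
congr (_ + _); rewrite [LHS]big_distrr /=.
under eq_bigr => l _ do rewrite mulrCA row mulNr mulrN.
rewrite sumrN; congr (- _).
transitivity (\sum_(l < M) \det (cas_mx x) *
    \sum_k xi (x + M)%N k * (\adj (cas_mx x) k l * f (x + l)%N)).
  apply: eq_bigr => l _; rewrite mulrCA; congr (_ * _).
  by rewrite big_distrr /=; apply: eq_bigr => k _; ring.
rewrite -big_distrr /=; congr (_ * _); rewrite exchange_big; apply: eq_bigr => k _ /=.
by rewrite /cas_coef big_distrr.
Qed.

(* The function [g] is obtained from
   [sum_k xi_k F_k = f], [F_k = cas_coef f k / det], by summing [X * (F_k(x+1) - F_k(x))]
   by parts; the denominators [det (cas_mx y)] cancel. *)
Lemma cas_ext_intertwine (N : nat) (f c X : nat -> F) (x : nat) :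
  (0 < M)%N -> (forall y, (N < y)%N -> f y = 0) ->
  (forall y, X y.+1 - X y = c y * \det (cas_mx y)) ->
  let g z := X z * f z
    + \sum_k xi z k * \sum_(z <= y < N.+1) c y * cas_coef f k y in
  cas_ext g x = X x.+1 * cas_ext f x.
Proof.
move=> hM f0 hX g.
pose h k y := c y * cas_coef f k y.
have h0 k y : (N < y)%N -> h k y = 0.
  move=> Ny; rewrite /h /cas_coef big1 ?mulr0 // => i _.
  by rewrite f0 ?mulr0 // ltn_addr.
(* The upper limit lies beyond every sum that occurs, so [be k] is the same for all rows and
   contributes a combination of the columns [xi], which the determinant ignores. *)
pose be k := \sum_(x <= y < (x + M + N).+1) h k y.
have big_shift (G : nat -> F) a j : \sum_(a <= y < a + j) G y = \sum_(l < j) G (a + l)%N.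
  rewrite -{1}[a]add0n big_addn addKn big_mkord.
  by apply: eq_bigr => l _; rewrite addnC.
have sumh k j : (j <= M)%N ->
  \sum_(x + j <= y < N.+1) h k y = be k - \sum_(l < j) h k (x + l)%N.
  move=> jM; have -> : \sum_(x + j <= y < N.+1) h k y = \sum_(x + j <= y < (x + M + N).+1) h k y.
    have [xN|xN] := leqP (x + j) N.+1.
      rewrite [RHS](@big_cat_nat _ _ _ N.+1) //=; last by lia.
      rewrite [X in _ + X](_ : _ = 0) ?addr0 // big_nat big1 // => y /andP[Ny _].
      exact: h0.
    rewrite big_geq; last by lia.
    rewrite big_nat big1 // => y /andP[Ny _]; apply: h0; lia.
  rewrite /be [X in X - _](@big_cat_nat _ _ _ (x + j)) //=; try lia.
  by rewrite big_shift addrAC subrr add0r.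
(* The node [x + j] belongs to the window starting at [x + l], so Cramer's rule returns [f (x + j)],
   and the factor [c] times the determinant becomes an increment of [X]. *)
have hxi (j : nat) (l : nat) : (l <= j)%N -> (j - l < M)%N ->
   \sum_k xi (x + j)%N k * h k (x + l)%N = (X (x + l).+1 - X (x + l)%N) * f (x + j)%N.
  move=> lj jl; rewrite hX -mulrA -{2}(subnKC lj) addnA.
  rewrite -(cas_coef_cramer f (x + l) (Ordinal jl)) /= mulr_sumr.
  apply: eq_bigr => k _; rewrite /h mulrCA; congr (_ * (xi _ _ * _)); lia.
have gE j : (j <= M)%N -> g (x + j)%N = X (x + j)%N * f (x + j)%N
    + \sum_k xi (x + j)%N k * be k - \sum_(l < j) \sum_k xi (x + j)%N k * h k (x + l)%N.
  move=> jM; rewrite /g -addrA; congr (_ + _).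
  rewrite exchange_big -sumrB; apply: eq_bigr => k _ /=.
  by rewrite -mulr_sumr -mulrBr -sumh.
have tel j n : (j <= n)%N -> \sum_(i < n - j) (X (x + (i + j)).+1 - X (x + (i + j))%N) = X (x + n)%N - X (x + j)%N.
  move=> jn; rewrite -(big_mkord xpredT (fun i => X (x + (i + j)).+1 - X (x + (i + j))%N)).
  rewrite (telescope_sumr_eq (fun i => X (x + (i + j))%N)) ?leq0n // => [|i _]; last by rewrite -addnS.
  by rewrite add0n subnK.
have gj j : (j < M)%N -> g (x + j)%N = X x * f (x + j)%N + \sum_k xi (x + j)%N k * be k.
  move=> jM; rewrite gE ?(ltnW jM) //.
  rewrite [X in _ - X](eq_bigr (fun l : 'I_j => (X (x + l).+1 - X (x + l)%N) * f (x + j)%N)) => [|l _]; last first.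
    by apply: hxi; have := ltn_ord l; lia.
  rewrite -mulr_suml.
  have := tel 0%N j (leq0n j); rewrite subn0 addn0.
  under eq_bigr do rewrite addn0.
  by move=> ->; ring.
(* The window starting at [x] ends at [x + M - 1], so the term [l = 0] escapes Cramer's rule. Its
   defect is the Schur complement, which turns [X x] into [X x.+1]. *)
have gM : g (x + M)%N = X x * f (x + M)%N + \sum_k xi (x + M)%N k * be k
   + c x * (\det (cas_mx x) * f (x + M)%N - \sum_k xi (x + M)%N k * cas_coef f k x).
  rewrite gE //; have := tel 1%N M hM.
  have -> : \sum_(l < M) \sum_k xi (x + M)%N k * h k (x + l)%N
     = c x * \sum_k xi (x + M)%N k * cas_coef f k x
       + \sum_(l < M - 1) (X (x + (l + 1)).+1 - X (x + (l + 1))%N) * f (x + M)%N.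
    rewrite -(big_mkord xpredT (fun l => \sum_k xi (x + M)%N k * h k (x + l)%N)).
    rewrite big_ltn // addn0 big_distrr /=; congr (_ + _).
      by apply: eq_bigr => k _; rewrite /h mulrCA.
    rewrite (big_addn 0 M 1) big_mkord; apply: eq_bigr => l _; apply: hxi.
    - by have := ltn_ord l; lia.
    - by have := ltn_ord l; lia.
  rewrite -big_distrl /= => ->.
  by rewrite [X in _ = _ + X]mulrBr mulrA -hX addn1; ring.
rewrite cas_extE big_ord_recr /= cf_max gM.
under eq_bigr => j _ do rewrite gj //.
transitivity (X x * cas_ext f x + \sum_k be k * (\sum_(j < M.+1) xi (x + j)%N k * cf x j)
   + c x * (\det (cas_mx x) * cas_ext f x)).
  rewrite cas_ext_bordered cas_extE.
  under [X in _ = _ + X + _]eq_bigr do rewrite mulr_sumr.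
  rewrite exchange_big /= !big_ord_recr /= cf_max.
  under eq_bigr do rewrite mulrDl -mulrA mulr_suml.
  rewrite big_split /= -mulr_sumr.
  under [X in _ + X + _ = _]eq_bigr => j _.
    under eq_bigr do rewrite mulrAC mulrC; over.
  have -> : \sum_i be i * (xi (x + M)%N i * \det (cas_mx x))
    = (\sum_k xi (x + M)%N k * be k) * \det (cas_mx x).
    by rewrite mulr_suml; apply: eq_bigr => k _; ring.
  by ring.
rewrite [X in _ + X + _]big1 => [|k _]; last by rewrite cf_xi mulr0.
by rewrite addr0 mulrA -hX; ring.
Qed.

End Casoratian.

(** * Degree bounds *)

(* [wdeg a b p]: the degree of [p] is at most [b - a], an integer difference. *)
Definition wdeg (F : nzRingType) (a b : nat) (p : {poly F}) : Prop :=
  forall i, (b < a + i)%N -> p`_i = 0.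

Definition wtop (F : nzRingType) (a b : nat) (p : {poly F}) : F :=
  if (a <= b)%N then p`_(b - a) else 0.

Section WeightedDegree.

Variable F : idomainType.
Implicit Types p q : {poly F}.

Lemma wdegM a b a' b' p q :
  wdeg a b p -> wdeg a' b' q -> wdeg (a + a') (b + b') (p * q).
Proof.
move=> hp hq i lt_i; rewrite coefM big1 // => j _.
have [h|h] := ltnP b (a + j); first by rewrite hp ?mul0r.
by rewrite hq ?mulr0 //; have := ltn_ord j; lia.
Qed.

Lemma wtopM a b a' b' p q :
  wdeg a b p -> wdeg a' b' q ->
  wtop (a + a') (b + b') (p * q) = wtop a b p * wtop a' b' q.
Proof.
move=> hp hq; rewrite /wtop.
have [ab|ab] := leqP a b; last first.
  have -> : p = 0 by apply/polyP => i; rewrite hp ?coef0 // ltn_addr.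
  by rewrite !mul0r coef0; case: ifP.
have [ab'|ab'] := leqP a' b'; last first.
  have -> : q = 0 by apply/polyP => i; rewrite hq ?coef0 // ltn_addr.
  by rewrite !mulr0 coef0; case: ifP.
rewrite leq_add // coefM.
have lt_j : (b - a < (b + b' - (a + a')).+1)%N by lia.
rewrite (bigD1 (Ordinal lt_j)) //= [X in _ + X]big1 ?addr0 => [|j jne].
  by congr (_ * q`_ _); lia.
have [h|h] := ltnP b (a + j); first by rewrite hp ?mul0r.
rewrite hq ?mulr0 //; move: jne; rewrite -val_eqE /= => /eqP jne.
by have := ltn_ord j; lia.
Qed.

Lemma wdegD a b p q : wdeg a b p -> wdeg a b q -> wdeg a b (p + q).
Proof. by move=> hp hq i hi; rewrite coefD hp ?hq ?addr0. Qed.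

Lemma wdegB a b p q : wdeg a b p -> wdeg a b q -> wdeg a b (p - q).
Proof. by move=> hp hq i hi; rewrite coefB hp ?hq ?subr0. Qed.

Lemma wdegZ a b c p : wdeg a b p -> wdeg a b (c *: p).
Proof. by move=> hp i hi; rewrite coefZ hp ?mulr0. Qed.

Lemma wtopD a b p q : wtop a b (p + q) = wtop a b p + wtop a b q.
Proof. by rewrite /wtop; case: ifP; rewrite ?coefD ?addr0. Qed.

Lemma wtopB a b p q : wtop a b (p - q) = wtop a b p - wtop a b q.
Proof. by rewrite /wtop; case: ifP; rewrite ?coefB ?subr0. Qed.

Lemma wtopZ a b c p : wtop a b (c *: p) = c * wtop a b p.
Proof. by rewrite /wtop; case: ifP; rewrite ?coefZ ?mulr0. Qed.

Lemma wdeg_shift c a b p : wdeg a b p -> wdeg (c + a) (c + b) p.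
Proof. by move=> hp i hi; apply: hp; lia. Qed.

Lemma wtop_shift c a b p : wtop (c + a) (c + b) p = wtop a b p.
Proof. by rewrite /wtop leq_add2l subnDl. Qed.

Lemma wdeg_le b b' a p : (b <= b')%N -> wdeg a b p -> wdeg a b' p.
Proof. by move=> bb hp i hi; apply: hp; lia. Qed.

Lemma wtop_lt b b' a p : (b < b')%N -> wdeg a b p -> wtop a b' p = 0.
Proof. by move=> bb hp; rewrite /wtop; case: ifP => // ab; apply: hp; lia. Qed.

Lemma wdeg_sum I (r : seq I) (P : pred I) a b (p : I -> {poly F}) :
  (forall i, P i -> wdeg a b (p i)) -> wdeg a b (\sum_(i <- r | P i) p i).
Proof. by move=> hp i hi; rewrite coef_sum big1 // => j Pj; apply: hp. Qed.

Lemma wtop_sum I (r : seq I) (P : pred I) a b (p : I -> {poly F}) :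
  wtop a b (\sum_(i <- r | P i) p i) = \sum_(i <- r | P i) wtop a b (p i).
Proof.
by rewrite /wtop; case: ifP => _; [rewrite coef_sum | rewrite big1].
Qed.

Lemma wdeg_prod I (r : seq I) (a b : I -> nat) (p : I -> {poly F}) :
  (forall i, wdeg (a i) (b i) (p i)) ->
  wdeg (\sum_(i <- r) a i) (\sum_(i <- r) b i) (\prod_(i <- r) p i) /\
  wtop (\sum_(i <- r) a i) (\sum_(i <- r) b i) (\prod_(i <- r) p i)
    = \prod_(i <- r) wtop (a i) (b i) (p i).
Proof.
move=> hp; elim: r => [|i r [IH1 IH2]].
  rewrite !big_nil; split=> [i|]; last by rewrite /wtop /= coef1.
  by rewrite coef1; case: i.
by rewrite !big_cons wtopM // IH2; split=> //; apply: wdegM.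
Qed.

(** The entry in row l and column k has degree at most [e k - l], so all terms of the Leibniz
    expansion obey one bound, whatever the permutation. Single differences may be negative, which is
    why both numbers are kept. *)
Lemma wdeg_det M (A : 'M[{poly F}]_M) (e : 'I_M -> nat) :
  (forall l k : 'I_M, wdeg l (e k) (A l k)) ->
  wdeg (\sum_(l < M) l) (\sum_k e k) (\det A) /\
  wtop (\sum_(l < M) l) (\sum_k e k) (\det A)
    = \det (\matrix_(l, k) wtop l (e k) (A l k)).
Proof.
move=> hA.
pose q (s : {perm 'I_M}) := \prod_i A i (s i).
have hq (s : {perm 'I_M}) : wdeg (\sum_(l < M) l) (\sum_k e k) (q s) /\
    wtop (\sum_(l < M) l) (\sum_k e k) (q s) = \prod_(i < M) wtop i (e (s i)) (A i (s i)).
  have -> : \sum_k e k = \sum_k e (s k) by rewrite (reindex_inj (@perm_inj _ s)).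
  exact: (wdeg_prod (index_enum 'I_M) (fun i => hA i (s i))).
have -> : \det A = \sum_(s : {perm 'I_M}) (-1) ^+ s *: q s.
  by apply: eq_bigr => s _; rewrite -mul_polyC rmorphXn rmorphN rmorph1.
split.
  by apply: wdeg_sum => s _; apply/wdegZ/(hq s).1.
rewrite wtop_sum; apply: eq_bigr => s _; rewrite wtopZ (hq s).2; congr (_ * _).
by apply: eq_bigr => i _; rewrite mxE.
Qed.

(** With the variable of weight 1 and [g i] of weight [M.+1 - i] the division is homogeneous, so it
    commutes with taking top coefficients. *)
Lemma wdeg_rem_coef M (g : nat -> {poly F}) d l :
  (forall i, (i <= M)%N -> wdeg i M.+1 (g i)) -> (l <= M)%N ->
  wdeg l d (rem_coef M.+1 g d l) /\
  wtop l d (rem_coef M.+1 g d l) = rem_coef M.+1 (fun i => wtop i M.+1 (g i)) d l.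
Proof.
move=> hg; elim: d l => [|d IHd] l lM /=.
  split=> [i|]; last by rewrite /wtop; case: l lM => [|l] _ //=; rewrite mulr1n coef1.
  by case: l lM => [|l] _ /=; rewrite ?mulr1n ?mulr0n ?coef1 ?coef0 //; case: i.
have [Hd Ht] := IHd M (leqnn M).
have H1 : wdeg l d.+1 (rem_coef M.+1 g d M * g l).
  move=> i hi; apply: (wdegM Hd (hg _ lM)); lia.
have T1 : wtop l d.+1 (rem_coef M.+1 g d M * g l)
    = rem_coef M.+1 (fun i => wtop i M.+1 (g i)) d M * wtop l M.+1 (g l).
  by rewrite -Ht -(wtopM Hd (hg _ lM)) (_ : d + M.+1 = M + d.+1)%N ?wtop_shift //; lia.
case: l lM H1 T1 => [|l] lM H1 T1.
  split; first by apply: wdegB => // i _; rewrite coef0.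
  by rewrite wtopB T1 /wtop coef0.
have [Hl Tl] := IHd l (ltnW lM); split; first by apply: wdegB => // i hi; apply: Hl; lia.
by rewrite wtopB T1 -Tl -(wtop_shift 1).
Qed.

End WeightedDegree.

(** * Sparse polynomials with many zeros *)

Section FewTerms.

Variable F : numFieldType.

Lemma rem_coef_dvdp M (g : nat -> F) d :
  'X^(M.+1) + \poly_(l < M.+1) g l %| 'X^d - \poly_(l < M.+1) rem_coef M.+1 g d l.
Proof.
set G := _ + _; set R := fun d => \poly_(l < M.+1) rem_coef M.+1 g d l.
elim: d => [|d IHd].
  rewrite (_ : 'X^0 - _ = 0) ?dvdp0 //; apply/polyP => i.
  rewrite expr0 coefB coef_poly coef1 coef0 /=.
  by case: i => [|i] /=; rewrite ?subrr //; case: ifP; rewrite subrr.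
have -> : 'X^(d.+1) - R d.+1 = ('X^d - R d) * 'X + (rem_coef M.+1 g d M)%:P * G.
  rewrite exprSr mulrBl -addrA; congr (_ + _); apply/eqP.
  rewrite eq_sym addrC subr_eq addrC; apply/eqP/polyP => i.
  rewrite /G mulrDr !coefD coefN coefCM coefXn coefCM coefMX !coef_poly /=.
  case: i => [|i] /=; first by ring.
  rewrite eqSS [(i.+1 < _)%N]ltnS; case: (ltngtP i M) => [iM|iM|->].
  - by rewrite ltnS (ltnW iM) mulr0n; ring.
  - by rewrite ltnS leqNgt iM mulr0n /=; ring.
  - by rewrite ltnSn mulr1n; ring.
by apply: dvdp_add; [apply: dvdp_mulr | apply: dvdp_mull].
Qed.

Lemma sparse_root1 (ds : seq nat) (c : nat -> F) :
  uniq ds -> ('X - 1%:P) ^+ size ds %| \sum_(d <- ds) c d *: 'X^d ->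
  {in ds, forall d, c d = 0}.
Proof.
elim: ds c => [|e ds IHds] c //= /andP[eds uds] hdvd.
have e0 : {in ds, forall d, c d = 0}.
  (* [X f' - e f] loses the monomial [X^e] and only one factor [X - 1]. *)
  have /IHds h : ('X - 1%:P) ^+ size ds %| \sum_(d <- ds) (c d * (d%:R - e%:R)) *: 'X^d.
    set f := \sum_(d <- e :: ds) c d *: 'X^d in hdvd.
    have -> : \sum_(d <- ds) (c d * (d%:R - e%:R)) *: 'X^d = 'X * f^`() - e%:R *: f.
      rewrite /f raddf_sum mulr_sumr scaler_sumr -sumrB big_cons /=.
      have term d : 'X * (c d *: 'X^d)^`() - e%:R *: (c d *: 'X^d)
          = (c d * (d%:R - e%:R)) *: 'X^d.
        rewrite derivZ derivXn; case: d => [|d].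
          by rewrite mulr0n scaler0 mulr0 !sub0r scalerA -scaleNr; congr (_ *: _); ring.
        rewrite /= -scalerAr mulrnAr -exprS -scaler_nat !scalerA -scalerBl.
        by congr (_ *: _); ring.
      by rewrite term subrr mulr0 scale0r add0r; apply: eq_bigr => d _; rewrite term.
    have /dvdpP[g ->] := hdvd.
    rewrite derivM deriv_exp derivB derivX derivC subr0 mul1r exprS /=.
    rewrite -!mul_polyC; apply/dvdpP.
    exists ('X * (g^`() * ('X - 1%:P) + (size ds).+1%:R * g) - e%:R%:P * g * ('X - 1%:P)).
    by rewrite -mulr_natl; ring.
  move=> d dds; have /eqP := h uds d dds.
  rewrite mulf_eq0 subr_eq0 eqr_nat => /orP[/eqP //|/eqP de].
  by rewrite -de dds in eds.
move=> d; rewrite inE => /predU1P[->|]; last exact: e0.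
move: hdvd; rewrite big_cons [X in _ %| _ + X]big_seq [X in _ %| _ + X]big1 ?addr0; last first.
  by move=> i ids; rewrite e0 ?scale0r.
move=> /(dvdp_trans (dvdp_exp2l _ (ltn0Sn _))); rewrite expr1 dvdp_XsubCl.
by rewrite rootE hornerZ hornerXn expr1n mulr1 => /eqP.
Qed.

Lemma sparse_roots (q : F) (ds : seq nat) (c : nat -> F) :
  q != 0 -> injective (fun n : nat => q ^+ n) -> uniq ds ->
  (forall j, (j < size ds)%N -> (\sum_(d <- ds) c d *: 'X^d).[q ^+ j] = 0) ->
  {in ds, forall d, c d = 0}.
Proof.
move=> q0 qi; elim: ds c => [|e ds IHds] c //= /andP[eds uds] hr.
have e0 : {in ds, forall d, c d = 0}.
  (* [f(q X) - q^e f(X)] loses the monomial [X^e] and only one root. *)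
  suff h : {in ds, forall d, c d * (q ^+ d - q ^+ e) = 0}.
    move=> d dds; have /eqP := h d dds.
    rewrite mulf_eq0 subr_eq0 => /orP[/eqP//|/eqP/qi de].
    by rewrite -de dds in eds.
  apply: (IHds (fun d => c d * (q ^+ d - q ^+ e)) uds) => j jds.
  have h1 := hr j.+1 jds; have h2 := hr j (ltnW jds).
  move/(congr1 (fun z => q ^+ e * z)): h2; rewrite mulr0 => h2.
  rewrite -[RHS](subrr 0) -{1}h1 -h2 !big_cons !hornerD mulrDr.
  have term d' : (c d' *: 'X^d').[q ^+ j.+1] - q ^+ e * (c d' *: 'X^d').[q ^+ j]
     = ((c d' * (q ^+ d' - q ^+ e)) *: 'X^d').[q ^+ j].
    by rewrite !hornerZ !hornerXn exprS exprMn; ring.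
  rewrite opprD addrACA term subrr mulr0 scale0r horner0 add0r !horner_sum mulr_sumr -sumrB.
  by apply: eq_bigr => d' _; rewrite term.
move=> d; rewrite inE => /predU1P[->|]; last exact: e0.
have := hr 0%N (ltn0Sn _).
rewrite big_cons [X in (_ + X).[_]]big_seq [X in (_ + X).[_]]big1 ?addr0; last first.
  by move=> i ids; rewrite e0 ?scale0r.
by rewrite hornerZ hornerXn expr0 expr1n mulr1.
Qed.

(** A linear relation between the columns is a nonzero combination of M monomials divisible by the
    product of the ['X - q ^+ j]. It would have a zero of order M at 1, or the M zeros [q ^+ j],
    which is too many for M terms. *)
Lemma det_rem_coef_neq0 M (q : F) (g : nat -> F) (d : 'I_M -> nat) :
  q = 1 \/ (q != 0 /\ injective (fun n : nat => q ^+ n)) ->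
  (forall i, (i < M)%N -> g i = (\prod_(j < M) ('X - (q ^+ j)%:P))`_i) ->
  injective d -> \det (\matrix_(l < M, k < M) rem_coef M g (d k) l) != 0.
Proof.
case: M d => [|M] d hq hg di; first by rewrite det_mx00 oner_neq0.
set G := \prod_(j < M.+1) _ in hg.
have GE : 'X^(M.+1) + \poly_(l < M.+1) g l = G.
  have sG : size G = M.+2 by rewrite size_prod_XsubC /index_enum -enumT size_enum_ord.
  have lG : lead_coef G = 1 by apply/eqP/monic_prod_XsubC.
  apply/polyP => i; rewrite coefD coefXn coef_poly.
  case: ltngtP => [iM|iM|->]; first by rewrite add0r hg.
    by rewrite addr0 nth_default // sG.
  by rewrite addr0 -lG lead_coefE sG.
rewrite -det_tr; apply/det0P => -[v v0 vA].
have vA0 l : (l < M.+1)%N -> \sum_k v 0 k * rem_coef M.+1 g (d k) l = 0.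
  move=> lM; have := congr1 (fun w : 'rV_M.+1 => w 0 (Ordinal lM)) vA.
  rewrite !mxE => E; rewrite -[RHS]E; apply: eq_bigr => k _; by rewrite !mxE.
have Gdvd : G %| \sum_k v 0 k *: 'X^(d k).
  have -> : \sum_k v 0 k *: 'X^(d k) = \sum_k v 0 k *:
      ('X^(d k) - \poly_(l < M.+1) rem_coef M.+1 g (d k) l).
    under [RHS]eq_bigr do rewrite scalerBr; rewrite sumrB.
    rewrite [X in _ = _ - X](_ : _ = 0) ?subr0 //; apply/polyP => i.
    rewrite coef_sum coef0; under eq_bigr do rewrite coefZ coef_poly.
    have [iM|iM] := ltnP i M.+1; first exact: vA0.
    by rewrite big1 // => k _; rewrite mulr0.
  rewrite -GE; elim/big_ind: _ => [|p p'|k _]; first exact: dvdp0.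
    exact: dvdp_add.
  by rewrite -mul_polyC dvdp_mull // rem_coef_dvdp.
pose ds := [seq d k | k <- enum 'I_M.+1].
pose c e := \sum_(k | d k == e) v 0 k.
have cd k : c (d k) = v 0 k.
  rewrite /c (big_pred1 k) // => k'; exact: inj_eq.
have uds : uniq ds by rewrite map_inj_uniq ?enum_uniq.
have sds : size ds = M.+1 by rewrite size_map size_enum_ord.
have fE : \sum_k v 0 k *: 'X^(d k) = \sum_(e <- ds) c e *: 'X^e.
  by rewrite big_map big_enum /=; apply: eq_big => // k _; rewrite cd.
have c0 : {in ds, forall e, c e = 0}.
  case: hq => [q1|[q0 qi]].
    apply: sparse_root1 => //; rewrite sds -fE; move: Gdvd; rewrite /G q1.
    under eq_bigr do rewrite expr1n.
    by rewrite prodr_const card_ord.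
  apply: (sparse_roots q0 qi) => // j; rewrite sds -fE => jM.
  have /dvdpP[h ->] := Gdvd; rewrite hornerM /G (bigD1 (Ordinal jM)) //= hornerM.
  by rewrite hornerXsubC subrr mul0r mulr0.
case/eqP: v0; apply/rowP => k; rewrite mxE -cd; apply: c0.
by apply: map_f; rewrite mem_enum.
Qed.

End FewTerms.

(* [tdeg a b f]: [f t s v] is a polynomial in [t, s, v] of total degree at most
   [b - a], an integer difference. *)
Definition tdeg (F : comNzRingType) (a b : nat) (f : F -> F -> F -> F) : Prop :=
  exists2 r : seq (F * (nat * nat * nat)),
    (forall m, m \in r -> (a + (m.2.1.1 + m.2.1.2 + m.2.2) <= b)%N) &
    forall t s v, f t s v =
      \sum_(m <- r) m.1 * (t ^+ m.2.1.1 * s ^+ m.2.1.2 * v ^+ m.2.2).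

Section TotalDegree.

Variable F : comNzRingType.
Implicit Types f g : F -> F -> F -> F.

Lemma tdeg_ext a b f g : (forall t s v, f t s v = g t s v) -> tdeg a b f -> tdeg a b g.
Proof. by move=> fg [r hr E]; exists r => // t s v; rewrite -fg. Qed.

Lemma tdeg_mon a b (c : F) i j k :
  (a + (i + j + k) <= b)%N -> tdeg a b (fun t s v => c * (t ^+ i * s ^+ j * v ^+ k)).
Proof.
move=> h; exists [:: (c, (i, j, k))] => [m|t s v]; last by rewrite big_seq1.
by rewrite inE => /eqP->.
Qed.

Lemma tdeg0 a b : @tdeg F a b (fun _ _ _ => 0).
Proof. by exists [::] => // t s v; rewrite big_nil. Qed.

Lemma tdegD a b f g : tdeg a b f -> tdeg a b g -> tdeg a b (fun t s v => f t s v + g t s v).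
Proof.
move=> [r hr E] [r' hr' E']; exists (r ++ r') => [m|t s v].
  by rewrite mem_cat => /orP[/hr|/hr'].
by rewrite big_cat E E'.
Qed.

Lemma tdegM a b a' b' f g : tdeg a b f -> tdeg a' b' g ->
  tdeg (a + a') (b + b') (fun t s v => f t s v * g t s v).
Proof.
move=> [r hr E] [r' hr' E'].
exists [seq (m.1 * m'.1, (m.2.1.1 + m'.2.1.1, m.2.1.2 + m'.2.1.2, m.2.2 + m'.2.2)%N)
       | m <- r, m' <- r'].
  move=> _ /allpairsP[[[c [[i j] k]] [c' [[i' j'] k']]] /= [/hr h /hr' h' ->]] /=; move: h h' => /=; lia.
move=> t s v; rewrite big_allpairs_dep E E' mulr_suml; apply: eq_bigr => m _.
by rewrite mulr_sumr; apply: eq_bigr => m' _ /=; rewrite !exprD; ring.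
Qed.

Lemma tdeg_const a b (c : F) : (a <= b)%N -> tdeg a b (fun _ _ _ => c).
Proof.
move=> ab; apply: (@tdeg_ext _ _ (fun t s v => c * (t ^+ 0 * s ^+ 0 * v ^+ 0))).
  by move=> t s v; rewrite !expr0 !mulr1.
by apply: tdeg_mon; rewrite !addn0.
Qed.

Lemma tdeg_le a b a' b' f : (b + a' <= b' + a)%N -> tdeg a b f -> tdeg a' b' f.
Proof. by move=> h [r hr E]; exists r => // m /hr; lia. Qed.

Lemma tdegZ a b c f : tdeg a b f -> tdeg a b (fun t s v => c * f t s v).
Proof. exact: (@tdegM 0 0 a b (fun _ _ _ => c) f (tdeg_const _ _)). Qed.

Lemma tdegN a b f : tdeg a b f -> tdeg a b (fun t s v => - f t s v).
Proof. by move/(tdegZ (-1)); apply: tdeg_ext => t s v; rewrite mulN1r. Qed.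

Lemma tdegB a b f g : tdeg a b f -> tdeg a b g -> tdeg a b (fun t s v => f t s v - g t s v).
Proof. by move=> hf /tdegN hg; apply: tdegD. Qed.

Lemma tdeg_sum I (r : seq I) a b (f : I -> F -> F -> F -> F) :
  (forall i, tdeg a b (f i)) -> tdeg a b (fun t s v => \sum_(i <- r) f i t s v).
Proof.
move=> hf; elim: r => [|i r IHr].
  by apply: tdeg_ext (tdeg0 a b) => t s v; rewrite big_nil.
by apply: tdeg_ext (tdegD (hf i) IHr) => t s v; rewrite big_cons.
Qed.

Lemma tdeg_prod I (r : seq I) (a b : I -> nat) (f : I -> F -> F -> F -> F) :
  (forall i, tdeg (a i) (b i) (f i)) ->
  tdeg (\sum_(i <- r) a i) (\sum_(i <- r) b i) (fun t s v => \prod_(i <- r) f i t s v).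
Proof.
move=> hf; elim: r => [|i r IHr].
  by rewrite !big_nil; apply: tdeg_ext (tdeg_const 1 (leqnn 0)) => t s v; rewrite big_nil.
by rewrite !big_cons; apply: tdeg_ext (tdegM (hf i) IHr) => t s v; rewrite big_cons.
Qed.

Lemma tdeg_horner a b (p : {poly F}) :
  (forall i, (b < a + i)%N -> p`_i = 0) -> tdeg a b (fun _ _ v => p.[v]).
Proof.
move=> hp; apply: (@tdeg_ext _ _ (fun t s v => \sum_(i < size p) p`_i * (t ^+ 0 * s ^+ 0 * v ^+ i))).
  by move=> t s v; rewrite horner_coef; apply: eq_bigr => i _; rewrite !mul1r.
apply: tdeg_sum => i; have [h|h] := leqP (a + i) b; first exact: tdeg_mon.
by apply: tdeg_ext (tdeg0 a b) => t s v; rewrite hp ?mul0r.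
Qed.

Lemma tdeg_det M (A : 'I_M -> 'I_M -> F -> F -> F -> F) (e : 'I_M -> nat) :
  (forall l k : 'I_M, tdeg l (e k) (A l k)) ->
  tdeg (\sum_(l < M) l) (\sum_k e k) (fun t s v => \det (\matrix_(l, k) A l k t s v)).
Proof.
move=> hA.
apply: (@tdeg_ext _ _ (fun t s v => \sum_(p : {perm 'I_M}) (-1) ^+ p * \prod_(i < M) A i (p i) t s v)).
  move=> t s v; apply: eq_bigr => p _; congr (_ * _); apply: eq_bigr => i _.
  by rewrite mxE.
apply: tdeg_sum => p; apply: tdegZ.
have -> : \sum_k e k = \sum_k e (p k) by rewrite (reindex_inj (@perm_inj _ p)).
exact: (tdeg_prod (index_enum 'I_M) (fun i => hA i (p i))).
Qed.

Lemma tdeg_rem_coef M (g : nat -> F -> F -> F -> F) d l :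
  (forall i, (i <= M)%N -> tdeg i M.+1 (g i)) -> (l <= M)%N ->
  tdeg l d (fun t s v => rem_coef M.+1 (fun i => g i t s v) d l).
Proof.
move=> hg; elim: d l => [|d IHd] l lM /=.
  by case: l lM => [|l] _; [apply: tdeg_const | apply: tdeg0].
apply: tdegB.
  case: l lM => [|l] lM; first exact: tdeg0.
  by apply: tdeg_le (IHd l (ltnW lM)); lia.
by apply: tdeg_le (tdegM (IHd M (leqnn M)) (hg l lM)); lia.
Qed.

End TotalDegree.

(** * Quadratic lattices *)

(* Leading coefficients of the even and odd parts of the [n]-th power. *)
Fixpoint eo_lead (F : nzRingType) (a b q : F) (n : nat) : F * F :=
  if n is n'.+1 then
    let: (e, o) := eo_lead a b q n' in (a * e + b * q * o, a * o + b * e)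
  else (1, 0).

(* [lev s x] is eta(x; lambda + s delta).  [lev m] is invariant under a reflection of x
   (x <-> - x - m - d for Racah) under which [asym m] is odd; [levJ] is the reflection
   of [levE].  [leps] is the limit of [asym m / lev m] as x tends to +oo, and [lom] that
   of [lev s (x + 1) / lev s x]: (0, 1) for Racah, (1, 1 / q) for q-Racah. *)
Record lattice (F : fieldType) := Lattice {
  lev : int -> F -> F;
  asym : int -> F -> F;
  lla : int -> int -> int -> F;
  llb : int -> int -> int -> F;
  llc : int -> int -> int -> F;
  lq2 : F; lq1 : int -> F; lq0 : int -> F;
  leps : F; lom : F; lbr : nat -> F;
  levE : forall s k m y,
    lev s (y + k%:~R) = lla s k m * lev m y + llc s k m + llb s k m * asym m y;
  levJ : forall s k m y,
    lev s (y + (m - s - k)%:~R) = lla s k m * lev m y + llc s k m - llb s k m * asym m y;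
  asym_sqr : forall m y, asym m y ^+ 2 = lq2 * lev m y ^+ 2 + lq1 m * lev m y + lq0 m;
  leps_sqr : leps ^+ 2 = lq2;
  lom_neq0 : lom != 0;
  lom_inj : lom = 1 \/ (lom != 0 /\ injective (fun n : nat => lom ^+ n));
  lla_lom : forall s k m, lla s k m + leps * llb s k m = lom ^ k;
  llaJ_lom : forall s k m, lla s k m - leps * llb s k m = lom ^ (m - s - k);
  lbrE : forall (j : nat) y, lev 0 (y + j%:R) - lev 0 y = lbr j * asym j%:Z y;
  lbr_neq0 : forall j, (0 < j)%N -> lbr j != 0;
  lla_step : forall r, lla (r + 1) 0 r = lla 1 0 0;
  llb_step : forall r, llb (r + 1) 0 r = llb 1 0 0;
  llb_neq0 : llb 1 0 0 != 0;
  odd_lead_neq0 : forall n, (0 < n)%N -> (eo_lead (lla 1 0 0) (llb 1 0 0) lq2 n).2 != 0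
}.

Section Lattice.

Variables (F : numFieldType) (L : lattice F).
Local Notation lev := (lev L).
Local Notation asym := (asym L).

Let quad m : {poly F} := lq2 L *: 'X^2 + lq1 L m *: 'X + (lq0 L m)%:P.

(** Even and odd parts of the n-th power of [lev s (y + k)] about the centre of [lev m]: [h] is the
    even part of the base, and [quad m] stands for the square of [asym m]. *)
Fixpoint eo_pow (s k m : int) (n : nat) : {poly F} * {poly F} :=
  if n is n'.+1 then
    let: (e, o) := eo_pow s k m n' in
    let h := lla L s k m *: 'X + (llc L s k m)%:P in
    (h * e + llb L s k m *: (quad m * o), h * o + llb L s k m *: e)
  else (1, 0).

Definition evp s k m (p : {poly F}) := \sum_(i < size p) p`_i *: (eo_pow s k m i).1.
Definition odp s k m (p : {poly F}) := \sum_(i < size p) p`_i *: (eo_pow s k m i).2.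

Let quadE m y : (quad m).[lev m y] = asym m y ^+ 2.
Proof. by rewrite asym_sqr /quad !hornerE. Qed.

Let eo_powE s k m n y :
  lev s (y + k%:~R) ^+ n = (eo_pow s k m n).1.[lev m y] + asym m y * (eo_pow s k m n).2.[lev m y]
  /\ lev s (y + (m - s - k)%:~R) ^+ n
     = (eo_pow s k m n).1.[lev m y] - asym m y * (eo_pow s k m n).2.[lev m y].
Proof.
elim: n => [|n [IH1 IH2]] /=; first by rewrite !hornerE ?mulr0 ?addr0 ?subr0.
move: IH1 IH2; case: (eo_pow s k m n) => e o /= IH1 IH2.
rewrite !exprS IH1 IH2 levJ (levE L s k m).
by rewrite !(quadE, hornerD, hornerM, hornerZ, hornerX, hornerC); split; ring.
Qed.

Lemma evodE s k m p y :
  p.[lev s (y + k%:~R)] = (evp s k m p).[lev m y] + asym m y * (odp s k m p).[lev m y].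
Proof.
rewrite horner_coef /evp /odp !horner_sum mulr_sumr -big_split; apply: eq_bigr => i _ /=.
by rewrite !hornerZ (eo_powE s k m i y).1; ring.
Qed.

Lemma evodJ s k m p y : p.[lev s (y + (m - s - k)%:~R)]
  = (evp s k m p).[lev m y] - asym m y * (odp s k m p).[lev m y].
Proof.
rewrite horner_coef /evp /odp !horner_sum mulr_sumr -sumrB; apply: eq_bigr => i _ /=.
by rewrite !hornerZ (eo_powE s k m i y).2; ring.
Qed.

Let eo_pow_size s k m n :
  [/\ wdeg 0 n (eo_pow s k m n).1, wdeg 1 n (eo_pow s k m n).2
    & (wtop 0 n (eo_pow s k m n).1, wtop 1 n (eo_pow s k m n).2)
      = eo_lead (lla L s k m) (llb L s k m) (lq2 L) n].
Proof.
have hlin : wdeg 0 1 (lla L s k m *: 'X + (llc L s k m)%:P)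
   /\ wtop 0 1 (lla L s k m *: 'X + (llc L s k m)%:P) = lla L s k m.
  split=> [i|]; last by rewrite /wtop /= coefD coefZ coefX coefC /= mulr1 addr0.
  by rewrite coefD coefZ coefX coefC; case: i => [|[|i]] //=; rewrite mulr0 addr0.
have hq : wdeg 0 2 (quad m) /\ wtop 0 2 (quad m) = lq2 L.
  split=> [i|]; last by rewrite /wtop /= !(coefD, coefZ, coefX, coefXn, coefC) /= mulr1 mulr0 !addr0.
  by rewrite !(coefD, coefZ, coefX, coefXn, coefC); case: i => [|[|[|i]]] //=; rewrite !mulr0 !addr0.
elim: n => [|n [IH1 IH2 IH3]] /=.
  split; [by move=> i; rewrite coef1; case: i | by move=> i; rewrite coef0 |].
  by rewrite /wtop /= coef1.
move: IH1 IH2 IH3; case: (eo_pow s k m n) => e o /= he ho.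
case: (eo_lead _ _ _ n) => te to [<- <-].
have he1 : wdeg 0 n.+1 ((lla L s k m *: 'X + (llc L s k m)%:P) * e) by apply: (wdegM hlin.1 he).
have ho1 : wdeg 1 n.+1 ((lla L s k m *: 'X + (llc L s k m)%:P) * o) by apply: (wdegM hlin.1 ho).
have hqo : wdeg 0 n.+1 (quad m * o).
  by move=> i hi; apply: (wdegM hq.1 ho); lia.
have he2 : wdeg 1 n.+1 e by move=> i hi; apply: he; lia.
split; [by apply/wdegD/wdegZ | by apply/wdegD/wdegZ |].
have T1 : wtop 0 n.+1 ((lla L s k m *: 'X + (llc L s k m)%:P) * e) = lla L s k m * wtop 0 n e.
  exact: etrans (wtopM hlin.1 he) (congr1 ( *%R^~ _) hlin.2).
have T2 : wtop 1 n.+1 ((lla L s k m *: 'X + (llc L s k m)%:P) * o) = lla L s k m * wtop 1 n o.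
  exact: etrans (wtopM hlin.1 ho) (congr1 ( *%R^~ _) hlin.2).
have T3 : wtop 0 n.+1 (quad m * o) = lq2 L * wtop 1 n o.
  rewrite -(wtop_shift 1); exact: etrans (wtopM hq.1 ho) (congr1 ( *%R^~ _) hq.2).
by rewrite !wtopD !wtopZ T1 T2 T3 mulrA -[wtop 1 n.+1 e](wtop_shift 1 0 n).
Qed.

Lemma evp_size s k m p : (size (evp s k m p) <= size p)%N.
Proof.
apply/leq_sizeP => j hj; rewrite coef_sum big1 // => i _; rewrite coefZ.
by have [h _ _] := eo_pow_size s k m i; rewrite h ?mulr0 //; have := ltn_ord i; lia.
Qed.

Lemma odp_size s k m p : (size (odp s k m p) <= (size p).-1)%N.
Proof.
apply/leq_sizeP => j hj; rewrite coef_sum big1 // => i _; rewrite coefZ.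
by have [_ h _] := eo_pow_size s k m i; rewrite h ?mulr0 //; have := ltn_ord i; lia.
Qed.

Let lead n := eo_lead (lla L 1 0 0) (llb L 1 0 0) (lq2 L) n.

Lemma evp_Xn_top r n : wtop 0 n (evp (r + 1) 0 r 'X^n) = (lead n).1.
Proof.
have [_ _] := eo_pow_size (r + 1) 0 r n; rewrite lla_step llb_step /lead => <- /=.
rewrite /evp size_polyXn big_ord_recr /= coefXn eqxx scale1r big1 ?add0r // => i _.
by rewrite coefXn ltn_eqF ?scale0r.
Qed.

Lemma odp_Xn_top r n : wtop 1 n (odp (r + 1) 0 r 'X^n) = (lead n).2.
Proof.
have [_ _] := eo_pow_size (r + 1) 0 r n; rewrite lla_step llb_step /lead => <- /=.
rewrite /odp size_polyXn big_ord_recr /= coefXn eqxx scale1r big1 ?add0r // => i _.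
by rewrite coefXn ltn_eqF ?scale0r.
Qed.

Lemma evp_widen s k m n (p : {poly F}) : (size p <= n)%N ->
  evp s k m p = \sum_(i < n) p`_i *: (eo_pow s k m i).1.
Proof.
move=> h; rewrite /evp (big_ord_widen _ (fun i => p`_i *: (eo_pow s k m i).1) h) big_mkcond /=.
by apply: eq_bigr => i _; case: ltnP => // hi; rewrite nth_default ?scale0r.
Qed.

Lemma odp_widen s k m n (p : {poly F}) : (size p <= n)%N ->
  odp s k m p = \sum_(i < n) p`_i *: (eo_pow s k m i).2.
Proof.
move=> h; rewrite /odp (big_ord_widen _ (fun i => p`_i *: (eo_pow s k m i).2) h) big_mkcond /=.
by apply: eq_bigr => i _; case: ltnP => // hi; rewrite nth_default ?scale0r.
Qed.

Lemma evp_linear s k m : linear (evp s k m).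
Proof.
move=> a p q; pose n := maxn (size (a *: p + q)) (maxn (size p) (size q)).
rewrite !(@evp_widen s k m n) /n ?leq_max ?leqnn ?orbT // scaler_sumr -big_split.
by apply: eq_bigr => i _ /=; rewrite coefD coefZ scalerDl scalerA.
Qed.

Lemma odp_linear s k m : linear (odp s k m).
Proof.
move=> a p q; pose n := maxn (size (a *: p + q)) (maxn (size p) (size q)).
rewrite !(@odp_widen s k m n) /n ?leq_max ?leqnn ?orbT // scaler_sumr -big_split.
by apply: eq_bigr => i _ /=; rewrite coefD coefZ scalerDl scalerA.
Qed.

Lemma linear_sumZ (V : lmodType F) (f : {poly F} -> V) n (a : nat -> F) (p : nat -> {poly F}) :
  linear f -> f (\sum_(i < n) a i *: p i) = \sum_(i < n) a i *: f (p i).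
Proof.
move=> fl; have f0 : f 0 = 0 by have := fl (-1) 0 0; rewrite scaler0 addr0 scaleN1r addNr.
elim: n => [|n IHn]; first by rewrite !big_ord0.
by rewrite !big_ord_recr /= addrC fl IHn addrC.
Qed.

Lemma size_exact (p : {poly F}) n : wdeg 0 n p -> p`_n != 0 -> size p = n.+1.
Proof.
move=> hp pn; apply/eqP; rewrite eqn_leq; apply/andP; split.
  by apply/leq_sizeP => j hj; apply: hp.
by rewrite ltnNge; apply: contra pn => /leq_sizeP->.
Qed.

(** Only the odd part of [Q] survives in the difference, so the equation reads [odp Q = llb *: p].
    The odd part of ['X^(n.+1)] has exact degree n, hence the system is triangular. Using no
    constant term gives [Q.[0] = 0]. This is the existence behind [Imap]. *)
Lemma lev_difference_inv r (p : {poly F}) : p != 0 ->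
  exists Q : {poly F}, [/\ Q.[0] = 0, size Q = (size p).+1 &
    forall y, Q.[lev (r + 1) y] - Q.[lev (r + 1) (y - 1)]
      = (lev (r + 1) y - lev (r + 1) (y - 1)) * p.[lev r y]].
Proof.
move=> p0; have b0 := llb_neq0 L.
pose t n := odp (r + 1) 0 r 'X^(n.+1).
have [|c sc E] := @triangular_poly_basis _ t (llb L 1 0 0 *: p).
  move=> n _; apply: size_exact => [i hi|].
    apply: nth_default; apply: leq_trans (odp_size _ _ _ _) _.
    by rewrite size_polyXn.
  have := odd_lead_neq0 L (ltn0Sn n); rewrite -/(lead n.+1) -(odp_Xn_top r).
  by rewrite /wtop /= subSS subn0.
pose Q := \sum_(i < size c) c`_i *: 'X^(i.+1).
have QX : Q = c * 'X.
  rewrite /Q -[c in RHS]coefK poly_def mulr_suml; apply: eq_bigr => i _.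
  by rewrite -scalerAl -exprSr.
exists Q; split.
- by rewrite QX hornerMX mulr0.
- rewrite QX size_mulX ?sc ?size_scale //.
  by rewrite -size_poly_eq0 sc size_scale // size_poly_eq0.
move=> y.
have lev0 s x : lev s x = lev s (x + 0%:~R) by rewrite addr0.
have levm x : lev (r + 1) (x - 1) = lev (r + 1) (x + (r - (r + 1) - 0)%:~R).
  by congr (lev _ (x + _)); rewrite (_ : r - (r + 1) - 0 = -1) ?rmorphN //; ring.
rewrite [lev (r + 1) y]lev0 levm (evodE (r + 1) 0 r) evodJ (levE L (r + 1) 0 r) levJ llb_step.
have odQ : (odp (r + 1) 0 r Q).[lev r y] = llb L 1 0 0 * p.[lev r y].
  rewrite /Q (linear_sumZ (size c) (fun i => c`_i) (fun i => 'X^(i.+1)) (@odp_linear (r + 1) 0 r)) -hornerZ E sc.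
  by congr (_.[_]); apply: eq_bigr.
by rewrite odQ; ring.
Qed.

(** It suffices to prescribe the odd part of the product of U and [s]: conjugation gives the second
    identity, and [e] is twice the even part. The map [t0] from [s] to this odd part preserves
    degrees, and its leading coefficient on ['X^n] is the quantity in the hypothesis. Subtracting
    the two identities yields a telescoping sum. *)
Lemma lev_gosper (u1 u0 ub : F) (p : {poly F}) :
  (forall n, u1 * (lead n).2 + ub * (lead n).1 != 0) ->
  exists s e : {poly F}, [/\ (size s <= size p)%N, (size e <= (size p).+1)%N,
    forall y, ((u1 * lev 0 y + u0) + ub * asym 0 y) * s.[lev 1 y] *+ 2
      = e.[lev 0 y] + asym 0 y * p.[lev 0 y] &
    forall y, ((u1 * lev 0 y + u0) - ub * asym 0 y) * s.[lev 1 (y - 1)] *+ 2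
      = e.[lev 0 y] - asym 0 y * p.[lev 0 y]].
Proof.
move=> hu; pose U := u1 *: 'X + u0%:P.
pose t0 := fun s => U * odp 1 0 0 s + ub *: evp 1 0 0 s.
pose t n := t0 'X^n.
have two0 : (2 : F) != 0 by rewrite pnatr_eq0.
have t0_lin : linear t0.
  move=> a p1 p2; rewrite /t0 evp_linear odp_linear mulrDr !scalerDr -scalerAr !scalerA.
  by rewrite [ub * a]mulrC addrACA.
have hU : wdeg 0 1 U /\ wtop 0 1 U = u1.
  split=> [i|]; last by rewrite /wtop /= coefD coefZ coefX coefC /= mulr1 addr0.
  by rewrite coefD coefZ coefX coefC; case: i => [|[|i]] //=; rewrite mulr0 addr0.
have [|c sc E] := @triangular_poly_basis _ t (2^-1 *: p).
  move=> n _; have hev : wdeg 0 n (evp 1 0 0 'X^n).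
    by move=> i hi; apply/nth_default/(leq_trans (evp_size _ _ _ _)); rewrite size_polyXn.
  have hod : wdeg 1 n (odp 1 0 0 'X^n).
    by move=> i hi; apply/nth_default/(leq_trans (odp_size _ _ _ _)); rewrite size_polyXn.
  have hUo : wdeg 0 n (U * odp 1 0 0 'X^n).
    by move=> i hi; apply: (wdegM hU.1 hod); lia.
  apply: size_exact; first by apply/wdegD/wdegZ.
  have <- : wtop 0 n (t n) = (t n)`_n by rewrite /wtop subn0.
  rewrite wtopD wtopZ -(wtop_shift 1) (_ : wtop (1 + 0) (1 + n) _ = u1 * (lead n).2).
    by have := hu n; rewrite -(evp_Xn_top 0).
  by rewrite -(odp_Xn_top 0); exact: etrans (wtopM hU.1 hod) (congr1 ( *%R^~ _) hU.2).
pose s := \sum_(i < size c) c`_i *: 'X^i.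
have ss : s = c by rewrite /s -poly_def coefK.
have st : t0 s = 2^-1 *: p.
  by rewrite /s (linear_sumZ (size c) (fun i => c`_i) (fun i => 'X^i) t0_lin) E sc size_scale ?invr_eq0.
exists s, (2 *: (U * evp 1 0 0 s + ub *: (quad 0 * odp 1 0 0 s))).
have lev0 r x : lev r x = lev r (x + 0%:~R) by rewrite addr0.
have levm x : lev 1 (x - 1) = lev 1 (x + (0 - 1 - 0)%:~R).
  by congr (lev _ (x + _)); rewrite (_ : 0 - 1 - 0 = -1) ?rmorphN.
have sp : (size s <= size p)%N by rewrite ss sc size_scale ?invr_eq0.
have pE y : p.[lev 0 y] = 2 * (u1 * lev 0 y + u0) * (odp 1 0 0 s).[lev 0 y]
    + 2 * ub * (evp 1 0 0 s).[lev 0 y].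
  have := congr1 (fun q => 2 * q.[lev 0 y]) st.
  rewrite /t0 /U !(hornerD, hornerM, hornerZ, hornerX, hornerC) mulrA mulfV // mul1r => <-.
  by ring.
clearbody s; split=> //.
- apply: leq_trans (size_scale_leq _ _) _; apply/leq_sizeP => i hi.
  have h1 : wdeg 0 (size p) (U * evp 1 0 0 s).
    have hev : wdeg 1 (size p) (evp 1 0 0 s).
      by move=> j hj; apply/nth_default/(leq_trans (evp_size _ _ _ _))/(leq_trans sp).
    by move=> j hj; apply: (wdegM hU.1 hev); lia.
  have h2 : wdeg 0 (size p) (quad 0 * odp 1 0 0 s).
    have [p0|p0] := posnP (size p).
      have -> : s = 0 by apply/eqP; rewrite -size_poly_eq0 -leqn0 -p0.
      by rewrite /odp size_poly0 big_ord0 mulr0 => j _; rewrite coef0.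
    have hq : wdeg 0 2 (quad 0).
      move=> j; rewrite !(coefD, coefZ, coefX, coefXn, coefC).
      by case: j => [|[|[|j]]] //=; rewrite !mulr0 !addr0.
    have hod : wdeg 2 (size p) (odp 1 0 0 s).
      move=> j hj; apply/nth_default/(leq_trans (odp_size _ _ _ _)).
      by move: sp hj; move: (size s) (size p) => m n; lia.
    by move=> j hj; apply: (wdegM hq hod); lia.
  by apply: (wdegD h1 (wdegZ _ h2)); lia.
- move=> y; rewrite [lev 1 y]lev0 (evodE 1 0 0) pE /U.
  by rewrite !(quadE, hornerD, hornerM, hornerZ, hornerX, hornerC); ring.
- move=> y; rewrite levm evodJ pE /U.
  by rewrite !(quadE, hornerD, hornerM, hornerZ, hornerX, hornerC); ring.
Qed.

End Lattice.

Lemma monic_root_expn (A : comNzRingType) M (P : {poly A}) (z : A) :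
  P \is monic -> size P = M.+1 -> P.[z] = 0 ->
  z ^+ M = - \sum_(l < M) P`_l * z ^+ l.
Proof.
move=> /eqP lP sP; rewrite horner_coef sP big_ord_recr /=.
move: lP; rewrite lead_coefE sP /= => ->; rewrite mul1r => /eqP.
by rewrite addrC addr_eq0 => /eqP.
Qed.

Lemma coef_mulXsubC (A : comNzRingType) (P H : {poly A}) (s : A) n l :
  P = ('X - s%:P) * H ->
  H`_l = \sum_(k < n) P`_(l + k).+1 * s ^+ k + s ^+ n * H`_(l + n).
Proof.
move=> PE; elim: n => [|n ->]; first by rewrite big_ord0 add0r mul1r addn0.
rewrite big_ord_recr /= -addrA; congr (_ + _).
have -> : P`_(l + n).+1 = H`_(l + n) - s * H`_(l + n).+1.
  by rewrite PE mulrBl coefB coefXM coefCM.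
by rewrite addnS exprSr; ring.
Qed.

(** * Symmetric functions of the nodes of a window *)

Section Windows.

Variables (F : numFieldType) (L : lattice F).
Local Notation lev := (lev L).
Local Notation asym := (asym L).

(* [f] and [fJ] are [u(lev m y) + asym m y * w(lev m y)] and its conjugate;
   [c], [cJ] are their leading coefficients. *)
Definition conj_pair (m : int) (a b : nat) (c cJ : F) (f fJ : F -> F) : Prop :=
  exists u w : {poly F}, [/\ wdeg a b u, wdeg a.+1 b w,
    c = wtop a b u + leps L * wtop a.+1 b w,
    cJ = wtop a b u - leps L * wtop a.+1 b w &
    forall y, f y = u.[lev m y] + asym m y * w.[lev m y] /\
      fJ y = u.[lev m y] - asym m y * w.[lev m y]].

Lemma conj_pair_ext m a b c cJ f fJ c' cJ' g gJ :
  c = c' -> cJ = cJ' -> (forall y, f y = g y) -> (forall y, fJ y = gJ y) ->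
  conj_pair m a b c cJ f fJ -> conj_pair m a b c' cJ' g gJ.
Proof.
move=> <- <- fg fgJ [u [w [hu hw hc hcJ hf]]]; exists u, w; split=> // y.
by rewrite -fg -fgJ.
Qed.

Lemma conj_pair_const m a b (c : F) :
  (a <= b)%N -> conj_pair m a b (c *+ (a == b)) (c *+ (a == b)) (fun=> c) (fun=> c).
Proof.
move=> ab; exists c%:P, 0; split=> [i hi|i _|||y].
- by rewrite coefC; case: eqP => // i0; move: hi; rewrite i0; lia.
- by rewrite coef0.
- rewrite /wtop ab coef0; case: ifP; rewrite mulr0 addr0 coefC subn_eq0 => _;
  by rewrite eqn_leq ab; case: leqP.
- rewrite /wtop ab coef0; case: ifP; rewrite mulr0 subr0 coefC subn_eq0 => _;
  by rewrite eqn_leq ab; case: leqP.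
- by rewrite hornerC horner0 mulr0 addr0 subr0.
Qed.

Lemma conj_pair0 m a b : conj_pair m a b 0 0 (fun=> 0) (fun=> 0).
Proof.
exists 0, 0; split=> [i|i|||y]; rewrite ?coef0 //.
- by rewrite /wtop !coef0; do 2!case: ifP => _; rewrite mulr0 addr0.
- by rewrite /wtop !coef0; do 2!case: ifP => _; rewrite mulr0 subr0.
- by rewrite horner0 mulr0 addr0 subr0.
Qed.

Lemma conj_pairB m a b c cJ c' cJ' f fJ g gJ :
  conj_pair m a b c cJ f fJ -> conj_pair m a b c' cJ' g gJ ->
  conj_pair m a b (c - c') (cJ - cJ') (fun y => f y - g y) (fun y => fJ y - gJ y).
Proof.
move=> [u [w [hu hw -> -> hf]]] [u' [w' [hu' hw' -> -> hg]]].
exists (u - u'), (w - w'); split; [exact: wdegB|exact: wdegB|..].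
- by rewrite !wtopB; ring.
- by rewrite !wtopB; ring.
- move=> y; rewrite (hf y).1 (hf y).2 (hg y).1 (hg y).2 !hornerD !hornerN.
  by split; ring.
Qed.

Lemma conj_pairM m a b a' b' c cJ c' cJ' f fJ g gJ :
  conj_pair m a b c cJ f fJ -> conj_pair m a' b' c' cJ' g gJ ->
  conj_pair m (a + a') (b + b') (c * c') (cJ * cJ') (fun y => f y * g y) (fun y => fJ y * gJ y).
Proof.
move=> [u [w [hu hw -> -> hf]]] [u' [w' [hu' hw' -> -> hg]]].
pose Q : {poly F} := lq2 L *: 'X^2 + lq1 L m *: 'X + (lq0 L m)%:P.
have QE y : Q.[lev m y] = asym m y ^+ 2 by rewrite asym_sqr /Q !hornerE.
have hq : wdeg 0 2 Q.
  move=> j; rewrite !(coefD, coefZ, coefX, coefXn, coefC).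
  by case: j => [|[|[|j]]] //=; rewrite !mulr0 !addr0.
have tq : wtop 0 2 Q = leps L ^+ 2.
  by rewrite leps_sqr /wtop /= !(coefD, coefZ, coefX, coefXn, coefC) /= mulr1 mulr0 !addr0.
have huu := wdegM hu hu'; have hww := wdegM hw hw'.
have huw := wdegM hu hw'; have hwu := wdegM hw hu'.
have hqww : wdeg (a + a') (b + b') (Q * (w * w')).
  by move=> i hi; apply: (wdegM hq hww); lia.
have huw1 : wdeg (a + a').+1 (b + b') (u * w') by move=> i hi; apply: huw; lia.
have hwu1 : wdeg (a + a').+1 (b + b') (w * u') by move=> i hi; apply: hwu; lia.
have t1 := wtopM hu hu'.
have t2 : wtop (a + a') (b + b') (Q * (w * w')) = leps L ^+ 2 * (wtop a.+1 b w * wtop a'.+1 b' w').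
  rewrite -(wtopM hw hw') -tq -(wtopM hq hww) -[LHS](wtop_shift 2).
  by congr (wtop _ _ _); lia.
have t3 : wtop (a + a').+1 (b + b') (u * w') = wtop a b u * wtop a'.+1 b' w'.
  by rewrite -(wtopM hu hw'); congr (wtop _ _ _); lia.
have t4 : wtop (a + a').+1 (b + b') (w * u') = wtop a.+1 b w * wtop a' b' u'.
  by rewrite -(wtopM hw hu').
exists (u * u' + Q * (w * w')), (u * w' + w * u'); split; [exact: wdegD|exact: wdegD|..].
- by rewrite !wtopD t1 t2 t3 t4; ring.
- by rewrite !wtopD t1 t2 t3 t4; ring.
- move=> y; rewrite (hf y).1 (hf y).2 (hg y).1 (hg y).2 !(QE, hornerD, hornerM).
  by split; ring.
Qed.

Lemma conj_pair_shift m c0 a b c cJ f fJ :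
  conj_pair m a b c cJ f fJ -> conj_pair m (c0 + a) (c0 + b) c cJ f fJ.
Proof.
move=> [u [w [hu hw -> -> hf]]]; exists u, w; split=> //.
- exact: wdeg_shift.
- by rewrite -addnS; apply: wdeg_shift.
- by rewrite -addnS !wtop_shift.
- by rewrite -addnS !wtop_shift.
Qed.

Lemma conj_pair_lev m s k : conj_pair m 0 1 (lom L ^ k) (lom L ^ (m - s - k))
  (fun y => lev s (y + k%:~R)) (fun y => lev s (y + (m - s - k)%:~R)).
Proof.
exists (lla L s k m *: 'X + (llc L s k m)%:P), (llb L s k m)%:P; split.
- by move=> i; rewrite coefD coefZ coefX coefC; case: i => [|[|i]] //=; rewrite mulr0 addr0.
- by move=> i; rewrite coefC; case: i.
- rewrite /wtop /= coefD coefZ coefX !coefC /= mulr1 addr0.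
  by rewrite (lla_lom L s k m).
- rewrite /wtop /= coefD coefZ coefX !coefC /= mulr1 addr0.
  by rewrite (llaJ_lom L s k m).
- move=> y; rewrite (levE L s k m) levJ !(hornerD, hornerZ, hornerX, hornerC).
  by split; ring.
Qed.

(** The reflection about the centre of the window reverses the order of its nodes, so the symmetric
    functions are even, that is, polynomials in [lev r y]. Their top coefficients come from the
    growth ratios [lom ^+ j] of the nodes. *)
Lemma window_coef (r : nat) : exists pc : nat -> {poly F}, forall i,
  [/\ wdeg i r.+1 (pc i),
    wtop i r.+1 (pc i) = (\prod_(j < r.+1) ('X - (lom L ^+ j)%:P))`_i &
    forall y, (\prod_(j < r.+1) ('X - (lev 0 (y + j%:R))%:P))`_i = (pc i).[lev r%:Z y]].
Proof.
(* Partial products are not symmetric, so the induction carries a function together with its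
   conjugate. At [n = r.+1] the two agree, and their mean removes the odd part. *)
have key (n i : nat) : conj_pair r%:Z i n
   (\prod_(j < n) ('X - (lom L ^ (j%:Z))%:P))`_i
   (\prod_(j < n) ('X - (lom L ^ (r%:Z - 0 - j%:Z))%:P))`_i
   (fun y => (\prod_(j < n) ('X - (lev 0 (y + j%:Z%:~R))%:P))`_i)
   (fun y => (\prod_(j < n) ('X - (lev 0 (y + (r%:Z - 0 - j%:Z)%:~R))%:P))`_i).
  elim: n i => [|n IHn] i.
    apply: (@conj_pair_ext _ _ _ (i == 0%N)%:R (i == 0%N)%:R (fun=> (i == 0%N)%:R) (fun=> (i == 0%N)%:R)).
    - by rewrite big_ord0 coef1.
    - by rewrite big_ord0 coef1.
    - by move=> y; rewrite big_ord0 coef1.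
    - by move=> y; rewrite big_ord0 coef1.
    case: i => [|i]; [exact: (conj_pair_const _ 1 (leqnn 0)) | exact: conj_pair0].
  have step (A : comNzRingType) (P : {poly A}) (z : A) :
     (P * ('X - z%:P))`_i = (if i is i'.+1 then P`_i' else 0) - z * P`_i.
    by rewrite mulrBr coefB coefMX coefMC [_ * z]mulrC; case: i.
  have hz := conj_pair_lev r%:Z 0 n%:Z.
  have h0 := conj_pairM hz (IHn i).
  have h1 : conj_pair r%:Z i n.+1
     (if i is i'.+1 then (\prod_(j < n) ('X - (lom L ^ (j%:Z))%:P))`_i' else 0)
     (if i is i'.+1 then (\prod_(j < n) ('X - (lom L ^ (r%:Z - 0 - j%:Z))%:P))`_i' else 0)
     (fun y => if i is i'.+1 then (\prod_(j < n) ('X - (lev 0 (y + j%:Z%:~R))%:P))`_i' else 0)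
     (fun y => if i is i'.+1 then (\prod_(j < n) ('X - (lev 0 (y + (r%:Z - 0 - j%:Z)%:~R))%:P))`_i' else 0).
    case: i {step h0} => [|i]; first exact: conj_pair0.
    exact: (conj_pair_shift 1 (IHn i)).
  apply: (conj_pair_ext _ _ _ _ (conj_pairB h1 h0)).
  - by rewrite big_ord_recr step.
  - by rewrite big_ord_recr step.
  - by move=> y; rewrite big_ord_recr step.
  - by move=> y; rewrite big_ord_recr step.
have two0 : (2 : F) != 0 by rewrite pnatr_eq0.
have revint (j : 'I_r.+1) : r%:Z - 0 - (rev_ord j)%:Z = j%:Z.
  by rewrite /=; have := ltn_ord j; lia.
have revC : \prod_(j < r.+1) ('X - (lom L ^ (r%:Z - 0 - j%:Z))%:P)
    = \prod_(j < r.+1) ('X - (lom L ^+ j)%:P).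
  rewrite (reindex_inj rev_ord_inj); apply: eq_bigr => j _.
  by rewrite revint.
have revV y : \prod_(j < r.+1) ('X - (lev 0 (y + (r%:Z - 0 - j%:Z)%:~R))%:P)
    = \prod_(j < r.+1) ('X - (lev 0 (y + j%:R))%:P).
  rewrite (reindex_inj rev_ord_inj); apply: eq_bigr => j _.
  by rewrite revint.
have {}key i : exists p : {poly F}, [/\ wdeg i r.+1 p,
    wtop i r.+1 p = (\prod_(j < r.+1) ('X - (lom L ^+ j)%:P))`_i &
    forall y, (\prod_(j < r.+1) ('X - (lev 0 (y + j%:R))%:P))`_i = p.[lev r%:Z y]].
  have [u [w [hu hw hc hcJ hf]]] := key r.+1 i; exists u; split=> //.
    apply: (mulfI two0); rewrite !mulr_natl !mulr2n -{1}revC hcJ.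
    rewrite [X in _ = _ + X](_ : _ = wtop i r.+1 u + leps L * wtop i.+1 r.+1 w).
      by ring.
    exact: hc.
  move=> y; have [h1 h2] := hf y.
  apply: (mulfI two0); rewrite !mulr_natl !mulr2n -{1}revV h2.
  rewrite [X in _ + X = _](_ : _ = u.[lev r y] + asym r y * w.[lev r y]).
    by ring.
  exact: h1.
by have [pc hpc] := choice key; exists pc.
Qed.

End Windows.

(** * Alternants on a window, intact or with one node replaced *)

Section Alternants.

Variables (F : numFieldType) (L : lattice F) (r : nat) (xi : 'I_r.+1 -> {poly F}).
Local Notation lev := (lev L).
Local Notation asym := (asym L).

Let node (y : F) (j : 'I_r.+1) := lev 0 (y + j%:R).
Let deg k := (size (xi k)).-1.

(** The remainder determinant of [det_alternant] becomes a polynomial in [lev r y] by [window_coef].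
    Its top coefficient is, up to the leading coefficients of the [xi], the determinant of
    remainders modulo the product of the ['X - lom ^+ j], so the degree is exact when the degrees of
    the [xi] are distinct. *)
Lemma window_alternant :
  exists p : {poly F}, [/\ wdeg (\sum_(l < r.+1) l) (\sum_k deg k) p,
    (forall k, xi k != 0) -> injective deg -> wtop (\sum_(l < r.+1) l) (\sum_k deg k) p != 0 &
    forall y, \det (\matrix_(j, k) (xi k).[node y j]) = vdm (node y) * p.[lev r%:Z y]].
Proof.
have [pc hpc] := window_coef L r.
pose A := \matrix_(l < r.+1, k < r.+1) \sum_(d < size (xi k)) (xi k)`_d *: rem_coef r.+1 pc d l.
have hrem d l : (l <= r)%N -> wdeg l d (rem_coef r.+1 pc d l) /\
    wtop l d (rem_coef r.+1 pc d l) = rem_coef r.+1 (fun i => wtop i r.+1 (pc i)) d l.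
  by apply: wdeg_rem_coef => i _; case: (hpc i).
have hA (l k : 'I_r.+1) : wdeg l (deg k) (A l k).
  rewrite mxE; apply: wdeg_sum => d _; apply: wdegZ.
  apply: (@wdeg_le _ d); first by rewrite /deg; case: (size _) d => [[]|n] // d; rewrite -ltnS ltn_ord.
  by have [] := hrem d l (ltn_ord l).
have tA (l k : 'I_r.+1) : wtop l (deg k) (A l k)
   = lead_coef (xi k) * rem_coef r.+1 (fun i => wtop i r.+1 (pc i)) (deg k) l.
  rewrite mxE wtop_sum; have [->|xk0] := eqVneq (xi k) 0.
    by rewrite size_poly0 big_ord0 lead_coef0 mul0r.
  rewrite lead_coefE /deg; case Es: (size (xi k)) => [|n].
    by move/eqP: Es; rewrite size_poly_eq0 (negPf xk0).
  rewrite big_ord_recr /= big1 ?add0r => [|d _].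
    by rewrite wtopZ (hrem n l (ltn_ord l)).2.
  by rewrite wtopZ (wtop_lt _ (hrem d l (ltn_ord l)).1) ?mulr0.
have [dA tdA] := wdeg_det hA.
exists (\det A); split=> // [xi0 di|y].
  rewrite tdA.
  have -> : \matrix_(l, k) wtop l (deg k) (A l k)
     = (\matrix_(l, k) rem_coef r.+1 (fun i => wtop i r.+1 (pc i)) (deg k) l)
         *m diag_mx (\row_k lead_coef (xi k)).
    apply/matrixP => l k; rewrite [LHS]mxE tA [RHS]mxE (bigD1 k) //=.
    rewrite big1 ?addr0 => [|i ik].
      by rewrite !mxE eqxx mulr1n mulrC.
    by rewrite !mxE (negPf ik) mulr0n mulr0.
  rewrite det_mulmx mulf_neq0 //; last first.
    rewrite det_diag prodf_seq_neq0; apply/allP => k _ /=.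
    by rewrite mxE lead_coef_eq0.
  apply: (@det_rem_coef_neq0 _ _ (lom L)) => //; first exact: lom_inj.
  by move=> i _; have [] := hpc i.
rewrite (det_alternant (g := fun i => (pc i).[lev r%:Z y])) => [|j].
  congr (_ * _); rewrite -horner_evalE -det_map_mx; congr (\det _).
  apply/matrixP => l k; rewrite !mxE rmorph_sum; apply: eq_bigr => d _ /=.
  by rewrite linearZ /= rmorph_rem_coef.
set P := \prod_(i < r.+1) ('X - (node y i)%:P).
have sP : size P = r.+2 by rewrite size_prod_XsubC /index_enum -enumT size_enum_ord.
rewrite (monic_root_expn (monic_prod_XsubC _ _ _) sP).
  by congr (- _); apply: eq_bigr => l _; congr (_ * _); have [_ _ ->] := hpc l.
by rewrite /P (bigD1 j) //= hornerM hornerXsubC subrr mul0r.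
Qed.

(** Let s be the node replaced by t, and H the window polynomial divided by ['X - s]. Synthetic
    division gives the coefficients [h] of H and [g] of the new window polynomial [('X - t) * H].
    The alternant is then [Q1] times the new Vandermonde product, which [vdm_replace] exchanges for
    the old one at the price of [Q2], the value H(t); this accounts for the r extra degrees. *)
Lemma window_replace :
  exists2 Q : F -> F -> F -> F, tdeg (\sum_(l < r.+1) l) (\sum_k deg k + r) Q &
  forall t y (i : 'I_r.+1),
    \det (\matrix_(j, k) (xi k).[if j == i then t else node y j])
      * \prod_(j | j != i) (node y i - node y j)
    = vdm (node y) * Q t (node y i) (lev r%:Z y).
Proof.
have [pc hpc] := window_coef L r.
pose h l (t s v : F) := \sum_(k < r.+1) (pc (l + k).+1).[v] * s ^+ k.
have hh l : tdeg l r (h l).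
  apply: tdeg_sum => k.
  have h1 : tdeg (l + k).+1 r.+1 (fun _ _ v => (pc (l + k).+1).[v]).
    by apply: tdeg_horner; have [] := hpc (l + k).+1.
  have h2 : @tdeg F 0 k (fun _ s _ => s ^+ k).
    apply: (@tdeg_ext _ _ _ (fun t s v => 1 * (t ^+ 0 * s ^+ k * v ^+ 0))).
      by move=> t s v; rewrite !mul1r mulr1.
    by apply: tdeg_mon; lia.
  by apply: tdeg_le (tdegM h1 h2); lia.
have tt : @tdeg F 0 1 (fun t _ _ => t).
  apply: (@tdeg_ext _ _ _ (fun t s v => 1 * (t ^+ 1 * s ^+ 0 * v ^+ 0))).
    by move=> t s v; rewrite mul1r !mulr1.
  by apply: tdeg_mon.
pose g l (t s v : F) := (if l is l'.+1 then h l' t s v else 0) - t * h l t s v.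
have hg l : tdeg l r.+1 (g l).
  apply: tdegB; last exact: (tdegM tt (hh l)).
  case: l => [|l]; first exact: tdeg0.
  by apply: tdeg_le (hh l); lia.
pose Q1 (t s v : F) := \det (\matrix_(l < r.+1, k < r.+1)
   (\sum_(d < size (xi k)) (xi k)`_d * rem_coef r.+1 (fun i => g i t s v) d l)).
pose Q2 (t s v : F) := \sum_(l < r.+1) h l t s v * t ^+ l.
exists (fun t s v => Q1 t s v * Q2 t s v).
  have hQ2 : tdeg 0 r Q2.
    apply: tdeg_sum => l.
    have h2 : @tdeg F 0 l (fun t _ _ => t ^+ l).
      apply: (@tdeg_ext _ _ _ (fun t s v => 1 * (t ^+ l * s ^+ 0 * v ^+ 0))).
        by move=> t s v; rewrite mul1r !mulr1.
      by apply: tdeg_mon; lia.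
    by apply: tdeg_le (tdegM (hh l) h2); lia.
  have hQ1 : tdeg (\sum_(l < r.+1) l) (\sum_k deg k) Q1.
    apply: tdeg_det => l k; apply: tdeg_sum => d; apply: tdegZ.
    have hgr := tdeg_rem_coef d (fun i (_ : (i <= r)%N) => hg i) (ltn_ord l : l <= r)%N.
    apply: (tdeg_le _ hgr).
    by rewrite leq_add2r /deg -ltnS (leq_trans (ltn_ord d)) // leqSpred.
  by apply: tdeg_le (tdegM hQ1 hQ2); rewrite addn0.
move=> t y i.
pose w j := if j == i then t else node y j.
pose H := \prod_(j < r.+1 | j != i) ('X - (node y j)%:P).
have PE : \prod_(j < r.+1) ('X - (node y j)%:P) = ('X - (node y i)%:P) * H.
  by rewrite /H (bigD1 i).
have sH : size H = r.+1.
  apply/eqP; rewrite -(eqn_add2r 1) !addn1; apply/eqP.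
  have <- : size (('X - (node y i)%:P) * H) = (size H).+1.
    rewrite size_monicM ?monicXsubC ?size_XsubC //.
    by apply/monic_neq0/monic_prod_XsubC.
  by rewrite -PE size_prod_XsubC /index_enum -enumT size_enum_ord.
have HE (l : nat) : H`_l = h l t (node y i) (lev r%:Z y).
  rewrite (coef_mulXsubC r.+1 l PE) nth_default ?sH ?mulr0 ?addr0; last by lia.
  by apply: eq_bigr => k _; have [_ _ ->] := hpc (l + k).+1.
have wne j : j != i -> node y j = w j by rewrite /w => /negPf->.
have wi : w i = t by rewrite /w eqxx.
rewrite -[LHS]/(\det (\matrix_(j, k) (xi k).[w j]) * _).
rewrite (det_alternant (g := fun l => g l t (node y i) (lev r%:Z y))); last first.
  move=> j; set G := ('X - t%:P) * H.
  have sG : size G = r.+2.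
    by rewrite size_monicM ?monicXsubC // ?sH ?size_XsubC // -size_poly_eq0 sH.
  have mG : G \is monic by rewrite monicMl ?monicXsubC // monic_prod_XsubC.
  rewrite (monic_root_expn mG sG).
    congr (- _); apply: eq_bigr => l _; congr (_ * _).
    rewrite /G mulrBl coefB coefXM coefCM !HE /g; by case: (nat_of_ord l).
  rewrite /G hornerM hornerXsubC /w; case: eqP => [_|/eqP ji]; first by rewrite subrr mul0r.
  by rewrite /H (bigD1 j) //= hornerM hornerXsubC subrr mul0r mulr0.
rewrite mulrAC -(vdm_replace (u := node y) (w := w)) // wi mulrAC mulrA.
congr (_ * _ * _); rewrite /Q2.
transitivity H.[t].
  rewrite /H horner_prod; apply: eq_bigr => j ji.
  by rewrite hornerXsubC wne.
by rewrite horner_coef sH; apply: eq_bigr => l _; rewrite HE.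
Qed.

End Alternants.

(** * The summation kernel *)

Section Kernel.

Variables (F : numFieldType) (L : lattice F).
Local Notation lev := (lev L).
Local Notation asym := (asym L).

Definition node (z : int) : F := lev 0 z%:~R.

Hypothesis node_inj : injective node.

Let lprod (z : int) (i : nat) := \prod_(a < i) (node z - node (z - a.+1%:Z)).
Let rprod (z : int) (i : nat) := \prod_(a < i) (node z - node (z + a.+1%:Z)).

Let lprod_neq0 z i : lprod z i != 0.
Proof.
rewrite prodf_seq_neq0; apply/allP => a _ /=.
by rewrite subr_eq0 inj_eq //; apply/eqP; lia.
Qed.

Let rprod_neq0 z i : rprod z i != 0.
Proof.
rewrite prodf_seq_neq0; apply/allP => a _ /=.
by rewrite subr_eq0 inj_eq //; apply/eqP; lia.
Qed.

Let windowE (r : nat) (z : int) (i : 'I_r.+1) :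
  \prod_(j < r.+1 | j != i) (node z - node (z - i%:Z + j%:Z)) = lprod z i * rprod z (r - i).
Proof.
have ir : (i < r.+1)%N := ltn_ord i.
rewrite (eq_bigl (fun j : 'I_r.+1 => (j : nat) != i)) => [|j]; last by rewrite -val_eqE.
rewrite -(big_mkord (fun j => j != i) (fun j => node z - node (z - i%:Z + j%:Z))).
rewrite (@big_cat_nat _ _ _ i) ?leq0n ?(ltnW ir) //=; congr (_ * _).
  rewrite big_mkord big_mkcond /= [LHS](reindex_inj rev_ord_inj) /=; apply: eq_bigr => j _.
  have ji := ltn_ord j; rewrite ifT; last by apply/eqP; lia.
  by congr (_ - node _); lia.
rewrite big_ltn_cond // eqxx /= (big_addn 0 _ i.+1) subSS big_mkord big_mkcond /=.
apply: eq_bigr => j _; rewrite ifT; last by apply/eqP; lia.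
by congr (_ - node _); lia.
Qed.

(* The transpose of the divided difference of order [r] over windows of
   [r + 1] consecutive nodes. *)
Definition dual_dd (r : nat) (G : int -> F) (z : int) : F :=
  \sum_(i < r.+1) G (z - i%:Z) / \prod_(j < r.+1 | j != i) (node z - node (z - i%:Z + j%:Z)).

(** Partial fractions: a denominator of order [r.+1] is split over the difference of the two end
    nodes into the denominators obtained by dropping one end of the window. *)
Lemma dual_dd_step r (G : int -> F) z :
  let g y := G y / (node (y + r.+1%:Z) - node y) in
  dual_dd r.+1 G z = dual_dd r (fun y => g (y - 1) - g y) z.
Proof.
move=> g.
(* [A] drops the left end of the window and [B] the right one. They are 0 at [i = 0] and at
   [i = r.+1] respectively, where the dropped node is z itself. *)
pose A i := if i is i'.+1 then (lprod z i' * rprod z (r - i'))^-1 else 0.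
pose B i := if i == r.+1 then 0 else (lprod z i * rprod z (r - i))^-1.
have AB (i : nat) : (i <= r.+1)%N ->
   (lprod z i * rprod z (r.+1 - i))^-1
   = (A i - B i) / (node (z - i%:Z + r.+1%:Z) - node (z - i%:Z)).
  move=> ir.
  have lp n : lprod z n.+1 = lprod z n * (node z - node (z - n.+1%:Z)) by rewrite /lprod big_ord_recr.
  have rp n : rprod z n.+1 = rprod z n * (node z - node (z + n.+1%:Z)) by rewrite /rprod big_ord_recr.
  have d0 x y : x <> y -> node x - node y != 0 by move=> xy; rewrite subr_eq0 inj_eq //; apply/eqP.
  have h1 := lprod_neq0 z; have h2 := rprod_neq0 z.
  have d1 := d0 (z - i%:Z + r.+1%:Z) (z - i%:Z) ltac:(lia).
  rewrite /A /B; case: i ir d1 => [|i] ir d1.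
    rewrite subn0 subr0 rp /lprod big_ord0 !mul1r /= subn0 sub0r.
    have d2 := d0 z (z + r.+1%:Z) ltac:(lia).
    have d3 := d0 (z + r.+1%:Z) z ltac:(lia).
    by field; rewrite h2 d2 d3.
  rewrite subSS eqSS; case: eqP => [->|/eqP ne].
    rewrite subnn /rprod big_ord0 !mulr1 subr0 lp subrK.
    have d2 := d0 z (z - r.+1%:Z) ltac:(lia).
    by field; rewrite h1 d2.
  have {ne}ir : (i < r)%N by lia.
  have -> : (r - i = (r - i.+1).+1)%N by lia.
  have -> : z - i.+1%:Z + r.+1%:Z = z + (r - i.+1).+1%:Z by lia.
  rewrite lp rp; set x := node (z + (r - i.+1).+1%:Z); set y := node (z - i.+1%:Z).
  have d2 : node z - y != 0 by apply: d0; lia.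
  have d3 : node z - x != 0 by apply: d0; lia.
  have d4 : x - y != 0 by apply: d0; lia.
  by field; rewrite d2 d3 d4 h1 h2.
transitivity (\sum_(i < r.+2) g (z - i%:Z) * A i - \sum_(i < r.+2) g (z - i%:Z) * B i).
  rewrite -sumrB; apply: eq_bigr => i _.
  rewrite windowE (AB i (ltn_ord i)) /g.
  by rewrite -mulrBr -[RHS]mulrA [X in _ = _ * X]mulrC.
rewrite big_ord_recl mulr0 add0r [X in _ - X]big_ord_recr /= /B eqxx mulr0 addr0 -sumrB.
apply: eq_bigr => i _; rewrite windowE (ltn_eqF (ltn_ord i)) mulrBl.
by congr (g _ * _ - _); rewrite /bump /=; lia.
Qed.

(** The end difference of a window is a multiple of [asym r.+1], so the division removes that
    factor. The increment of [u] that is left is odd about the next centre: it equals -2 times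
    [asym r] times [odp u]. The shape is thus reproduced with r and the degree both lowered by one,
    and [v] collects the constants. *)
Lemma dual_dd_asym (r : nat) (u : {poly F}) : exists2 u' : {poly F},
  (size u' <= size u - r)%N &
  forall z : int, dual_dd r (fun y => asym r%:Z y%:~R * u.[lev r%:Z y%:~R]) z
    = asym 0 z%:~R * u'.[node z].
Proof.
elim: r u => [|r IHr] u.
  exists u; first by rewrite subn0.
  move=> z; rewrite /dual_dd big_ord_recl big_ord0 addr0 subr0 big_pred0 ?divr1 //.
  by move=> j; rewrite ord1.
pose v := - (2 / lbr L r.+1) *: odp L r.+1%:Z 0 r%:Z u.
have [u' su' hu'] := IHr v; exists u'.
  apply: leq_trans su' _; rewrite subnS -subn1 subnAC; apply: leq_sub2r.
  by rewrite (leq_trans (size_scale_leq _ _)) // (leq_trans (odp_size _ _ _ _ _)) // subn1.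
move=> z; rewrite dual_dd_step -hu'; apply: eq_bigr => i _; congr (_ / _).
have gE (y : int) : asym r.+1%:Z y%:~R * u.[lev r.+1%:Z y%:~R] / (node (y + r.+1%:Z) - node y)
    = u.[lev r.+1%:Z y%:~R] / lbr L r.+1.
  have d0 : node (y + r.+1%:Z) - node y != 0.
    by rewrite subr_eq0 inj_eq //; apply/eqP; lia.
  move: d0; rewrite /node rmorphD /= (lbrE L r.+1) mulf_eq0 negb_or => /andP[b0 a0].
  by field; rewrite b0 a0.
rewrite !gE.
have -> : lev r.+1%:Z (z - i%:Z)%:~R = lev r.+1%:Z ((z - i%:Z)%:~R + 0%:~R) by rewrite addr0.
have -> : lev r.+1%:Z (z - i%:Z - 1)%:~R
   = lev r.+1%:Z ((z - i%:Z)%:~R + (r%:Z - r.+1%:Z - 0)%:~R).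
  by congr (lev _ _); rewrite -rmorphD; congr (_%:~R); lia.
rewrite (evodE L r.+1%:Z 0 r%:Z) evodJ /v hornerZ.
have := lbr_neq0 L (ltn0Sn r); set b := lbr L _ => b0.
by field.
Qed.

(** Each monomial of the polynomial from [window_replace] is treated separately: its power of
    [lev r] enters the transposed divided difference together with [C], and the rest does not depend
    on the window. The r degrees lost in [dual_dd_asym] are those gained in [window_replace]. *)
Lemma kernel_poly (r : nat) (xi : 'I_r.+1 -> {poly F}) (C : {poly F}) :
  exists2 kap : seq (nat * {poly F}),
    (forall m, m \in kap ->
       m.1 + size m.2 + \sum_(l < r.+1) l <= size C + \sum_k (size (xi k)).-1)%N &
    forall (t : F) (z : int),
      \sum_(i < r.+1) asym r%:Z (z - i%:Z)%:~R * C.[lev r%:Z (z - i%:Z)%:~R]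
        * (\det (\matrix_(j < r.+1, k < r.+1)
                (xi k).[if j == i then t else node (z - i%:Z + j%:Z)])
           / vdm (fun j : 'I_r.+1 => node (z - i%:Z + j%:Z)))
      = asym 0 z%:~R * \sum_(m <- kap) t ^+ m.1 * m.2.[node z].
Proof.
have [Q [mons hmons QE] hQ] := window_replace L xi.
have /choice[u hu] : forall e : nat, exists u' : {poly F},
    (size u' <= size (C * 'X^e)%R - r)%N /\
    forall z : int, dual_dd r (fun y => asym r%:Z y%:~R * (C * 'X^e).[lev r%:Z y%:~R]) z
      = asym 0 z%:~R * u'.[node z].
  by move=> e; have [u' h1 h2] := dual_dd_asym r (C * 'X^e); exists u'.
pose ent (m : F * (nat * nat * nat)) := (m.2.1.1, m.1 *: 'X^(m.2.1.2) * u m.2.2).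
(* Entries with zero second factor are dropped, since the truncated subtraction in the bound on [u]
   would not give the degree bound for them. *)
exists [seq m <- [seq ent m | m <- mons] | m.2 != 0] => [m|t z].
  rewrite mem_filter => /andP[m0 /mapP[[c [[a b] e]] /hmons hm Em]].
  move: m0 hm; rewrite Em /= => m0 hm.
  have u0 : u e != 0 by apply: contraNneq m0 => ->; rewrite mulr0.
  have su : (size (m.2) <= b + size (u e))%N.
    rewrite Em /=; apply: leq_trans (size_polyMleq _ _) _.
    rewrite -subn1 leq_subLR addnA add1n leq_add2r.
    by apply: leq_trans (size_scale_leq _ _) _; rewrite size_polyXn.
  have [hs _] := hu e.
  have hC : (size (C * 'X^e)%R <= size C + e)%N.
    by apply: leq_trans (size_polyMleq _ _) _; rewrite size_polyXn addnS.
  have ue0 : (0 < size (u e))%N by rewrite size_poly_gt0.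
  move: su hs hC hm ue0; rewrite Em /=.
  move: (size (c *: 'X^b * u e)%R) (size (u e)) (size (C * 'X^e)%R) (size C) (\sum_(l < _) _)%N (\sum_k _)%N.
  by move=> n1 n2 n3 n4 n5 n6; lia.
rewrite big_filter big_map.
have -> : \sum_(m <- mons | (ent m).2 != 0) t ^+ (ent m).1 * (ent m).2.[node z]
   = \sum_(m <- mons) t ^+ (ent m).1 * (ent m).2.[node z].
  rewrite [LHS]big_mkcond; apply: eq_bigr => m _.
  by case: eqP => //= ->; rewrite horner0 mulr0.
have vdm0 (y : int) : vdm (fun j : 'I_r.+1 => node (y + j%:Z)) != 0.
  rewrite prodf_seq_neq0; apply/allP => b _ /=.
  rewrite prodf_seq_neq0; apply/allP => a _ /=; apply/implyP => ab.
  by rewrite subr_eq0 inj_eq //; apply/eqP; lia.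
transitivity (\sum_(m <- mons) m.1 * (t ^+ m.2.1.1 * node z ^+ m.2.1.2) *
    dual_dd r (fun y => asym r%:Z y%:~R * (C * 'X^(m.2.2)).[lev r%:Z y%:~R]) z).
  rewrite /dual_dd; under [RHS]eq_bigr do rewrite mulr_sumr.
  rewrite exchange_big; apply: eq_bigr => i _ /=.
  have := hQ t (z - i%:Z)%:~R i.
  have nE (j : 'I_r.+1) : lev 0 ((z - i%:Z)%:~R + j%:R) = node (z - i%:Z + j%:Z).
    by rewrite /node [(z - i%:Z + j%:Z)%:~R]rmorphD.
  rewrite (_ : \matrix_(j, k) _ = \matrix_(j < r.+1, k < r.+1)
                (xi k).[if j == i then t else node (z - i%:Z + j%:Z)]); last first.
    by apply/matrixP => j k; rewrite !mxE nE.
  rewrite (eq_bigr (fun j : 'I_r.+1 => node z - node (z - i%:Z + j%:Z))) => [|j _]; last first.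
    by rewrite !nE subrK.
  rewrite nE subrK (_ : vdm _ = vdm (fun j : 'I_r.+1 => node (z - i%:Z + j%:Z))); last first.
    by apply: eq_bigr => b _; apply: eq_bigr => a _; rewrite !nE.
  have W0 : \prod_(j < r.+1 | j != i) (node z - node (z - i%:Z + j%:Z)) != 0.
    rewrite prodf_seq_neq0; apply/allP => j _ /=; apply/implyP => ji.
    rewrite subr_eq0 inj_eq //; apply/eqP; move: ji; rewrite -val_eqE /= => /eqP; lia.
  move: (\det _) (\prod_(j < _ | _) _) (vdm _) (vdm0 (z - i%:Z)) W0 => d w v v0 w0 dw.
  have -> : d / v = Q t (node z) (lev r (z - i%:Z)%:~R) / w.
    by apply/eqP; rewrite eqr_div // dw mulrC.
  rewrite QE mulrA mulr_sumr mulr_suml; apply: eq_bigr => m _.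
  by rewrite hornerM hornerXn; ring.
rewrite mulr_sumr; apply: eq_bigr => m _.
by rewrite (hu m.2.2).2 /ent /= !(hornerM, hornerZ, hornerXn); ring.
Qed.

End Kernel.

(** * Band operators *)

Section OrthogonalSystem.

Variables (F : fieldType) (N : nat) (t : nat -> F) (w : nat -> F) (P : nat -> {poly F}).
Hypothesis t_inj : forall x y, (x <= N)%N -> (y <= N)%N -> t x = t y -> x = y.
Hypothesis w_neq0 : forall x, (x <= N)%N -> w x != 0.
Hypothesis P_size : forall n, (n <= N)%N -> size (P n) = n.+1.

Definition pairing (f g : nat -> F) := \sum_(x < N.+1) w x * f x * g x.

Hypothesis P_orth : forall n m, (n <= N)%N -> (m <= N)%N -> n != m ->
  pairing (fun x => (P n).[t x]) (fun x => (P m).[t x]) = 0.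

Lemma orth_low_degree m (p : {poly F}) : (m <= N)%N -> (size p <= m)%N ->
  pairing (fun x => p.[t x]) (fun x => (P m).[t x]) = 0.
Proof.
move=> mN pm.
have [i ip|c sc ->] := @triangular_poly_basis _ P p.
  by apply: P_size; apply: leq_trans mN; apply: ltnW (leq_trans ip pm).
transitivity (\sum_(i < size p) c`_i * pairing (fun x => (P i).[t x]) (fun x => (P m).[t x])).
  rewrite /pairing; under [RHS]eq_bigr do rewrite mulr_sumr.
  rewrite exchange_big; apply: eq_bigr => x _ /=.
  rewrite horner_sum mulr_sumr mulr_suml; apply: eq_bigr => i _.
  by rewrite hornerZ; ring.
apply: big1 => i _; have im := leq_trans (ltn_ord i) pm.
by rewrite P_orth ?mulr0 ?ltn_eqF // ltnW // (leq_trans im).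
Qed.

(** The matrix A of values is invertible because the degrees are distinct and at most N.
    Orthogonality makes A W A^T diagonal, with W the diagonal matrix of the weights, so the squared
    norms are nonzero without being computed, although the weights are complex. The inverse of A
    then gives the expansion. *)
Lemma orth_expansion (f : nat -> F) x : (x <= N)%N ->
  f x = \sum_(m < N.+1) pairing f (fun x => (P m).[t x])
     / pairing (fun x => (P m).[t x]) (fun x => (P m).[t x]) * (P m).[t x].
Proof.
move=> xN; pose A := \matrix_(n < N.+1, y < N.+1) (P n).[t y].
pose h m := pairing (fun x => (P m).[t x]) (fun x => (P m).[t x]).
have A0 : \det A != 0.
  apply/det0P => -[v v0 vA].
  pose q := \sum_(n < N.+1) v 0 n *: P n.
  have qroot (y : nat) : (y <= N)%N -> q.[t y] = 0.
    move=> yN; have yN' : (y < N.+1)%N by [].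
    have := congr1 (fun u : 'rV_N.+1 => u 0 (Ordinal yN')) vA.
    rewrite !mxE => E; rewrite -[RHS]E /q horner_sum; apply: eq_bigr => n _.
    by rewrite hornerZ !mxE.
  have q0 : q = 0.
    apply: (@roots_geq_poly_eq0 _ _ [seq t y | y <- iota 0 N.+1]).
    - apply/allP => z /mapP[y]; rewrite mem_iota /= add0n ltnS => yN ->.
      by apply/eqP/qroot.
    - rewrite map_inj_in_uniq ?iota_uniq // => y z.
      by rewrite !mem_iota /= !add0n !ltnS; apply: t_inj.
    - rewrite size_map size_iota; apply/leq_sizeP => j hj.
      rewrite coef_sum big1 // => n _; rewrite coefZ nth_default ?mulr0 //.
      by rewrite P_size ?leq_ord // (leq_trans _ hj).
  have /rV0Pn[k0 vk0] := v0.
  have [k vk kmax] := @arg_maxnP _ k0 (fun k => v 0 k != 0) (fun k => k : nat) vk0.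
  have kN : (k <= N)%N by rewrite -ltnS.
  have Pk : (P k)`_k != 0.
    have : lead_coef (P k) != 0 by rewrite lead_coef_eq0 -size_poly_eq0 P_size.
    by rewrite lead_coefE P_size.
  have := congr1 (fun p : {poly F} => p`_k) q0.
  rewrite coef0 coef_sum (bigD1 k) //= big1 ?addr0 => [|n nk]; last first.
    rewrite coefZ; have [vn|] := eqVneq (v 0 n) 0; first by rewrite vn mul0r.
    move=> vn; have nlek : (n <= k)%N := kmax _ vn; rewrite [X in _ * X]nth_default ?mulr0 //.
    by rewrite P_size ?leq_ord // ltn_neqAle nlek andbT.
  by apply/eqP; rewrite coefZ mulf_neq0.
have AW : A *m (diag_mx (\row_(y < N.+1) w y) *m A^T) = diag_mx (\row_(n < N.+1) h n).
  apply/matrixP => n m; rewrite !mxE.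
  transitivity (pairing (fun x => (P n).[t x]) (fun x => (P m).[t x])).
    apply: eq_bigr => y _; rewrite !mxE (bigD1 y) //= big1 ?addr0 => [|z zy].
      by rewrite !mxE eqxx mulr1n; ring.
    by rewrite !mxE eq_sym (negPf zy) mulr0n mul0r.
  have [->|nm] := eqVneq n m; first by rewrite mulr1n.
  by rewrite mulr0n P_orth ?leq_ord.
have h0 m : (m <= N)%N -> h m != 0.
  move=> mN; have : \det (diag_mx (\row_(n < N.+1) h n)) != 0.
    rewrite -AW !det_mulmx det_tr det_diag !mulf_neq0 // prodf_seq_neq0.
    by apply/allP => y _ /=; rewrite mxE w_neq0 ?leq_ord.
  have mN' : (m < N.+1)%N by [].
  by rewrite det_diag (bigD1 (Ordinal mN')) //= mxE mulf_eq0 negb_or => /andP[].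
pose Dh : 'M[F]_N.+1 := diag_mx (\row_(n < N.+1) (h n)^-1).
have AB : A *m (diag_mx (\row_(y < N.+1) w y) *m A^T *m Dh) = 1%:M.
  rewrite mulmxA AW /Dh; apply/matrixP => n m; rewrite mul_diag_mx !mxE.
  have [->|nm] := eqVneq n m; last by rewrite mulr0n mulr0.
  by rewrite !mulr1n divff // h0 ?leq_ord.
have {AB}BA := mulmx1C AB.
pose fr : 'rV[F]_N.+1 := \row_y f y.
have xN' : (x < N.+1)%N by [].
pose Bm := diag_mx (\row_(y < N.+1) w y) *m A^T *m Dh.
have -> : f x = \sum_m (fr *m Bm) 0 m * (P m).[t x].
  transitivity ((fr *m Bm *m A) 0 (Ordinal xN')); first by rewrite -mulmxA BA mulmx1 mxE.
  by rewrite mxE; apply: eq_bigr => m _; rewrite [A _ _]mxE.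
apply: eq_bigr => m _; congr (_ * _); rewrite /Bm !mulmxA mul_mx_diag mxE.
congr (_ * _); last by rewrite mxE.
rewrite mxE; apply: eq_bigr => y _; rewrite mul_mx_diag !mxE; ring.
Qed.

End OrthogonalSystem.

Section Band.

Variables (F : numFieldType) (L : lattice F).
Local Notation lev := (lev L).
Local Notation asym := (asym L).
Local Notation node := (node L).

(* [nu (x + 1) / nu x = U x / U' (x + 1)], where
   [U, U' = u1 * node + u0 +/- ub * asym 0]. *)
Record weight := Weight {
  wu1 : F; wu0 : F; wub : F; wnu : nat -> F;
  wup := fun x : int => (wu1 * node x + wu0) + wub * asym 0 x%:~R;
  wdn := fun x : int => (wu1 * node x + wu0) - wub * asym 0 x%:~R;
  wnuS : forall x : nat, wnu x * wup x = wnu x.+1 * wdn x.+1;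
  wgosper : forall n, let: (e, o) := eo_lead (lla L 1 0 0) (llb L 1 0 0) (lq2 L) n in
     wu1 * o + wub * e != 0
}.

Lemma weight_sum (nu : weight) (p : {poly F}) : exists s e : {poly F},
  [/\ (size e <= (size p).+1)%N,
      forall x : nat, wup nu x * s.[lev 1 x%:~R] *+ 2 = e.[node x] + asym 0 x%:~R * p.[node x],
      forall x : nat, wdn nu x * s.[lev 1 (x%:Z - 1)%:~R] *+ 2 = e.[node x] - asym 0 x%:~R * p.[node x]
    & forall a b : nat, (a <= b)%N ->
      \sum_(a <= x < b) wnu nu x * asym 0 x%:~R * p.[node x]
      = wnu nu b * wdn nu b * s.[lev 1 (b%:Z - 1)%:~R]
        - wnu nu a * wdn nu a * s.[lev 1 (a%:Z - 1)%:~R]].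
Proof.
have hg n : wu1 nu * (eo_lead (lla L 1 0 0) (llb L 1 0 0) (lq2 L) n).2
   + wub nu * (eo_lead (lla L 1 0 0) (llb L 1 0 0) (lq2 L) n).1 != 0.
  by have := wgosper nu n; case: (eo_lead _ _ _ _).
have [s [e [_ se h1 h2]]] := lev_gosper (wu0 nu) p hg.
have two0 : (2 : F) != 0 by rewrite pnatr_eq0.
have h1' (x : nat) : wup nu x * s.[lev 1 x%:~R] *+ 2 = e.[node x] + asym 0 x%:~R * p.[node x].
  exact: h1.
have h2' (x : nat) : wdn nu x * s.[lev 1 (x%:Z - 1)%:~R] *+ 2 = e.[node x] - asym 0 x%:~R * p.[node x].
  by rewrite rmorphB; apply: h2.
exists s, e; split=> // a b ab.
rewrite (telescope_sumr_eq (fun x : nat => wnu nu x * wdn nu x * s.[lev 1 (x%:Z - 1)%:~R])) // => x _.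
have -> : x.+1%:Z - 1 = x%:Z by lia.
rewrite -wnuS; apply: (mulfI two0).
have -> : 2 * (wnu nu x * asym 0 x%:~R * p.[node x])
   = wnu nu x * ((e.[node x] + asym 0 x%:~R * p.[node x]) - (e.[node x] - asym 0 x%:~R * p.[node x])).
  by ring.
by rewrite -h1' -h2'; ring.
Qed.

Variables (r N : nat) (X : {poly F}) (kap : seq (nat * {poly F})) (b : nat).
Hypothesis kap_deg : forall m, m \in kap -> (m.1 + size m.2 <= b)%N.
Hypothesis X_deg : (size X <= b.+1)%N.

Definition kernel (t s : F) := \sum_(m <- kap) t ^+ m.1 * m.2.[s].

Hypothesis X_diag : forall x : nat,
  X.[lev r.+1%:Z x%:~R] - X.[lev r.+1%:Z (x%:Z - r.+1%:Z)%:~R]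
  = asym 0 x%:~R * kernel (node x) (node x).

(** The reflection that fixes [node x] exchanges the arguments x and x - r - 1 of [lev r.+1]. By
    [X_diag], the diagonal of the kernel is therefore twice the odd part of [X]. *)
Let X_even : exists2 X1 : {poly F}, (size X1 <= b.+1)%N & forall x : nat,
  X.[lev r.+1%:Z x%:~R] *+ 2 = X1.[node x] + asym 0 x%:~R * kernel (node x) (node x).
Proof.
exists (evp L r.+1%:Z 0 0 X *+ 2) => [|x].
  rewrite -scaler_nat; apply: leq_trans (size_scale_leq _ _) _.
  exact: leq_trans (evp_size _ _ _ _ _) X_deg.
rewrite -X_diag.
have -> : lev r.+1%:Z x%:~R = lev r.+1%:Z (x%:~R + 0%:~R) by rewrite addr0.
have -> : lev r.+1%:Z (x%:Z - r.+1%:Z)%:~R = lev r.+1%:Z (x%:~R + (0 - r.+1%:Z - 0)%:~R).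
  by congr (lev _ _); rewrite -rmorphD; congr (_%:~R); lia.
by rewrite (evodE L r.+1%:Z 0 0) evodJ hornerMn /node; ring.
Qed.

(** For each entry of the kernel the sum telescopes to a boundary term at [x], half the sum of an
    even part [e] and an odd part; the other end vanishes with [nu] at [N.+1]. The odd parts add up
    to the diagonal of the kernel and cancel the odd part of [X], leaving a polynomial in
    [node x]. *)
Lemma kernel_band_up (nu : weight) (p : {poly F}) :
  wnu nu N.+1 = 0 ->
  exists2 q : {poly F}, (size q <= b + size p)%N & forall x : nat, (x <= N)%N ->
    wnu nu x * q.[node x]
    = X.[lev r.+1%:Z x%:~R] * (wnu nu x * p.[node x])
      + \sum_(x.+1 <= z < N.+1) asym 0 z%:~R * kernel (node x) (node z) * (wnu nu z * p.[node z]).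
Proof.
move=> nuN; have two0 : (2 : F) != 0 by rewrite pnatr_eq0.
have [->|p0] := eqVneq p 0.
  exists 0 => [|x xN]; first by rewrite size_poly0.
  by rewrite !horner0 !mulr0 big1 ?addr0 // => z _; rewrite horner0 !mulr0.
have [X1 sX1 hX1] := X_even.
have /choice[s /choice[e h]] := fun m : nat * {poly F} => weight_sum nu (p * m.2).
exists (2^-1 *: (X1 * p - \sum_(m <- kap) 'X^(m.1) * e m)).
  apply: leq_trans (size_scale_leq _ _) _; rewrite (leq_trans (size_polyD _ _)) //.
  rewrite size_polyN geq_max; apply/andP; split.
    apply: leq_trans (size_polyMleq _ _) _.
    by rewrite -subn1 leq_subLR addnA add1n leq_add2r.
  rewrite big_seq; apply: (leq_trans (size_sum _ _ _)); apply/bigmax_leqP_seq => m mk _.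
  have [he _ _ _] := h m; have hm := kap_deg mk.
  have hpm : (size (p * m.2)%R <= (size p + size m.2).-1)%N by exact: size_polyMleq.
  have sp : (0 < size p)%N by rewrite size_poly_gt0.
  apply: leq_trans (size_polyMleq _ _) _; rewrite size_polyXn /=.
  move: he hm hpm sp; move: (size (e m)) (size (p * m.2)%R) (size p) (size m.2) (m.1).
  by move=> n1 n2 n3 n4 n5; lia.
move=> x xN.
transitivity (2^-1 * (X.[lev r.+1%:Z x%:~R] *+ 2 * (wnu nu x * p.[node x])
   - \sum_(m <- kap) node x ^+ m.1 * (wnu nu x * (wup nu x * (s m).[lev 1 x%:~R] *+ 2)))).
  rewrite hX1 hornerZ hornerD hornerN hornerM horner_sum.
  have -> : \sum_(m <- kap) node x ^+ m.1 * (wnu nu x * (wup nu x * (s m).[lev 1 x%:~R] *+ 2))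
     = \sum_(m <- kap) node x ^+ m.1 * (wnu nu x * (e m).[node x])
       + asym 0 x%:~R * kernel (node x) (node x) * (wnu nu x * p.[node x]).
    rewrite /kernel mulr_sumr mulr_suml -big_split; apply: eq_bigr => m _ /=.
    by have [_ -> _ _] := h m; rewrite hornerM; ring.
  have -> : \sum_(m <- kap) ('X^(m.1) * e m).[node x] = \sum_(m <- kap) node x ^+ m.1 * (e m).[node x].
    by apply: eq_bigr => m _; rewrite hornerM hornerXn.
  have -> : \sum_(m <- kap) node x ^+ m.1 * (wnu nu x * (e m).[node x])
     = wnu nu x * \sum_(m <- kap) node x ^+ m.1 * (e m).[node x].
    by rewrite mulr_sumr; apply: eq_bigr => m _; ring.
  by ring.
rewrite mulrBr; congr (_ + _); first by field.
have -> : \sum_(x.+1 <= z < N.+1) asym 0 z%:~R * kernel (node x) (node z) * (wnu nu z * p.[node z])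
   = \sum_(m <- kap) node x ^+ m.1 *
       (\sum_(x.+1 <= z < N.+1) wnu nu z * asym 0 z%:~R * (p * m.2).[node z]).
  under [RHS]eq_bigr do rewrite mulr_sumr.
  rewrite exchange_big; apply: eq_bigr => z _ /=.
  rewrite /kernel mulr_sumr mulr_suml; apply: eq_bigr => m _.
  by rewrite hornerM; ring.
rewrite mulr_sumr -sumrN; apply: eq_bigr => m _.
have [_ _ _ h3] := h m; rewrite h3 // nuN !mul0r sub0r -wnuS.
have -> : x.+1%:Z - 1 = x%:Z by lia.
by field.
Qed.

(** The transposed sum runs over the first argument of the kernel. Its end at 0 vanishes with
    [wdn rho 0]. At [z] the boundary term involves [wdn], whose odd part has the opposite sign, so
    it again cancels the odd part of [X]. *)
Lemma kernel_band_down (rho : weight) (p : {poly F}) :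
  wdn rho 0 = 0 ->
  exists2 q : {poly F}, (size q <= b + size p)%N & forall z : nat,
    wnu rho z * q.[node z]
    = X.[lev r.+1%:Z z%:~R] * (wnu rho z * p.[node z])
      + \sum_(0 <= x < z) asym 0 x%:~R * kernel (node x) (node z) * (wnu rho x * p.[node x]).
Proof.
move=> wd0; have two0 : (2 : F) != 0 by rewrite pnatr_eq0.
have [X1 sX1 hX1] := X_even.
have /choice[s /choice[e h]] := fun m : nat * {poly F} => weight_sum rho (p * 'X^(m.1)).
exists (2^-1 *: (X1 * p + \sum_(m <- kap) m.2 * e m)).
  apply: leq_trans (size_scale_leq _ _) _; rewrite (leq_trans (size_polyD _ _)) //.
  rewrite geq_max; apply/andP; split.
    apply: leq_trans (size_polyMleq _ _) _.
    by rewrite -subn1 leq_subLR addnA add1n leq_add2r.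
  rewrite big_seq; apply: (leq_trans (size_sum _ _ _)); apply/bigmax_leqP_seq => m mk _.
  have [he _ _ _] := h m; have hm := kap_deg mk.
  have hpm : (size (p * 'X^(m.1))%R <= size p + m.1)%N.
    by apply: leq_trans (size_polyMleq _ _) _; rewrite size_polyXn addnS.
  apply: leq_trans (size_polyMleq _ _) _.
  move: he hm hpm; move: (size (e m)) (size (p * 'X^(m.1))%R) (size p) (size m.2) (m.1).
  by move=> n1 n2 n3 n4 n5; lia.
move=> z.
transitivity (2^-1 * (X.[lev r.+1%:Z z%:~R] *+ 2 * (wnu rho z * p.[node z])
   + \sum_(m <- kap) m.2.[node z] * (wnu rho z * (wdn rho z * (s m).[lev 1 (z%:Z - 1)%:~R] *+ 2)))).
  rewrite hX1 hornerZ hornerD hornerM horner_sum.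
  have -> : \sum_(m <- kap) m.2.[node z] * (wnu rho z * (wdn rho z * (s m).[lev 1 (z%:Z - 1)%:~R] *+ 2))
     = wnu rho z * \sum_(m <- kap) (m.2 * e m).[node z]
       - asym 0 z%:~R * kernel (node z) (node z) * (wnu rho z * p.[node z]).
    rewrite /kernel !mulr_sumr mulr_suml -sumrB; apply: eq_bigr => m _ /=.
    by have [_ _ -> _] := h m; rewrite !hornerM hornerXn; ring.
  by ring.
rewrite mulrDr; congr (_ + _); first by field.
have -> : \sum_(0 <= x < z) asym 0 x%:~R * kernel (node x) (node z) * (wnu rho x * p.[node x])
   = \sum_(m <- kap) m.2.[node z] *
       (\sum_(0 <= x < z) wnu rho x * asym 0 x%:~R * (p * 'X^(m.1)).[node x]).
  under [RHS]eq_bigr do rewrite mulr_sumr.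
  rewrite exchange_big; apply: eq_bigr => x _ /=.
  rewrite /kernel mulr_sumr mulr_suml; apply: eq_bigr => m _.
  by rewrite hornerM hornerXn; ring.
rewrite mulr_sumr; apply: eq_bigr => m _.
have [_ _ _ h3] := h m; rewrite h3 // wd0 mulr0 mul0r subr0.
by field.
Qed.

End Band.

(** * The recurrence for Casoratians on the grid *)

Section GridRecurrence.

Variables (F : numFieldType) (L : lattice F).
Local Notation lev := (lev L).
Local Notation asym := (asym L).
Local Notation node := (node L).

Hypothesis node_inj : injective node.

Variables (r N b : nat) (xi : 'I_r.+1 -> {poly F}) (X C : {poly F}).

Definition xi_window (y : int) : 'M[F]_r.+1 := \matrix_(j, k) (xi k).[node (y + j%:Z)].

Definition xi_replaced (y : int) (i : 'I_r.+1) (t : F) : 'M[F]_r.+1 :=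
  \matrix_(j, k) (xi k).[if j == i then t else node (y + j%:Z)].

Let vd (y : int) := vdm (fun j : 'I_r.+1 => node (y + j%:Z)).

Hypothesis X_step : forall y : int,
  X.[lev r.+1%:Z y%:~R] - X.[lev r.+1%:Z (y - 1)%:~R]
  = asym r%:Z y%:~R * C.[lev r%:Z y%:~R] * (\det (xi_window y) / vd y).
Hypothesis X_deg : (size X <= b.+1)%N.
Hypothesis C_deg : (size C + \sum_k (size (xi k)).-1 <= b + \sum_(l < r.+1) l)%N.

Let term (y : int) i t :=
  asym r%:Z y%:~R * C.[lev r%:Z y%:~R] * (\det (xi_replaced y i t) / vd y).

Let term_node (y : int) (i : 'I_r.+1) :
  term y i (node (y + i%:Z)) = X.[lev r.+1%:Z y%:~R] - X.[lev r.+1%:Z (y - 1)%:~R].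
Proof.
rewrite X_step /term; congr (_ * (\det _ / _)); apply/matrixP => j k; rewrite !mxE.
by case: eqP => // ->.
Qed.

Let term_dup (y : int) (i j : 'I_r.+1) : i != j -> term y i (node (y + j%:Z)) = 0.
Proof.
move=> ij; rewrite /term (determinant_alternate ij) ?mul0r ?mulr0 // => k.
by rewrite !mxE eqxx eq_sym (negPf ij).
Qed.

Let kap_ex := kernel_poly node_inj xi C.

Variables (nu rho : weight L) (P : nat -> {poly F}).
Hypothesis nu_gt : forall y, (N < y)%N -> wnu nu y = 0.
Hypothesis rho0 : wdn rho 0 = 0.
Let w (x : nat) := asym 0 x%:~R * wnu nu x * wnu rho x.
Hypothesis w_neq0 : forall x, (x <= N)%N -> w x != 0.
Hypothesis P_size : forall n, (n <= N)%N -> size (P n) = n.+1.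
Hypothesis P_orth : forall n m, (n <= N)%N -> (m <= N)%N -> n != m ->
  pairing N w (fun x => (P n).[node x]) (fun x => (P m).[node x]) = 0.

Let xiw (y : nat) (k : 'I_r.+1) := (xi k).[node y].

Let coef_replaced (z y : nat) (i : 'I_r.+1) :
  \sum_k xiw z k * \adj (cas_mx xiw y) k i = \det (xi_replaced y i (node z)).
Proof.
rewrite (expand_det_row _ i); apply: eq_bigr => k _.
rewrite !mxE eqxx; congr (_ * _); rewrite /cofactor; congr (_ * \det _).
by apply/matrixP => a c; rewrite !mxE eq_sym (negPf (neq_lift _ _)) /xiw -PoszD.
Qed.

(** [th n m] is the coefficient of [P m] in the image [q n] of [P n]. The degree of [q n] kills it
    for [m > n + b]. For [n > m + b] the pairing is rewritten through the adjoint applied to [P m],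
    whose degree is too small. Windows reach past N, but [nu] vanishes there, so an expansion valid
    on the grid suffices. *)
Lemma grid_recurrence : exists th : nat -> nat -> F, forall n x, (n <= N)%N -> (x <= N)%N ->
  X.[lev r.+1%:Z x%:~R] * cas_ext xiw (fun y => wnu nu y * (P n).[node y]) x
  = \sum_(m < N.+1 | (n <= m + b)%N && (m <= n + b)%N)
      th n m * cas_ext xiw (fun y => wnu nu y * (P m).[node y]) x.
Proof.
have [kap hdeg kapE] := kap_ex.
have kap_deg m : m \in kap -> (m.1 + size m.2 <= b)%N.
  move=> /hdeg; move: C_deg; move: (m.1) (size m.2) (size C) => n1 n2 n3.
  by move: (\sum_(l < r.+1) l)%N (\sum_k _)%N => n4 n5; lia.
have kE (t : F) (z : int) : asym 0 z%:~R * kernel kap t (node z) = \sum_(i < r.+1) term (z - i%:Z) i t.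
  by rewrite -kapE.
have X_diag (x : nat) : X.[lev r.+1%:Z x%:~R] - X.[lev r.+1%:Z (x%:Z - r.+1%:Z)%:~R]
   = asym 0 x%:~R * kernel kap (node x) (node x).
  rewrite kE.
  have E (i : 'I_r.+1) : term (x%:Z - i%:Z) i (node x)
     = - (X.[lev r.+1%:Z (x%:Z - i.+1%:Z)%:~R] - X.[lev r.+1%:Z (x%:Z - i%:Z)%:~R]).
    rewrite -{2}[x%:Z](subrK i%:Z) term_node opprB; congr (_ - _.[lev _ _%:~R]); lia.
  under eq_bigr do rewrite E.
  rewrite sumrN -(big_mkord xpredT (fun i => X.[lev r.+1%:Z (x%:Z - i.+1%:Z)%:~R] - X.[lev r.+1%:Z (x%:Z - i%:Z)%:~R])).
  rewrite (telescope_sumr_eq (fun i : nat => X.[lev r.+1%:Z (x%:Z - i%:Z)%:~R])) //.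
  by rewrite subr0 opprB.
pose f n (y : nat) := wnu nu y * (P n).[node y].
have /choice[q hq] : forall n, exists q : {poly F}, (size q <= b + size (P n))%N /\
   forall x : nat, (x <= N)%N ->
    wnu nu x * q.[node x] = X.[lev r.+1%:Z x%:~R] * f n x
      + \sum_(x.+1 <= z < N.+1) asym 0 z%:~R * kernel kap (node x) (node z) * f n z.
  move=> n; have [q h1 h2] := kernel_band_up kap_deg X_deg X_diag (P n) (nu_gt (ltnSn N)).
  by exists q.
(* [cas_ext_intertwine] yields [X] at the next point, hence the shift. The missing increment from
   [Xp z] to [X] at z is the contribution of the window starting at z with its first node
   replaced. *)
pose Xp (y : nat) := X.[lev r.+1%:Z (y%:Z - 1)%:~R].
pose c (y : nat) := asym r%:Z y%:~R * C.[lev r%:Z y%:~R] / vd y.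
have XpS (y : nat) : Xp y.+1 - Xp y = c y * \det (cas_mx xiw y).
  rewrite /Xp; have -> : y.+1%:Z - 1 = y%:Z by lia.
  rewrite X_step mulrA mulrAC; congr (_ * \det _).
have f_gt n y : (N < y)%N -> f n y = 0 by move=> Ny; rewrite /f nu_gt ?mul0r.
have gE n (z : nat) : Xp z * f n z + \sum_k xiw z k * \sum_(z <= y < N.+1) c y * cas_coef xiw (f n) k y
   = wnu nu z * (q n).[node z].
  have [zN|zN] := leqP z N; last first.
    rewrite f_gt // nu_gt // mulr0 mul0r add0r big1 // => k _.
    by rewrite big_geq ?mulr0.
  rewrite (hq n).2 //.
  have -> : \sum_k xiw z k * \sum_(z <= y < N.+1) c y * cas_coef xiw (f n) k y
     = \sum_(i < r.+1) \sum_(z <= y < N.+1) term y i (node z) * f n (y + i)%N.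
    under eq_bigr do rewrite mulr_sumr.
    rewrite exchange_big [RHS]exchange_big; apply: eq_bigr => y _ /=.
    transitivity (\sum_(i < r.+1) c y * (\sum_k xiw z k * \adj (cas_mx xiw y) k i) * f n (y + i)%N).
      rewrite /cas_coef; under eq_bigr do rewrite mulr_sumr mulr_sumr.
      rewrite exchange_big; apply: eq_bigr => i _ /=.
      by rewrite mulr_sumr mulr_suml; apply: eq_bigr => k _; ring.
    by apply: eq_bigr => i _; rewrite coef_replaced /c /term; ring.
  (* The sum over window starts is reindexed by the position of the replaced node, so that it can be
     compared with the kernel, which collects the windows through a given node. *)
  have shift (i : 'I_r.+1) : \sum_(z <= y < N.+1) term y i (node z) * f n (y + i)%N
     = \sum_(z <= y < N.+1) (if (z + i <= y)%N then term (y%:Z - i%:Z) i (node z) else 0) * f n y.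
    pose G y := term (y%:Z - i%:Z) i (node z) * f n y.
    have i0 y : (y < z + i)%N -> (if (z + i <= y)%N then term (y%:Z - i%:Z) i (node z) else 0) * f n y = 0.
      by move=> yz; rewrite leqNgt yz mul0r.
    transitivity (\sum_(z <= y < N.+1 + i)
        (if (z + i <= y)%N then term (y%:Z - i%:Z) i (node z) else 0) * f n y).
      rewrite [RHS](@big_cat_nat _ _ _ (z + i)) ?leq_addr ?leq_add2r ?leqW //=.
      rewrite [X in _ = X + _]big_nat_cond [X in _ = X + _]big1 ?add0r;
        last by move=> y /andP[/andP[_ yz] _]; exact: i0.
      rewrite big_addn addnK; apply: eq_big_nat => y /andP[zy _].
      by rewrite leq_add2r zy; congr (term _ _ _ * _); lia.
    rewrite (@big_cat_nat _ _ _ N.+1) ?leq_addr ?leqW //=.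
    rewrite [X in _ + X]big_nat_cond [X in _ + X]big1 ?addr0 // => y /andP[/andP[Ny _] _].
    by rewrite f_gt ?mulr0.
  under eq_bigr do rewrite shift.
  rewrite exchange_big /= big_ltn // addrA.
  congr (_ + _).
    rewrite (bigD1 ord0) //= big1 ?addr0 => [|i i0]; last first.
      rewrite ifN ?mul0r // -ltnNge; rewrite -val_eqE /= in i0; lia.
    rewrite addn0 leqnn.
    have := term_node z%:Z ord0; rewrite (_ : z%:Z + (ord0 : 'I_r.+1)%:Z = z); last by rewrite /=; lia.
    by move=> ->; rewrite /Xp; ring.
  (* The kernel also counts the windows through [y] that start before [z]. These contain [z] as
     well, so replacing [y] by [z] creates two equal rows. *)
  apply: eq_big_nat => y /andP[zy yN]; rewrite kE mulr_suml; apply: eq_bigr => i _.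
  case: leqP => // lt_y; congr (_ * _).
  have hj : (z + i - y < r.+1)%N by have := ltn_ord i; lia.
  have ij : i != Ordinal hj by rewrite -val_eqE /=; apply/eqP; lia.
  have := term_dup (y%:Z - i%:Z) ij.
  by rewrite (_ : y%:Z - i%:Z + (Ordinal hj)%:Z = z) //=; lia.
exists (fun n m => pairing N w (fun x => (q n).[node x]) (fun x => (P m).[node x])
     / pairing N w (fun x => (P m).[node x]) (fun x => (P m).[node x])).
move=> n x nN xN.
have pos_inj (y z : nat) : (y <= N)%N -> (z <= N)%N -> node y = node z -> y = z.
  by move=> _ _ /node_inj [].
transitivity (cas_ext xiw (fun z => wnu nu z * (q n).[node z]) x).
  have -> : (fun z : nat => wnu nu z * (q n).[node z])
     = (fun z => Xp z * f n z + \sum_k xiw z k * \sum_(z <= y < N.+1) c y * cas_coef xiw (f n) k y).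
    by apply/funext => z; rewrite gE.
  have /= := cas_ext_intertwine x (ltn0Sn r) (f_gt n) XpS; rewrite /Xp => ->.
  by congr (_.[lev _ _%:~R] * _); lia.
have zero m : (m <= N)%N -> ~~ ((n <= m + b)%N && (m <= n + b)%N) ->
   pairing N w (fun x => (q n).[node x]) (fun x => (P m).[node x]) = 0.
  move=> mN; rewrite negb_and -!ltnNge => /orP[mbn|nbm]; last first.
    apply: (orth_low_degree P_size P_orth) => //; apply: leq_trans (hq n).1 _.
    by rewrite P_size //; lia.
  have [q' sq' hq'] := kernel_band_down kap_deg X_deg X_diag (P m) rho0.
  transitivity (pairing N w (fun x => q'.[node x]) (fun x => (P n).[node x])); last first.
    apply: (orth_low_degree P_size P_orth) => //; apply: leq_trans sq' _.
    by rewrite P_size //; lia.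
  (* The double sum over [x < z] is exchanged: the kernel that acts upward on [f n] acts downward on
     [P m], with [rho] in place of [nu]. *)
  pose A (x z : nat) := asym 0 x%:~R * wnu rho x * (P m).[node x] * (asym 0 z%:~R * kernel kap (node x) (node z) * f n z).
  transitivity (\sum_(x < N.+1) (asym 0 x%:~R * wnu rho x * (P m).[node x] * (X.[lev r.+1%:Z x%:~R] * f n x))
     + \sum_(x < N.+1) \sum_(z < N.+1 | (x < z)%N) A x z).
    rewrite -big_split; apply: eq_bigr => x' _ /=.
    have := (hq n).2 x' (leq_ord x'); rewrite (big_geq_mkord _ _ _ (fun z : nat => asym 0 z%:~R * kernel kap (node x') (node z) * f n z)) /=.
    rewrite /A -mulr_sumr -mulrDr => <-; rewrite /w; ring.
  rewrite [X in _ + X](exchange_big_dep xpredT) //= -big_split; apply: eq_bigr => z _ /=.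
  transitivity (asym 0 z%:~R * f n z * (wnu rho z * q'.[node z])); last by rewrite /w /f; ring.
  rewrite hq' mulrDr; congr (_ + _); first by ring.
  rewrite big_mkord (big_ord_widen N.+1 (fun x : nat => asym 0 x%:~R * kernel kap (node x) (node z) * (wnu rho x * (P m).[node x]))) ?leq_ord //; last by rewrite ltnW.
  by rewrite mulr_sumr; apply: eq_bigr => x' _; rewrite /A; ring.
have expand z : (fun z => wnu nu z * (q n).[node z]) z = \sum_(m < N.+1)
   pairing N w (fun x => (q n).[node x]) (fun x => (P m).[node x])
     / pairing N w (fun x => (P m).[node x]) (fun x => (P m).[node x]) * f m z.
  have [zN|zN] := leqP z N; last first.
    by rewrite nu_gt // mul0r big1 // => m _; rewrite f_gt ?mulr0.
  rewrite (orth_expansion pos_inj w_neq0 P_size P_orth (fun x => (q n).[node x]) zN).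
  by rewrite mulr_sumr; apply: eq_bigr => m _; rewrite /f; ring.
rewrite (cas_ext_sum _ _ expand) [RHS]big_mkcond; apply: eq_bigr => m _ /=.
case: ifPn => // hm; by rewrite zero ?leq_ord // !mul0r.
Qed.

End GridRecurrence.

(** * The Racah and q-Racah polynomials *)

Section QPower.

Variable R : realType.
Local Notation C := R[i].

Lemma cexpD (x y : C) : cexp (x + y) = cexp x * cexp y.
Proof.
case: x => x1 x2; case: y => y1 y2; rewrite /cexp /= expRD cosD sinD rmorphM /=.
by rewrite mulrACA; congr (_ * _); simpc; congr (_ +i* _); ring.
Qed.

Lemma cexp0 : cexp (0 : C) = 1.
Proof. by rewrite /cexp /= expR0 cos0 sin0; simpc. Qed.

Variables (q : R) (hq : 0 < q < 1).

Lemma qpowD x y : qpow q (x + y) = qpow q x * qpow q y.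
Proof. by rewrite /qpow mulrDl cexpD. Qed.

Lemma qpow0 : qpow q 0 = 1.
Proof. by rewrite /qpow mul0r cexp0. Qed.

Lemma qpow_neq0 x : qpow q x != 0.
Proof.
have /eqP : qpow q x * qpow q (- x) = 1 by rewrite -qpowD subrr qpow0.
by apply: contraTneq => ->; rewrite mul0r eq_sym oner_neq0.
Qed.

Lemma qpowN x : qpow q (- x) = (qpow q x)^-1.
Proof.
apply: (mulfI (qpow_neq0 x)); rewrite -qpowD subrr qpow0 mulfV //.
exact: qpow_neq0.
Qed.

Lemma qpow1 : qpow q 1 = q%:C.
Proof.
have q0 : 0 < q by case/andP: hq.
by rewrite /qpow mul1r /cexp /= lnK // cos0 sin0; simpc.
Qed.

Lemma qC_neq0 : q%:C != 0 :> C.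
Proof. by rewrite -qpow1 qpow_neq0. Qed.

Lemma qpow_nat (n : nat) : qpow q n%:R = q%:C ^+ n.
Proof. by elim: n => [|n IHn]; rewrite ?qpow0 // -natr1 qpowD IHn qpow1 exprSr. Qed.

Lemma qpow_int (n : int) : qpow q n%:~R = q%:C ^ n.
Proof.
case: n => n; first exact: qpow_nat.
by rewrite NegzE rmorphN /= qpowN [_%:~R]/(_%:R) qpow_nat.
Qed.

Lemma qC_expfz_inj : injective (fun n : int => q%:C ^ n : C).
Proof.
have [q0 q1] := andP hq.
have h (n : nat) (k : int) : q%:C ^ k = q%:C ^ (k + n.+1%:Z) :> C -> False.
  rewrite expfzDr ?qC_neq0 // => /esym/eqP; rewrite -subr_eq0 -{2}[_ ^ k]mulr1 -mulrBr.
  rewrite mulf_eq0 expfz_eq0 (negPf qC_neq0) andbF /= subr_eq0.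
  rewrite -[_ ^ _]/(q%:C ^+ n.+1) -rmorphXn /= => /eqP/complexI E.
  by have := exprn_ilt1 n.+1 (ltW q0) q1; rewrite E ltxx.
move=> k1 k2 /= E; apply: contrapT => ne.
have [lt|le] := ltP k1 k2.
  apply: (h `|k2 - k1|.-1%N k1); rewrite E; congr (_ ^ _); lia.
apply: (h `|k1 - k2|.-1%N k2); rewrite -E; congr (_ ^ _); lia.
Qed.

End QPower.

(** * The two quadratic lattices *)

Section Instances.

Variable R : realType.
Local Notation C := R[i].

Lemma eo_lead_racah (n : nat) : eo_lead (1 : C) 2^-1 0 n = (1, n%:R / 2).
Proof.
elim: n => [|n IHn]; first by rewrite /= mul0r.
by rewrite /= IHn -natr1; congr (_, _); field.
Qed.

(** Half the sum of [lev s (y + k)] and its reflection gives [lla] and [llc]; half the difference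
    gives [llb]. *)
Definition racah_lattice (d : C) : lattice C.
Proof.
refine (@Lattice _ (fun s x => x * (x + (d + s%:~R))) (fun m x => 2 * x + (d + m%:~R))
  (fun _ _ _ => 1) (fun s k m => (2 * k%:~R + s%:~R - m%:~R) / 2)
  (fun s k m => k%:~R * (k%:~R + d + s%:~R) - (2 * k%:~R + s%:~R - m%:~R) * (d + m%:~R) / 2)
  0 (fun _ => 4) (fun m => (d + m%:~R) ^+ 2) 0 1 (fun j => j%:R) _ _ _ _ _ _ _ _ _ _ _ _ _ _).
- by move=> s k m y; field.
- by move=> s k m y; rewrite !rmorphB /=; field.
- by move=> m y; ring.
- by rewrite expr0n.
- exact: oner_neq0.
- by left.
- by move=> s k m; rewrite mul0r addr0 exp1rz.
- by move=> s k m; rewrite mul0r subr0 exp1rz.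
- by move=> j y; ring.
- by move=> j j0; rewrite pnatr_eq0 -lt0n.
- by [].
- by move=> r; rewrite !rmorphD /=; field.
- by rewrite /= !mulr0 add0r subr0 mul1r invr_eq0 pnatr_eq0.
- move=> n n0; rewrite /= !mulr0 add0r subr0 mul1r eo_lead_racah /=.
  by rewrite mulf_neq0 ?invr_eq0 ?pnatr_eq0 // -lt0n.
Defined.

Variables (q : R) (hq : 0 < q < 1).
Local Notation qc := (q%:C : C).

Lemma eo_lead_qracah (n : nat) :
  eo_lead ((1 + qc) / 2) ((1 - qc) / 2) 1 n = ((1 + qc ^+ n) / 2, (1 - qc ^+ n) / 2).
Proof.
elim: n => [|n IHn]; first by rewrite /= subrr mul0r; congr (_, _); field.
by rewrite /= IHn exprS; congr (_, _); field.
Qed.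

Let q0 : qc != 0 := qC_neq0 hq.
Let qz k : qc ^ k != 0. Proof. by rewrite expfz_neq0. Qed.

Definition qracah_lattice (d : C) : lattice C.
Proof.
refine (@Lattice _ (fun s x => (qpow q (- x) - 1) * (1 - d * qc ^ s * qpow q x))
  (fun m x => qpow q (- x) - d * qc ^ m * qpow q x)
  (fun s k m => ((qc ^ k)^-1 + qc ^ s * qc ^ k / qc ^ m) / 2)
  (fun s k m => ((qc ^ k)^-1 - qc ^ s * qc ^ k / qc ^ m) / 2)
  (fun s k m => ((qc ^ k)^-1 + qc ^ s * qc ^ k / qc ^ m) / 2 * (1 + d * qc ^ m) - 1 - d * qc ^ s)
  1 (fun m => 2 * (1 + d * qc ^ m)) (fun m => (1 - d * qc ^ m) ^+ 2) 1 qc^-1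
  (fun j => (qc ^+ j)^-1 - 1) _ _ _ _ _ _ _ _ _ _ _ _ _ _).
- move=> s k m y; rewrite !qpowN qpowD qpow_int //.
  by field; rewrite !qz qpow_neq0.
- move=> s k m y; rewrite !qpowN qpowD qpow_int // !expfzDr // -!invr_expz.
  by field; rewrite !qz qpow_neq0.
- by move=> m y; rewrite !qpowN; field; rewrite qpow_neq0.
- by rewrite expr1n.
- by rewrite invr_eq0.
- right; split; first by rewrite invr_eq0.
  move=> m n /=; rewrite !exprVn => /invr_inj E.
  by have [] := @qC_expfz_inj _ _ hq m%:Z n%:Z E.
- by move=> s k m; rewrite mul1r exprz_inv -!invr_expz; field; rewrite !qz.
- move=> s k m; rewrite mul1r exprz_inv -!invr_expz !expfzDr // -!invr_expz.
  by field; rewrite !qz.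
- move=> j y; rewrite !qpowN qpowD qpow_nat // expr0z /= -exprnP.
  by field; rewrite qpow_neq0 expf_neq0.
- move=> j j0; rewrite subr_eq0 invr_eq1 -(expr0 qc); apply/eqP => E.
  by have [j1] := @qC_expfz_inj _ _ hq j%:Z 0%:Z E; rewrite j1 in j0.
- by move=> r; rewrite expfzDr // expr0z expr1z; field; rewrite qz.
- by move=> r; rewrite expfzDr // expr0z expr1z; field; rewrite qz.
- rewrite !expr0z expr1z !(invr1, divr1, mulr1) mulf_neq0 ?invr_eq0 ?pnatr_eq0 // subr_eq0.
  apply/eqP => E; have := @qC_expfz_inj _ _ hq 0%:Z 1%:Z.
  by rewrite expr0z expr1z => /(_ E).
- move=> n n0; rewrite !expr0z expr1z !(invr1, divr1, mulr1) eo_lead_qracah /=.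
  rewrite mulf_neq0 ?invr_eq0 ?pnatr_eq0 // subr_eq0; apply/eqP => E.
  by have [n1] := @qC_expfz_inj _ _ hq 0%:Z n%:Z E; rewrite -n1 in n0.
Defined.

End Instances.

Definition lattice_of (R : realType) (fam : racah_case R) (d : R[i]) : lattice R[i] :=
  match fam with
  | Racah => racah_lattice d
  | qRacah q hq => qracah_lattice hq d
  end.

Lemma lev_etax (R : realType) (fam : racah_case R) (l : params R[i]) s x :
  lev (lattice_of fam (pd l)) s x = etax fam x (shift_params fam l s).
Proof. by case: l => a b c d; case: fam => [|q hq]; [|reflexivity]. Qed.

Lemma etax_lev0 (R : realType) (fam : racah_case R) (l : params R[i]) x :
  etax fam x l = lev (lattice_of fam (pd l)) 0 x.
Proof.
case: l => a b c d; case: fam => [|q hq]; first by rewrite /= addr0.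
transitivity ((qpow q (- x) - 1) * (1 - d * 1 * qpow q x)); last exact: erefl.
by rewrite mulr1.
Qed.

Lemma size_newton_sum (F : fieldType) (s nd c : nat -> F) n :
  (forall i, s i != 0) -> c n != 0 ->
  size (\sum_(k < n.+1) c k *: \prod_(i < k) (s i *: ((nd i)%:P - 'X))) = n.+1.
Proof.
move=> s0 cn; pose t k : {poly F} := \prod_(i < k) (s i *: ((nd i)%:P - 'X)).
have st k : size (t k) = k.+1.
  elim: k => [|k IHk]; first by rewrite /t big_ord0 size_poly1.
  have s1 : size ((nd k)%:P - 'X : {poly F}) = 2 by rewrite -opprB size_polyN size_XsubC.
  have t0 : t k != 0 by rewrite -size_poly_eq0 IHk.
  have u0 : s k *: ((nd k)%:P - 'X) != 0 by rewrite scaler_eq0 (negPf (s0 k)) -size_poly_eq0 s1.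
  by rewrite /t big_ord_recr /= size_mul // IHk size_scale // s1 addn2.
rewrite big_ord_recr /= addrC size_polyDl size_scale // st //.
rewrite ltnS; apply: (leq_trans (size_sum _ _ _)); apply/bigmax_leqP => i _.
by apply: leq_trans (size_scale_leq _ _) _; rewrite [size _]st.
Qed.

(** * Hypergeometric sums in a Newton basis *)

Section HypergeometricPolynomials.

Variable R : realType.
Local Notation C := R[i].

Lemma pochsS (F : fieldType) (zs : seq F) k :
  pochs zs k.+1 = pochs zs k * \prod_(z <- zs) (z + k%:R).
Proof. by rewrite /pochs -big_split; apply: eq_bigr => z _; rewrite big_ord_recr. Qed.

Lemma qpochsS (F : fieldType) (p : F) (zs : seq F) k :
  qpochs p zs k.+1 = qpochs p zs k * \prod_(z <- zs) (1 - z * p ^+ k).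
Proof. by rewrite /qpochs -big_split; apply: eq_bigr => z _; rewrite big_ord_recr. Qed.

Lemma pochs_neq0 (F : fieldType) (zs : seq F) k :
  (forall z i, z \in zs -> (i < k)%N -> z + i%:R != 0) -> pochs zs k != 0.
Proof.
move=> h; rewrite prodf_seq_neq0; apply/allP => z zs0 /=.
by rewrite prodf_seq_neq0; apply/allP => i _ /=; apply: h.
Qed.

Lemma qpochs_neq0 (F : fieldType) (p : F) (zs : seq F) k :
  (forall z i, z \in zs -> (i < k)%N -> 1 - z * p ^+ i != 0) -> qpochs p zs k != 0.
Proof.
move=> h; rewrite prodf_seq_neq0; apply/allP => z zs0 /=.
by rewrite prodf_seq_neq0; apply/allP => i _ /=; apply: h.
Qed.

Definition hyp_coef (fam : racah_case R) n (l : params C) k : C :=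
  match fam with
  | Racah => pochs [:: - n%:R; n%:R + dtilde fam l] k
      / (pochs [:: pa l; pb l; pc l] k * k`!%:R)
  | qRacah q _ => qpochs q%:C [:: q%:C ^- n; dtilde fam l * q%:C ^+ n] k
      / (qpochs q%:C [:: pa l; pb l; pc l] k * qpochs q%:C [:: q%:C] k) * q%:C ^+ k
  end.

Definition newton_basis (fam : racah_case R) (l : params C) k (x : C) : C :=
  match fam with
  | Racah => pochs [:: - x; x + pd l] k
  | qRacah q _ => qpochs q%:C [:: qpow q (- x); pd l * qpow q x] k
  end.

Lemma checkP0E fam n x (l : params C) :
  checkP0 fam n x l = \sum_(k < n.+1) hyp_coef fam n l k * newton_basis fam l k x.
Proof.
case: l => a b c d; case: fam => [|q hq]; rewrite /checkP0 /hyp_coef /newton_basis;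
  apply: eq_bigr => k _.
- have -> : pochs [:: - n%:R; n%:R + dtilde Racah (Params a b c d); - x; x + d] k
     = pochs [:: - n%:R; n%:R + dtilde Racah (Params a b c d)] k * pochs [:: - x; x + d] k.
    by rewrite /pochs !big_cons !big_nil; ring.
  by rewrite /= mulrAC.
- rewrite /=; set dt := _ * q%:C ^+ n.
  have -> : qpochs q%:C [:: q%:C ^- n; dt; qpow q (- x); d * qpow q x] k
     = qpochs q%:C [:: q%:C ^- n; dt] k * qpochs q%:C [:: qpow q (- x); d * qpow q x] k.
    by rewrite /qpochs !big_cons !big_nil; ring.
  by rewrite /dt mulrAC [in RHS]mulrAC -!mulrA; congr (_ * _); ring.
Qed.

(** In the q-Racah case the i-th factor (1 - q^(i-x))(1 - d q^(x+i)) is q^i times eta(i) -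
    eta(x). *)
Definition basis_scale (fam : racah_case R) (i : nat) : C :=
  if fam is qRacah q _ then q%:C ^+ i else 1.

Lemma basis_scale_neq0 fam i : basis_scale fam i != 0.
Proof.
case: fam => [|q hq] /=; first exact: oner_neq0.
by rewrite expf_neq0 // (qC_neq0 hq).
Qed.

Lemma newton_basisE fam l k x : newton_basis fam l k x =
  (\prod_(i < k) (basis_scale fam i *: ((etax fam i%:R l)%:P - 'X))).[etax fam x l].
Proof.
elim: k => [|k IHk].
  rewrite big_ord0 hornerC /newton_basis.
  by case: fam => [|q hq]; rewrite /pochs /qpochs !big_cons !big_nil !big_ord0 !mulr1.
rewrite big_ord_recr /= hornerM -IHk !hornerE /newton_basis /etax /=.
case: fam {IHk} => [|q hq] /=.
  by rewrite pochsS !big_cons big_nil mulr1; congr (_ * _); ring.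
rewrite qpochsS !big_cons big_nil mulr1 !qpowN qpow_nat //.
by field; rewrite !qpow_neq0 expf_neq0 // (qC_neq0 hq).
Qed.

Definition hyp_regular (fam : racah_case R) n (l : params C) : Prop :=
  forall i, (i < n)%N -> match fam with
  | Racah => [/\ pa l + i%:R != 0, pb l + i%:R != 0, pc l + i%:R != 0 &
      n%:R + dtilde fam l + i%:R != 0]
  | qRacah q _ => [/\ 1 - pa l * q%:C ^+ i != 0, 1 - pb l * q%:C ^+ i != 0,
      1 - pc l * q%:C ^+ i != 0 & 1 - dtilde fam l * q%:C ^+ n * q%:C ^+ i != 0]
  end.

Lemma hyp_coef_neq0 fam n l : hyp_regular fam n l -> hyp_coef fam n l n != 0.
Proof.
rewrite /hyp_regular /hyp_coef; case: fam => [|q hq] h.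
  rewrite mulf_neq0 ?invr_eq0 ?mulf_neq0 ?pnatr_eq0 -?lt0n ?fact_gt0 //; apply: pochs_neq0 => z i.
    rewrite !inE => /orP[]/eqP-> lt_in; last by have [] := h i lt_in.
    by rewrite addrC subr_eq0 eqr_nat neq_ltn lt_in.
  by rewrite !inE => /or3P[]/eqP-> lt_in; have [] := h i lt_in.
have q0 : q%:C != 0 :> C := qC_neq0 hq.
have qinj := @qC_expfz_inj _ _ hq.
rewrite !mulf_neq0 ?invr_eq0 ?mulf_neq0 ?expf_neq0 //; apply: qpochs_neq0 => z i.
- rewrite !inE => /orP[]/eqP-> lt_in; last by have [] := h i lt_in.
  rewrite subr_eq0; apply/eqP => /(congr1 (fun u => q%:C ^+ n * u)).
  rewrite mulr1 mulrA mulfV ?expf_neq0 // mul1r => E.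
  by have [E'] := qinj n%:Z i%:Z E; rewrite E' ltnn in lt_in.
- by rewrite !inE => /or3P[]/eqP-> lt_in; have [] := h i lt_in.
- rewrite inE => /eqP-> _; rewrite -exprS subr_eq0; apply/eqP => E.
  by have := qinj 0%:Z i.+1%:Z E.
Qed.

Definition hyp_poly fam n (l : params C) : {poly C} :=
  \sum_(k < n.+1) hyp_coef fam n l k *:
    \prod_(i < k) (basis_scale fam i *: ((etax fam i%:R l)%:P - 'X)).

Lemma hyp_polyE fam n l x : checkP0 fam n x l = (hyp_poly fam n l).[etax fam x l].
Proof.
rewrite checkP0E /hyp_poly horner_sum; apply: eq_bigr => k _.
by rewrite hornerZ newton_basisE.
Qed.

Lemma size_hyp_poly fam n l : hyp_regular fam n l -> size (hyp_poly fam n l) = n.+1.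
Proof.
move=> h; apply: (size_newton_sum (s := basis_scale fam) (fun i => etax fam i%:R l)).
  exact: basis_scale_neq0.
exact: hyp_coef_neq0.
Qed.

End HypergeometricPolynomials.

(* [f0], [fp], [fm] are the values at [x], [x + 1], [x - 1] of the basis function of
   index [K + 1], and [psi] is the value at [x] of the one of index [K]. *)
Lemma racah_step (F : fieldType) (x a b c d K psi f0 fp fm : F) :
  2 * x + d != 0 -> 2 * x + d - 1 != 0 -> 2 * x + d + 1 != 0 ->
  f0 = psi * ((K - x) * (x + d + K)) ->
  (x + d) * fp = psi * ((- 1 - x) * (x + d + K) * (x + d + K + 1)) ->
  - x * fm = psi * ((K - x) * (K + 1 - x) * (x + d - 1)) ->
  (x + a) * (x + b) * ((x + c) * (x + d)) / ((2 * x + d) * (2 * x + d + 1)) * (f0 - fp)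
  + (x + d - a) * (x + d - b) * ((x + d - c) * (x + d - d)) / ((2 * x + d) * (2 * x + d - 1))
    * (f0 - fm)
  = - ((K + 1) * (K + 1 + (a + b + c - d - 1))) * f0
    + (K + 1) * (a + K) * (b + K) * (c + K) * psi.
Proof.
move=> h0 hm hp -> hfp hfm; set f0' := psi * _.
transitivity ((x + a) * (x + b) * (x + c) / ((2 * x + d) * (2 * x + d + 1)) * ((x + d) * f0' - (x + d) * fp)
  + (x + d - a) * (x + d - b) * (x + d - c) / ((2 * x + d) * (2 * x + d - 1)) * (x * f0' + (- x) * fm)).
  by field; rewrite h0 hm hp.
by rewrite hfp hfm /f0'; field; rewrite h0 hm hp.
Qed.

(* The same with [z = q^x], [K = q^k] and the basis functions of indices [k + 1] and [k]. *)
Lemma qracah_step (F : fieldType) (q z a b c d K psi f0 fp fm : F) :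
  q != 0 -> z != 0 -> K != 0 -> a != 0 -> b != 0 -> c != 0 -> d != 0 ->
  z^-1 - d * z != 0 -> z^-1 - d / q * z != 0 -> (q * z)^-1 - d * z != 0 ->
  f0 = psi * ((1 - K / z) * (1 - d * z * K)) ->
  (1 - d * z) * fp = psi * ((1 - (q * z)^-1) * (1 - d * z * K) * (1 - d * z * K * q)) ->
  (1 - z^-1) * fm = psi * ((1 - K / z) * (1 - q * K / z) * (1 - d * z / q)) ->
  (1 - a * z) * (1 - b * z) * (d / (a * b)) / z * ((1 - c * z) * (1 - d * z) * (d / (c * d)) / z)
    / ((z^-1 - d * z) * ((q * z)^-1 - d * z)) * (f0 - fp)
  + (1 - d / a * z) * (1 - d / b * z) / z * ((1 - d / c * z) * (1 - d / d * z) / z)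
    / ((z^-1 - d * z) * (z^-1 - d / q * z)) * (f0 - fm)
  = - (((q * K)^-1 - 1) * (1 - a * b * c / d / q * (q * K)) / (a * b * c / d / q)) * f0
    + (a * b * c / d / q)^-1 / (q * K) * (1 - a * K) * (1 - b * K) * (1 - c * K) * (1 - q * K) * psi.
Proof.
move=> q0 z0 K0 a0 b0 c0 d0 h0 hm hp -> hfp hfm; set f0' := psi * _.
have e0 : 1 + - (d * z) * z != 0.
  have <- : (z^-1 - d * z) * z = 1 + - (d * z) * z by field.
  exact: mulf_neq0.
have em : q + - (d * z) * z != 0.
  have <- : (z^-1 - d / q * z) * (q * z) = q + - (d * z) * z by field; rewrite q0 z0.
  by rewrite !mulf_neq0.
have ep : 1 + - (d * z) * (q * z) != 0.
  have <- : ((q * z)^-1 - d * z) * (q * z) = 1 + - (d * z) * (q * z) by field; rewrite q0 z0.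
  by rewrite !mulf_neq0.
transitivity ((1 - a * z) * (1 - b * z) * (1 - c * z) * d / (a * b * c * z * z)
    / ((z^-1 - d * z) * ((q * z)^-1 - d * z)) * ((1 - d * z) * f0' - (1 - d * z) * fp)
  - (1 - d / a * z) * (1 - d / b * z) * (1 - d / c * z) / z
    / ((z^-1 - d * z) * (z^-1 - d / q * z)) * ((1 - z^-1) * f0' - (1 - z^-1) * fm)).
  by field; rewrite z0 q0 em e0 c0 b0 a0 ep d0.
rewrite hfp hfm /f0'.
by field; rewrite ?z0 ?q0 ?em ?e0 ?c0 ?b0 ?a0 ?ep ?d0 ?K0.
Qed.

(** * Halves of the orthogonality weight and the difference operator *)

Section Weights.

Variables (R : realType) (fam : racah_case R).
Local Notation C := R[i].

(** In the q-Racah case the factor d / (a b) and the division by q^x make the reflection of the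
    lattice exchange [up_val] and [dn_val]. Hence they are conjugate, as a [weight] requires; [u1],
    [u0] and [ub] below are the coefficients of their common even part and of the odd part. *)
Definition up_val (d a b x : C) : C :=
  match fam with
  | Racah => (x + a) * (x + b)
  | qRacah q _ => (1 - a * qpow q x) * (1 - b * qpow q x) * (d / (a * b)) / qpow q x
  end.

Definition dn_val (d a b x : C) : C :=
  match fam with
  | Racah => (x + d - a) * (x + d - b)
  | qRacah q _ => (1 - d / a * qpow q x) * (1 - d / b * qpow q x) / qpow q x
  end.

(** The first condition is the solvability of the Gosper equation in degree n, the second the
    nonvanishing of the denominators of [pair_nu]. *)
Definition good_pair (d a b : C) : Prop :=
  match fam with
  | Racah => forall n : nat, n%:R + a + b - d != 0 /\ dn_val d a b n.+1%:R != 0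
  | qRacah q _ => [/\ a != 0, b != 0 & forall n : nat,
      d != a * b * q%:C ^+ n /\ dn_val d a b n.+1%:R != 0]
  end.

Let u1 (d a b : C) : C := if fam is qRacah _ _ then (d / (a * b) + 1) / 2 else 1.
Let ub (d a b : C) : C :=
  if fam is qRacah _ _ then (d / (a * b) - 1) / 2 else (a + b - d) / 2.
Let u0 (d a b : C) : C :=
  if fam is qRacah _ _ then (d / (a * b) + 1) / 2 * (1 + d) - (a + b) * (d / (a * b))
  else a * b - (a + b - d) * d / 2.

Lemma up_valE d a b x : good_pair d a b ->
  u1 d a b * lev (lattice_of fam d) 0 x + u0 d a b + ub d a b * asym (lattice_of fam d) 0 x
  = up_val d a b x.
Proof.
rewrite /good_pair /u1 /u0 /ub /up_val; case: fam => [|q hq] /=; first by move=> _; field.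
move=> [a0 b0 _]; rewrite !expr0z !qpowN; by field; rewrite a0 b0 qpow_neq0.
Qed.

Lemma dn_valE d a b x : good_pair d a b ->
  u1 d a b * lev (lattice_of fam d) 0 x + u0 d a b - ub d a b * asym (lattice_of fam d) 0 x
  = dn_val d a b x.
Proof.
rewrite /good_pair /u1 /u0 /ub /dn_val; case: fam => [|q hq] /=; first by move=> _; field.
move=> [a0 b0 _]; rewrite !expr0z !qpowN; by field; rewrite a0 b0 qpow_neq0.
Qed.

Lemma dn_val_neq0 d a b (n : nat) : good_pair d a b -> dn_val d a b n.+1%:R != 0.
Proof.
rewrite /good_pair /dn_val; case: fam => [|q hq]; first by move/(_ n) => [].
by case=> _ _ /(_ n) [].
Qed.

(** The full orthogonality weight is [asym 0] times [pair_nu] for (a, b) times [pair_nu] for (c, d),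
    up to a constant. *)
Definition pair_nu (d a b : C) (x : nat) : C :=
  \prod_(i < x) (up_val d a b i%:R / dn_val d a b i.+1%:R).

Lemma pair_gosper d a b n : good_pair d a b ->
  let L := lattice_of fam d in
  let: (e, o) := eo_lead (lla L 1 0 0) (llb L 1 0 0) (lq2 L) n in
  u1 d a b * o + ub d a b * e != 0.
Proof.
rewrite /good_pair /u1 /ub; case: fam => [|q hq] /=.
  move=> /(_ n) [h _]; rewrite !mulr0 add0r subr0 mul1r eo_lead_racah.
  rewrite (_ : _ + _ = (n%:R + a + b - d) / 2); last by field.
  by rewrite mulf_neq0 ?invr_eq0 ?pnatr_eq0.
move=> [a0 b0 /(_ n) [h _]]; rewrite !expr0z expr1z !(invr1, divr1, mulr1) eo_lead_qracah.
rewrite (_ : _ + _ = (d - a * b * q%:C ^+ n) / (2 * (a * b))); last by field; rewrite a0 b0.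
by rewrite mulf_neq0 ?subr_eq0 // invr_eq0 !mulf_neq0 ?pnatr_eq0.
Qed.

Definition pair_weight d a b (h : good_pair d a b) : weight (lattice_of fam d).
Proof.
apply: (@Weight _ _ (u1 d a b) (u0 d a b) (ub d a b) (pair_nu d a b)).
- move=> x; rewrite /node up_valE // dn_valE //.
  rewrite [x.+1%:~R]/(x.+1%:R) [x%:~R]/(x%:R) /pair_nu big_ord_recr /= -mulrA divfK //.
  exact: dn_val_neq0.
- by move=> n; apply: pair_gosper.
Defined.

Lemma pair_weight_up d a b (h : good_pair d a b) (x : int) :
  wup (pair_weight h) x = up_val d a b x%:~R.
Proof. exact: up_valE. Qed.

Lemma pair_weight_dn d a b (h : good_pair d a b) (x : int) :
  wdn (pair_weight h) x = dn_val d a b x%:~R.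
Proof. exact: dn_valE. Qed.

Section Eigen.

Variables (l : params C).
Hypothesis l_neq0 : if fam is qRacah _ _ then
  [/\ pa l != 0, pb l != 0, pc l != 0 & pd l != 0] else True.

Let L := lattice_of fam (pd l).
Let a := pa l.
Let b := pb l.
Let c := pc l.
Let d := pd l.

(** Up to normalization, [step_up] and [step_dn] are the two potentials of the (q-)Racah difference
    operator. With [asym L (-1)], the value of [step_up] at x and that of [step_dn] at x + 1 share a
    denominator factor, which makes the symmetry visible. In the q-Racah case this normalization
    divides the energies by [dtilde]. *)
Definition step_up (x : C) : C :=
  up_val d a b x * up_val d c d x / (asym L 0 x * asym L (-1) (x + 1)).

Definition step_dn (x : C) : C :=
  dn_val d a b x * dn_val d c d x / (asym L 0 x * asym L (-1) x).

Definition racah_op (f : C -> C) (x : C) : C :=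
  step_up x * (f x - f (x + 1)) + step_dn x * (f x - f (x - 1)).

Definition eigenval (n : nat) : C :=
  if fam is qRacah _ _ then - (energy fam n l / dtilde fam l) else - energy fam n l.

(** [lower 0] vanishes, so the truncated index [k.-1] below is harmless at [k = 0]. *)
Let lower (k : nat) : C :=
  match fam with
  | Racah => k%:R * (a + k%:R - 1) * (b + k%:R - 1) * (c + k%:R - 1)
  | qRacah q _ => (dtilde fam l)^-1 / q%:C ^+ k * (1 - a * q%:C ^+ k / q%:C)
      * (1 - b * q%:C ^+ k / q%:C) * (1 - c * q%:C ^+ k / q%:C) * (1 - q%:C ^+ k)
  end.

(** The operator is bidiagonal in the Newton basis, so the eigenvalue equation becomes a two-term
    recursion for the coefficients, which [hyp_coef] satisfies. *)
Lemma racah_op_basis k x :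
  asym L 0 x != 0 -> asym L (-1) x != 0 -> asym L (-1) (x + 1) != 0 ->
  racah_op (newton_basis fam l k) x
  = eigenval k * newton_basis fam l k x + lower k * newton_basis fam l k.-1 x.
Proof.
rewrite /racah_op /step_up /step_dn /L /lower /eigenval /energy /newton_basis /up_val /dn_val
  -/a -/b -/c -/d.
case: fam l_neq0 => [_|q hq [a0 b0 c0 d0]].
  rewrite /= !mulr0z => h0 hm hp.
  have h0' : 2 * x + d != 0 by rewrite addr0 in h0.
  have hm' : 2 * x + d - 1 != 0 by move: hm; rewrite (_ : d + (-1)%:~R = d - 1) ?addrA.
  have hp' : 2 * x + d + 1 != 0.
    by move: hp; rewrite (_ : 2 * (x + 1) + (d + (-1)%:~R) = 2 * x + d + 1) //; ring.
  rewrite addr0 (_ : 2 * (x + 1) + (d + (-1)%:~R) = 2 * x + d + 1); last by ring.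
  rewrite (_ : 2 * x + (d + (-1)%:~R) = 2 * x + d - 1); last by ring.
  case: k => [|k].
    by rewrite /pochs !big_cons !big_nil !big_ord0 !subrr !mulr0 !mul0r oppr0 mul0r.
  (* A shifted basis function is a multiple of the unshifted one of lower index only after
     multiplication by x + d, or by -x in the other direction. The potentials supply these
     factors. *)
  have up j : (x + d) * pochs [:: - (x + 1); x + 1 + d] j.+1
     = pochs [:: - x; x + d] j * ((- 1 - x) * (x + d + j%:R) * (x + d + j%:R + 1)).
    elim: j => [|j IHj].
      by rewrite pochsS /pochs !big_cons !big_nil !big_ord0; ring.
    by rewrite pochsS mulrA IHj [in RHS]pochsS !big_cons !big_nil -natr1; ring.
  have dn j : - x * pochs [:: - (x - 1); x - 1 + d] j.+1
     = pochs [:: - x; x + d] j * ((j%:R - x) * (j%:R + 1 - x) * (x + d - 1)).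
    elim: j => [|j IHj].
      by rewrite pochsS /pochs !big_cons !big_nil !big_ord0; ring.
    by rewrite pochsS mulrA IHj [in RHS]pochsS !big_cons !big_nil -natr1; ring.
  have f0 : pochs [:: - x; x + d] k.+1 = pochs [:: - x; x + d] k * ((k%:R - x) * (x + d + k%:R)).
    by rewrite pochsS !big_cons big_nil; ring.
  rewrite (racah_step a b c h0' hm' hp' f0 (up k) (dn k)) -natr1 /a /b /c /d.
  by case: l => a' b' c' d' /=; ring.
have q0 : q%:C != 0 :> C := qC_neq0 hq.
have z0 := qpow_neq0 q x; have z1 := qpow_neq0 q (x - 1).
rewrite /= !qpowN !qpowD qpowN qpow1 // expr0z exprN1 !mulr1.
set z := qpow q x => h0 hm hp.
have h0' : z^-1 - d * z != 0 by [].
have hm' : z^-1 - d / q%:C * z != 0 by [].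
have hp' : (q%:C * z)^-1 - d * z != 0.
  by move: hp; congr (_ != 0); field; rewrite q0 z0.
rewrite (_ : (z * q%:C)^-1 - d / q%:C * (z * q%:C) = (q%:C * z)^-1 - d * z); last first.
  by field; rewrite q0 z0.
case: k => [|k].
  by rewrite /qpochs !big_cons !big_nil !big_ord0 !subrr !mulr0 !mul0r invr1 subrr !mul0r oppr0 mul0r add0r.
have up j : (1 - d * z) * qpochs q%:C [:: (z * q%:C)^-1; d * (z * q%:C)] j.+1
   = qpochs q%:C [:: z^-1; d * z] j *
     ((1 - (q%:C * z)^-1) * (1 - d * z * q%:C ^+ j) * (1 - d * z * q%:C ^+ j * q%:C)).
  elim: j => [|j IHj].
    by rewrite qpochsS /qpochs !big_cons !big_nil !big_ord0; field; rewrite q0 z0.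
  rewrite qpochsS [LHS]mulrA IHj [in RHS]qpochsS !big_cons !big_nil exprS.
  by field; rewrite q0 z0.
have dn j : (1 - z^-1) * qpochs q%:C [:: (z / q%:C)^-1; d * (z / q%:C)] j.+1
   = qpochs q%:C [:: z^-1; d * z] j *
     ((1 - q%:C ^+ j / z) * (1 - q%:C * q%:C ^+ j / z) * (1 - d * z / q%:C)).
  elim: j => [|j IHj].
    by rewrite qpochsS /qpochs !big_cons !big_nil !big_ord0; field; rewrite q0 z0.
  rewrite qpochsS [LHS]mulrA IHj [in RHS]qpochsS !big_cons !big_nil exprS.
  by field; rewrite q0 z0.
have f0 : qpochs q%:C [:: z^-1; d * z] k.+1
   = qpochs q%:C [:: z^-1; d * z] k * ((1 - q%:C ^+ k / z) * (1 - d * z * q%:C ^+ k)).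
  by rewrite qpochsS !big_cons big_nil; ring.
have K0 : q%:C ^+ k != 0 :> C by rewrite expf_neq0.
rewrite (qracah_step q0 z0 K0 a0 b0 c0 d0 h0' hm' hp' f0 (up k) (dn k)) exprS.
move: a0 b0 c0 d0; rewrite /a /b /c /d; case: l => a' b' c' d' /= a0 b0 c0 d0.
congr (_ + _ * _); move: (q%:C ^+ k) K0 => K K0.
by field; rewrite q0 K0 a0 b0 c0 d0.
Qed.

Let hyp_coef_step n k : hyp_regular fam n l -> (k < n)%N ->
  hyp_coef fam n l k.+1 * lower k.+1 = hyp_coef fam n l k * (eigenval n - eigenval k).
Proof.
move=> hreg kn; have := hreg k kn; rewrite /hyp_coef /lower /eigenval /energy.
case: fam l_neq0 => [_|q hq [a0 b0 c0 d0]].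
  rewrite -/a -/b -/c => -[ak bk ck _].
  have k1 : (k.+1%:R : C) != 0 by rewrite pnatr_eq0.
  rewrite !pochsS !big_cons !big_nil factS natrM !invfM.
  move: (dtilde _ _) (pochs _ k) (pochs _ k)^-1 (k`!%:R^-1) => dt p1 p2 p3.
  move: k1; rewrite -natr1 => k1.
  rewrite (_ : a + (k%:R + 1) - 1 = a + k%:R); last by ring.
  rewrite (_ : b + (k%:R + 1) - 1 = b + k%:R); last by ring.
  rewrite (_ : c + (k%:R + 1) - 1 = c + k%:R); last by ring.
  by field; rewrite ak bk ck k1.
rewrite -/a -/b -/c => -[ak bk ck _].
have q0 : q%:C != 0 :> C := qC_neq0 hq.
have dt0 : dtilde (qRacah hq) l != 0.
  move: a0 b0 c0 d0; case: (l) => a' b' c' d' /= a0 b0 c0 d0.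
  by rewrite !mulf_neq0 ?invr_eq0.
have q1 : 1 - q%:C * q%:C ^+ k != 0 :> C.
  rewrite -exprS subr_eq0; apply/eqP => E.
  by have := @qC_expfz_inj _ _ hq 0%:Z k.+1%:Z E.
rewrite !qpochsS !big_cons !big_nil !invfM.
move: (dtilde _ _) dt0 (qpochs _ _ k) (qpochs _ [:: q%:C] k)^-1 (qpochs _ _ k)^-1 => dt dt0 p1 p2 p3.
rewrite exprS; have := expf_neq0 k q0; have := expf_neq0 n q0.
move: (q%:C ^+ k) (q%:C ^+ n) ak bk ck q1 => K Nq ak bk ck q1 n0 k0.
by field; rewrite ?q0 ?k0 ?n0 ?dt0 ?ak ?bk ?ck ?q1.
Qed.

Lemma racah_op_checkP0 n x : hyp_regular fam n l ->
  asym L 0 x != 0 -> asym L (-1) x != 0 -> asym L (-1) (x + 1) != 0 ->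
  racah_op (fun y => checkP0 fam n y l) x = eigenval n * checkP0 fam n x l.
Proof.
move=> hreg h0 hm hp.
have -> : racah_op (fun y => checkP0 fam n y l) x
  = \sum_(k < n.+1) hyp_coef fam n l k * racah_op (newton_basis fam l k) x.
  rewrite /racah_op !checkP0E -!sumrB !mulr_sumr -big_split.
  by apply: eq_bigr => k _ /=; ring.
under eq_bigr do rewrite racah_op_basis // mulrDr.
rewrite big_split /= [X in _ + X]big_ord_recl [X in _ + (X + _)](_ : _ = 0) ?add0r; last first.
  rewrite /lower; case: (fam) => [|q hq]; first by rewrite !mul0r mulr0.
  by rewrite expr0 subrr !mulr0 mul0r mulr0.
rewrite big_ord_recr /= checkP0E mulr_sumr [RHS]big_ord_recr /=.
rewrite addrAC -big_split /=; congr (_ + _); last by ring.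
apply: eq_bigr => k _ /=.
rewrite /bump /= add1n [_ * (lower _ * _)]mulrA hyp_coef_step //.
by rewrite add0n; ring.
Qed.

End Eigen.

End Weights.

(* Summation by parts: the right-hand side is symmetric in [f] and [h]. *)
Lemma racah_op_sym (R : realType) (fam : racah_case R) (l : params R[i]) (N : nat)
    (nu rho : weight (lattice_of fam (pd l))) (f h : R[i] -> R[i]) :
  let L := lattice_of fam (pd l) in
  (forall x : nat, asym L 0 x%:R != 0) -> (forall x : int, asym L (-1) x%:~R != 0) ->
  (forall x : nat, wup nu x = up_val fam (pd l) (pa l) (pb l) x%:R) ->
  (forall x : nat, wdn nu x = dn_val fam (pd l) (pa l) (pb l) x%:R) ->
  (forall x : nat, wup rho x = up_val fam (pd l) (pc l) (pd l) x%:R) ->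
  (forall x : nat, wdn rho x = dn_val fam (pd l) (pc l) (pd l) x%:R) ->
  wup nu N = 0 -> wdn rho 0 = 0 ->
  \sum_(x < N.+1) asym L 0 x%:R * wnu nu x * wnu rho x * racah_op fam l f x%:R * h x%:R
  = \sum_(x < N.+1) wnu nu x * wup nu x * wnu rho x * wup rho x / asym L (-1) x.+1%:R
     * (f x%:R - f x.+1%:R) * (h x%:R - h x.+1%:R).
Proof.
move=> L a0 am hu1 hd1 hu2 hd2 uN d0.
pose B (x : nat) := wnu nu x * wup nu x * wnu rho x * wup rho x / asym L (-1) x.+1%:R.
have am' (x : nat) : asym L (-1) x%:R != 0 by exact: (am x).
have hup (x : nat) : asym L 0 x%:R * wnu nu x * wnu rho x * step_up fam l x%:R = B x.
  rewrite /step_up /B hu1 hu2 natr1; have := a0 x; have := am' x.+1.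
  by rewrite -/L; move: (asym L 0 _) (asym L (-1) _) => s t t0 s0; field; rewrite s0 t0.
have hdn (x : nat) : asym L 0 x.+1%:R * wnu nu x.+1 * wnu rho x.+1 * step_dn fam l x.+1%:R = B x.
  rewrite /B -[_ * wnu rho x * _]mulrA (wnuS nu) (wnuS rho) /step_dn hd1 hd2.
  have := a0 x.+1; have := am' x.+1.
  by rewrite -/L; move: (asym L 0 _) (asym L (-1) _) => s t t0 s0; field; rewrite s0 t0.
have BN : B N = 0 by rewrite /B uN mulr0 !mul0r.
transitivity (\sum_(x < N.+1) B x * (f x%:R - f x.+1%:R) * h x%:R
    + \sum_(x < N.+1) asym L 0 x%:R * wnu nu x * wnu rho x * step_dn fam l x%:R
        * (f x%:R - f (x%:R - 1)) * h x%:R).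
  rewrite -big_split; apply: eq_bigr => x _ /=.
  by rewrite /racah_op -hup -natr1; ring.
rewrite [X in _ + X]big_ord_recl [X in _ + (X + _)](_ : _ = 0) ?add0r; last first.
  by rewrite /step_dn -hd2 d0 mulr0 !mul0r mulr0 !mul0r.
rewrite [X in _ + X](_ : _ = \sum_(x < N.+1) B x * (f x.+1%:R - f x%:R) * h x.+1%:R); last first.
  rewrite big_ord_recr /= BN !mul0r addr0; apply: eq_bigr => x _.
  by rewrite /bump /= add1n hdn -natr1 addrK.
by rewrite -big_split; apply: eq_bigr => x _ /=; rewrite -/(B x); ring.
Qed.

(** * Generic parameters *)

Section Regular.

Variables (R : realType) (fam : racah_case R) (N : nat).
Local Notation C := R[i].

(** With [a] fixed by N, the quantities built from a, such as d - a, [dtilde] and its twist, differ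
    from these expressions by an integer, or by a power of q. One countable list thus covers node
    differences, denominators, weights, energies and normalization constants. *)
Definition regular (b c d : C) : Prop :=
  match fam with
  | Racah => forall k : int, [/\ b + k%:~R != 0, c + k%:~R != 0 & d + k%:~R != 0] /\
      [/\ d - b + k%:~R != 0, d - c + k%:~R != 0, b + c - d + k%:~R != 0 &
        c + d - b + k%:~R != 0]
  | qRacah q _ => [/\ b != 0, c != 0 & d != 0] /\ forall k : int,
      [/\ b != q%:C ^ k, c != q%:C ^ k & d != q%:C ^ k] /\
      [/\ d != b * q%:C ^ k, d != c * q%:C ^ k, b * c != d * q%:C ^ k &
        c * d != b * q%:C ^ k]
  end.

Variables (b c d : C).
Hypothesis reg : regular b c d.

Let a := aN fam N.
Let l := Params a b c d.
Let L := lattice_of fam d.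

Lemma regular_lev_inj (r : int) : injective (fun x : int => lev L r x%:~R).
Proof.
move=> x y /eqP; rewrite /L -subr_eq0; move: reg; rewrite /regular; case: fam => [|q hq].
  move=> h /=; rewrite (_ : _ - _ = (x - y)%:~R * (d + (r + x + y)%:~R)); last first.
    by rewrite !rmorphD rmorphN /=; ring.
  rewrite mulf_eq0 => /orP[|/eqP E]; first by rewrite intr_eq0 subr_eq0 => /eqP.
  by have [[_ _ /eqP]] := h (r + x + y).
move=> [_ h] /=; have q0 : q%:C != 0 :> C := qC_neq0 hq.
have qz k : q%:C ^ k != 0 :> C by rewrite expfz_neq0.
rewrite !qpowN !qpow_int //.
rewrite (_ : _ - _ = ((q%:C ^ y) - (q%:C ^ x)) * (1 - d * q%:C ^ (r + x + y)) / (q%:C ^ x * q%:C ^ y)); last first.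
  by rewrite !expfzDr //; field; rewrite !qz.
rewrite !mulf_eq0 invr_eq0 mulf_eq0 !(negPf (qz _)) !orbF => /orP[|]; rewrite subr_eq0.
  by move/eqP/(qC_expfz_inj hq).
move=> /eqP E; have [[_ _ /eqP dq] _] := h (- (r + x + y)); case: dq.
by rewrite -invr_expz -[RHS]mul1r E mulfK // qz.
Qed.

Lemma regular_asym_neq0 (m x : int) : asym L m x%:~R != 0.
Proof.
move: reg; rewrite /L /regular; case: fam => [|q hq].
  move=> h /=; have [[_ _ +] _] := h (m + x + x).
  by rewrite !rmorphD /=; congr (_ != 0); ring.
move=> [_ h] /=; have q0 : q%:C != 0 :> C := qC_neq0 hq.
have qz k : q%:C ^ k != 0 :> C by rewrite expfz_neq0.
rewrite !qpowN !qpow_int // subr_eq0; have [[_ _ /eqP dq] _] := h (- (m + x + x)).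
apply/eqP => E; apply: dq; rewrite -invr_expz !expfzDr //.
transitivity (d * q%:C ^ m * q%:C ^ x / (q%:C ^ m * q%:C ^ x)); first by field; rewrite !qz.
by rewrite -E; field; rewrite !qz.
Qed.

Let nat_int (n : nat) : n%:R = (n%:Z)%:~R :> C. Proof. by []. Qed.

Lemma regular_good_ab : good_pair fam d a b.
Proof.
move: reg; rewrite /good_pair /a /aN /regular; case: fam => [|q hq].
  move=> h n; split; last rewrite mulf_neq0 //.
  - have [_ [+ _ _ _]] := h (N%:Z - n%:Z); rewrite -oppr_eq0; congr (_ != 0).
    by rewrite !nat_int rmorphB /=; ring.
  - have [[_ _ +] _] := h (n.+1%:Z + N%:Z); congr (_ != 0).
    by rewrite !nat_int rmorphD /=; ring.
  - have [_ [+ _ _ _]] := h n.+1; congr (_ != 0).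
    by rewrite !nat_int /=; ring.
move=> [[b0 c0 d0] h]; have q0 : q%:C != 0 :> C := qC_neq0 hq.
have qz k : q%:C ^ k != 0 :> C by rewrite expfz_neq0.
split=> // [|n]; first by rewrite invr_eq0 expf_neq0.
have qN0 : q%:C ^+ N != 0 :> C by rewrite expf_neq0.
split.
  have [_ [+ _ _ _]] := h (n%:Z - N%:Z); congr (_ != _).
  by rewrite expfzDr // -invr_expz -!exprnP; ring.
rewrite /dn_val !qpow_nat // !mulf_neq0 ?invr_eq0 ?expf_neq0 // subr_eq0.
  have [[_ _ +] _] := h (- (n.+1%:Z + N%:Z)); apply: contra => /eqP E.
  rewrite -invr_expz expfzDr // -!exprnP; apply/eqP.
  transitivity (d / q%:C ^- N * q%:C ^+ n.+1 / (q%:C ^+ n.+1 * q%:C ^+ N)).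
    by field; rewrite qN0 expf_neq0.
  by rewrite -E; field; rewrite qN0 expf_neq0.
have [_ [+ _ _ _]] := h (- n.+1%:Z); apply: contra => /eqP E.
rewrite -invr_expz -!exprnP; apply/eqP.
transitivity (b * (d / b * q%:C ^+ n.+1) / q%:C ^+ n.+1).
  by field; rewrite b0 expf_neq0.
by rewrite -E mulr1.
Qed.

Lemma regular_good_cd : good_pair fam d c d.
Proof.
move: reg; rewrite /good_pair /regular; case: fam => [|q hq].
  move=> h n; split; last rewrite mulf_neq0 //.
  - by have [[_ + _] _] := h n%:Z; congr (_ != 0); rewrite !nat_int /=; ring.
  - by have [_ [_ + _ _]] := h n.+1; congr (_ != 0); rewrite !nat_int /=; ring.
  - by rewrite addrK pnatr_eq0.
move=> [[b0 c0 d0] h]; have q0 : q%:C != 0 :> C := qC_neq0 hq.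
split=> // n; split.
  have [[_ + _] _] := h (- n%:Z); apply: contra => /eqP E; apply/eqP.
  rewrite -invr_expz -exprnP; apply: (mulIf d0); apply: (mulIf (expf_neq0 n q0)).
  by rewrite -E; field; rewrite expf_neq0.
rewrite /dn_val !qpow_nat // !mulf_neq0 ?invr_eq0 ?expf_neq0 // subr_eq0.
  have [_ [_ + _ _]] := h (- n.+1%:Z); apply: contra => /eqP E.
  rewrite -invr_expz -!exprnP; apply/eqP.
  transitivity (c * (d / c * q%:C ^+ n.+1) / q%:C ^+ n.+1).
    by field; rewrite c0 expf_neq0.
  by rewrite -E mulr1.
rewrite divff // mul1r; apply/eqP => E.
by have := @qC_expfz_inj _ _ hq 0%:Z n.+1%:Z E.
Qed.

Lemma regular_hyp n : (n <= N)%N -> hyp_regular fam n l.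
Proof.
move=> nN i lt_in; move: reg; rewrite /hyp_regular /l /a /aN /regular; case: fam => [|q hq].
  move=> h; split=> /=.
  - by rewrite addrC subr_eq0 eqr_nat neq_ltn (leq_trans lt_in).
  - by have [[]] := h i.
  - by have [[]] := h i.
  - have [_ [_ _ + _]] := h (n%:Z - N%:Z - 1 + i%:Z); congr (_ != 0).
    by rewrite !nat_int !rmorphD !rmorphN /=; ring.
move=> [[b0 c0 d0] h]; have q0 : q%:C != 0 :> C := qC_neq0 hq.
have qn k : q%:C ^+ k != 0 :> C by rewrite expf_neq0.
split=> /=.
- rewrite subr_eq0; apply/eqP => E.
  have E' : q%:C ^+ N = q%:C ^+ i :> C by rewrite -[LHS]mulr1 E mulrA mulfV // mul1r.
  by have [E''] := @qC_expfz_inj _ _ hq N%:Z i%:Z E'; rewrite -E'' ltnNge nN in lt_in.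
- have [[+ _ _] _] := h (- i%:Z); rewrite subr_eq0; apply: contra => /eqP E.
  by rewrite -invr_expz -!exprnP -[X in _ == X]mul1r E mulfK.
- have [[_ + _] _] := h (- i%:Z); rewrite subr_eq0; apply: contra => /eqP E.
  by rewrite -invr_expz -!exprnP -[X in _ == X]mul1r E mulfK.
- have [_ [_ _ + _]] := h (N%:Z + 1 - n%:Z - i%:Z); rewrite subr_eq0; apply: contra => /eqP E.
  rewrite !expfzDr // -!invr_expz expr1z -!exprnP; apply/eqP.
  transitivity (q%:C ^- N * b * c / d / q%:C * q%:C ^+ n * q%:C ^+ i
     * d * q%:C ^+ N * q%:C / (q%:C ^+ n * q%:C ^+ i)); first by field; rewrite !qn d0 q0.
  by rewrite -E; field; rewrite !qn.
Qed.

Lemma regular_hyp_twist v : hyp_regular fam v (twist fam l).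
Proof.
move=> i lt_iv; move: reg; rewrite /hyp_regular /l /a /aN /regular; case: fam => [|q hq].
  move=> h; split=> /=.
  - have [[_ _ +] _] := h (N%:Z + 1 + i%:Z); congr (_ != 0).
    by rewrite !nat_int !rmorphD /=; ring.
  - have [_ [+ _ _ _]] := h (1 + i%:Z); congr (_ != 0).
    by rewrite !nat_int !rmorphD /=; ring.
  - by have [[]] := h i.
  - have [_ [_ _ _ +]] := h (v%:Z + N%:Z + 1 + i%:Z); congr (_ != 0).
    by rewrite !nat_int !rmorphD /=; ring.
move=> [[b0 c0 d0] h]; have q0 : q%:C != 0 :> C := qC_neq0 hq.
have qn k : q%:C ^+ k != 0 :> C by rewrite expf_neq0.
split=> /=.
- have [[_ _ +] _] := h (- (N%:Z + 1 + i%:Z)); rewrite subr_eq0; apply: contra => /eqP E.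
  rewrite -!invr_expz !expfzDr // expr1z -!exprnP; apply/eqP.
  transitivity (d * q%:C / q%:C ^- N * q%:C ^+ i / (q%:C ^+ N * q%:C * q%:C ^+ i)).
    by field; rewrite !qn q0.
  by rewrite -E; field; rewrite !qn q0.
- have [_ [+ _ _ _]] := h (- (1 + i%:Z)); rewrite subr_eq0; apply: contra => /eqP E.
  rewrite -!invr_expz !expfzDr // expr1z -!exprnP; apply/eqP.
  transitivity (d * q%:C / b * q%:C ^+ i * b / (q%:C * q%:C ^+ i)).
    by field; rewrite !qn q0 b0.
  by rewrite -E; field; rewrite !qn q0.
- have [[_ + _] _] := h (- i%:Z); rewrite subr_eq0; apply: contra => /eqP E.
  by rewrite -invr_expz -!exprnP -[X in _ == X]mul1r E mulfK.
- have [_ [_ _ _ +]] := h (- (N%:Z + 1 + v%:Z + i%:Z)); rewrite subr_eq0; apply: contra => /eqP E.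
  rewrite -!invr_expz !expfzDr // expr1z -!exprnP; apply/eqP.
  transitivity (d * q%:C / q%:C ^- N * (d * q%:C / b) * c / d / q%:C * q%:C ^+ v * q%:C ^+ i
     * b / (q%:C ^+ N * q%:C * q%:C ^+ v * q%:C ^+ i)); first by field; rewrite !qn d0 b0 q0.
  by rewrite -E; field; rewrite !qn q0.
Qed.

Lemma regular_l_neq0 : if fam is qRacah _ _ then
  [/\ pa l != 0, pb l != 0, pc l != 0 & pd l != 0] else True.
Proof.
move: reg; rewrite /l /a /aN /regular; case: fam => [//|q hq] [[b0 c0 d0] _].
by split; rewrite //= invr_eq0 expf_neq0 // (qC_neq0 hq).
Qed.

Lemma regular_up_ab_max : up_val fam d a b N%:R = 0.
Proof.
rewrite /up_val /a /aN; case: fam => [|q hq]; first by rewrite subrr mul0r.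
by rewrite qpow_nat // mulVf ?expf_neq0 ?(qC_neq0 hq) // subrr !mul0r.
Qed.

Lemma regular_dn_cd0 : dn_val fam d c d 0 = 0.
Proof.
move: reg; rewrite /dn_val /regular; case: fam => [|q hq]; first by rewrite add0r subrr mulr0.
by move=> [[_ _ d0] _]; rewrite qpow0 divff // mul1r subrr mulr0 mul0r.
Qed.

Lemma regular_nu_neq0 x : (x <= N)%N -> pair_nu fam d a b x != 0.
Proof.
move=> xN; rewrite prodf_seq_neq0; apply/allP => i _ /=.
rewrite mulf_neq0 ?invr_eq0 ?(dn_val_neq0 i regular_good_ab) //.
have iN : (i < N)%N by apply: leq_trans xN.
move: reg; rewrite /up_val /a /aN /regular; case: fam => [|q hq].
  move=> h; rewrite mulf_neq0 //; first by rewrite subr_eq0 eqr_nat neq_ltn iN.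
  by rewrite addrC; have [[]] := h i.
move=> [[b0 c0 d0] h]; have q0 : q%:C != 0 :> C := qC_neq0 hq.
have qn k : q%:C ^+ k != 0 :> C by rewrite expf_neq0.
rewrite qpow_nat // !mulf_neq0 ?invr_eq0 ?mulf_neq0 ?invr_eq0 // subr_eq0.
  apply/eqP => E.
  have E' : q%:C ^+ N = q%:C ^+ i :> C by rewrite -[LHS]mulr1 E mulrA mulfV // mul1r.
  by have [E''] := @qC_expfz_inj _ _ hq N%:Z i%:Z E'; rewrite -E'' ltnn in iN.
have [[+ _ _] _] := h (- i%:Z); apply: contra => /eqP E.
by rewrite -invr_expz -!exprnP -[X in _ == X]mul1r E mulfK.
Qed.

Lemma regular_nu_eq0 x : (N < x)%N -> pair_nu fam d a b x = 0.
Proof.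
move=> Nx; rewrite /pair_nu (bigD1 (Ordinal Nx)) //= regular_up_ab_max.
by rewrite !mul0r.
Qed.

Lemma regular_rho_neq0 x : pair_nu fam d c d x != 0.
Proof.
rewrite prodf_seq_neq0; apply/allP => i _ /=.
rewrite mulf_neq0 ?invr_eq0 ?(dn_val_neq0 i regular_good_cd) //.
move: reg; rewrite /up_val /regular; case: fam => [|q hq].
  by move=> h; rewrite mulf_neq0 // addrC; have [[]] := h i.
move=> [[b0 c0 d0] h]; have q0 : q%:C != 0 :> C := qC_neq0 hq.
have qn k : q%:C ^+ k != 0 :> C by rewrite expf_neq0.
rewrite qpow_nat // !mulf_neq0 ?invr_eq0 ?mulf_neq0 // subr_eq0.
  have [[_ + _] _] := h (- i%:Z); apply: contra => /eqP E.
  by rewrite -invr_expz -!exprnP -[X in _ == X]mul1r E mulfK.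
have [[_ _ +] _] := h (- i%:Z); apply: contra => /eqP E.
by rewrite -invr_expz -!exprnP -[X in _ == X]mul1r E mulfK.
Qed.

Lemma regular_eigenval n m : (n <= N)%N -> (m <= N)%N -> n != m ->
  eigenval fam l n != eigenval fam l m.
Proof.
move=> _ _ nm; rewrite -subr_eq0; move: reg; rewrite /eigenval /energy /l /a /aN /regular.
case: fam => [|q hq].
  move=> h /=; rewrite [X in X != 0](_ : _ = (m%:R - n%:R) *
      (b + c - d + (n%:Z + m%:Z - N%:Z - 1)%:~R)); last first.
    by rewrite !nat_int !rmorphD !rmorphN /=; ring.
  apply: mulf_neq0; first by rewrite subr_eq0 eqr_nat eq_sym.
  by have [_ []] := h (n%:Z + m%:Z - N%:Z - 1).
move=> [[b0 c0 d0] h] /=; have q0 : q%:C != 0 :> C := qC_neq0 hq.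
have qn k : q%:C ^+ k != 0 :> C by rewrite expf_neq0.
have := h (N%:Z + 1 - n%:Z - m%:Z) => -[_ [_ _ + _]].
rewrite !expfzDr // -!invr_expz expr1z -!exprnP => ne.
rewrite [X in X != 0](_ : _ = (q%:C ^+ n - q%:C ^+ m) * (d * (q%:C ^+ N * q%:C / q%:C ^+ n / q%:C ^+ m) - b * c) / (b * c)); last first.
  by field; rewrite !qn ?q0 ?b0 ?c0 ?d0.
rewrite !mulf_neq0 ?invr_eq0 ?mulf_neq0 // subr_eq0; last by rewrite eq_sym.
by apply: contra nm => /eqP E; have [->] := @qC_expfz_inj _ _ hq n%:Z m%:Z E.
Qed.

Lemma regular_orth n m : (n <= N)%N -> (m <= N)%N -> n != m ->
  pairing N (fun x => asym L 0 x%:~R * pair_nu fam d a b x * pair_nu fam d c d x)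
    (fun x => (hyp_poly fam n l).[node L x]) (fun x => (hyp_poly fam m l).[node L x]) = 0.
Proof.
move=> nN mN nm.
pose f k (y : C) := checkP0 fam k y l.
pose w (x : nat) := asym L 0 x%:~R * pair_nu fam d a b x * pair_nu fam d c d x.
have pE k (x : nat) : (hyp_poly fam k l).[node L x] = f k x%:R.
  by rewrite /f hyp_polyE etax_lev0.
have opE k x : (k <= N)%N -> (x <= N)%N -> racah_op fam l (f k) x%:R = eigenval fam l k * f k x%:R.
  move=> kN xN; apply: racah_op_checkP0; first exact: regular_l_neq0.
  - exact: regular_hyp.
  - exact: (regular_asym_neq0 0 x).
  - exact: (regular_asym_neq0 (-1) x).
  - by rewrite natr1; apply: (regular_asym_neq0 (-1) x.+1).
have sym k k' := @racah_op_sym R fam l N (pair_weight regular_good_ab)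
   (pair_weight regular_good_cd) (f k) (f k') (fun x : nat => regular_asym_neq0 0 x)
   (fun x => regular_asym_neq0 (-1) x) (fun x => pair_weight_up _ x)
   (fun x => pair_weight_dn _ x) (fun x => pair_weight_up _ x) (fun x => pair_weight_dn _ x)
   (etrans (pair_weight_up _ N) regular_up_ab_max) (etrans (pair_weight_dn _ 0) regular_dn_cd0).
have E k k' : (k <= N)%N -> \sum_(x < N.+1) w x * racah_op fam l (f k) x%:R * f k' x%:R
   = eigenval fam l k * pairing N w (fun x => f k x%:R) (fun x => f k' x%:R).
  move=> kN; rewrite /pairing mulr_sumr; apply: eq_bigr => x _.
  by rewrite opE ?leq_ord //; ring.
have pC : pairing N w (fun x => f m x%:R) (fun x => f n x%:R)
   = pairing N w (fun x => f n x%:R) (fun x => f m x%:R).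
  by apply: eq_bigr => x _; ring.
have -> : pairing N w (fun x => (hyp_poly fam n l).[node L x]) (fun x => (hyp_poly fam m l).[node L x])
   = pairing N w (fun x => f n x%:R) (fun x => f m x%:R).
  by apply: eq_bigr => x _; rewrite !pE.
have : eigenval fam l n * pairing N w (fun x => f n x%:R) (fun x => f m x%:R)
   = eigenval fam l m * pairing N w (fun x => f n x%:R) (fun x => f m x%:R).
  rewrite -{2}pC -!E // -[LHS]/(\sum_(x < N.+1) _) (sym n m) (sym m n).
  by apply: eq_bigr => x _; rewrite -!mulrA; congr (_ * _); ring.
move/eqP; rewrite -subr_eq0 -mulrBl mulf_eq0 subr_eq0.
by rewrite (negPf (regular_eigenval nN mN nm)) => /eqP.
Qed.

End Regular.

Lemma poly_eq_nat (F : numFieldType) (p q : {poly F}) (t : nat -> F) :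
  injective t -> (forall n, p.[t n] = q.[t n]) -> p = q.
Proof.
move=> ti pq; apply/eqP; rewrite -subr_eq0; apply/eqP.
apply: (@roots_geq_poly_eq0 _ _ [seq t n | n <- iota 0 (size (p - q))]).
- by apply/allP => z /mapP[n _ ->]; rewrite rootE hornerD hornerN pq subrr.
- by rewrite map_inj_uniq ?iota_uniq.
- by rewrite size_map size_iota.
Qed.

(** * Nonvanishing of the normalization constants *)

Section Constants.

Variables (R : realType) (fam : racah_case R) (N : nat).
Local Notation C := R[i].
Variables (b c d : C).
Hypothesis reg : regular fam b c d.

Let a := aN fam N.
Let l := Params a b c d.
Let L := lattice_of fam d.

Let nodeE (x : int) : etax fam x%:~R l = node L x.
Proof. exact: etax_lev0. Qed.

Let node_inj : injective (node L).
Proof. exact: (regular_lev_inj reg (r := 0)). Qed.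

Let node0 : node L 0 = 0.
Proof.
by rewrite /node /L; case: fam => [|q hq] /=; rewrite ?mul0r // oppr0 qpow0 subrr mul0r.
Qed.

Definition varphi_scale (m : nat) : C :=
  \prod_(k < m) \prod_(j < m | (j < k)%N) etax fam (k - j)%N%:R l.

Lemma varphi_scale_neq0 m : varphi_scale m != 0.
Proof.
rewrite prodf_seq_neq0; apply/allP => k _ /=.
rewrite prodf_seq_neq0; apply/allP => j _ /=; apply/implyP => jk.
have -> : etax fam (k - j)%N%:R l = node L (k - j)%N%:Z by rewrite -nodeE.
by rewrite -node0 inj_eq //; apply/eqP; lia.
Qed.

Lemma varphi_vdm m x :
  varphi fam m x l = vdm (fun j : 'I_m => lev L 0 (x + j%:R)) / varphi_scale m.
Proof.
rewrite /varphi /vdm /varphi_scale -prodf_div; apply: eq_bigr => k _.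
by rewrite -prodf_div; apply: eq_bigr => j _; rewrite !etax_lev0.
Qed.

Lemma vdm_node_neq0 m (x : int) : vdm (fun j : 'I_m => lev L 0 (x%:~R + j%:R)) != 0.
Proof.
rewrite prodf_seq_neq0; apply/allP => k _ /=.
rewrite prodf_seq_neq0; apply/allP => j _ /=; apply/implyP => jk.
have E (i : 'I_m) : lev L 0 (x%:~R + i%:R) = node L (x + i%:Z) by rewrite /node rmorphD.
by rewrite !E subr_eq0 inj_eq //; apply/eqP; lia.
Qed.

Lemma varphi_neq0 m (x : int) : varphi fam m x%:~R l != 0.
Proof. by rewrite varphi_vdm mulf_neq0 ?invr_eq0 ?varphi_scale_neq0 ?vdm_node_neq0. Qed.

Let alpha_neq0 : alpha fam l != 0.
Proof.
move: reg; rewrite /l /a /aN /regular /alpha; case: fam => [|q hq]; first by rewrite oner_neq0.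
by move=> [[b0 c0 d0] _]; rewrite !mulf_neq0 ?invr_eq0 ?expf_neq0 // (qC_neq0 hq).
Qed.

Let Bprime_neq0 (j : nat) : Bprime fam j%:R l != 0.
Proof.
have int_nat (k : nat) : k%:R = (k%:Z)%:~R :> C by [].
move: reg; rewrite /l /a /aN /regular /Bprime; case: fam => [|q hq].
  move=> h; rewrite oppr_eq0 !mulf_neq0 ?invr_eq0 ?mulf_neq0 //.
  - have [[_ _ +] _] := h (j%:Z + N%:Z + 1); congr (_ != 0).
    by rewrite !int_nat !rmorphD /=; ring.
  - have [_ [+ _ _ _]] := h (j%:Z + 1); congr (_ != 0).
    by rewrite !int_nat !rmorphD /=; ring.
  - by have [[_ + _] _] := h j%:Z; rewrite addrC.
  - by have [[_ _ +] _] := h j%:Z; rewrite addrC.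
  - have [[_ _ +] _] := h (j%:Z + j%:Z); congr (_ != 0).
    by rewrite !int_nat !rmorphD /=; ring.
  - have [[_ _ +] _] := h (j%:Z + j%:Z + 1); congr (_ != 0).
    by rewrite !int_nat !rmorphD /=; ring.
move=> [[b0 c0 d0] h]; have q0 : q%:C != 0 :> C := qC_neq0 hq.
have qn k : q%:C ^+ k != 0 :> C by rewrite expf_neq0.
rewrite !natr1 -!natrM !qpow_nat // oppr_eq0.
have dq n : 1 - d * q%:C ^+ n != 0.
  have [[_ _ +] _] := h (- n%:Z); rewrite subr_eq0; apply: contra => /eqP E.
  by rewrite -invr_expz -!exprnP -[X in _ == X]mul1r E mulfK.
rewrite !mulf_neq0 ?invr_eq0 ?mulf_neq0 //.
- by rewrite invrK [_ * d]mulrC -mulrA -exprD dq.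
- have [_ [+ _ _ _]] := h (- j.+1%:Z); rewrite subr_eq0; apply: contra => /eqP E.
  rewrite -!invr_expz -!exprnP; apply/eqP.
  transitivity (b^-1 * d * q%:C ^+ j.+1 * b / q%:C ^+ j.+1); first by field; rewrite !qn b0.
  by rewrite -E; field; rewrite !qn.
- have [[_ + _] _] := h (- j%:Z); rewrite subr_eq0; apply: contra => /eqP E.
  by rewrite -invr_expz -!exprnP -[X in _ == X]mul1r E mulfK.
- by rewrite natr1 qpow_nat ?dq.
Qed.

Section Indices.

Variables (M : nat) (D : M.-tuple nat).
Hypothesis D_inj : injective (tnth D).

Let venergy_neq (v w : nat) : v != w -> venergy fam v l - venergy fam w l != 0.
Proof.
have int_nat (k : nat) : k%:R = (k%:Z)%:~R :> C by [].
move=> vw; move: reg; rewrite /l /a /aN /regular /venergy; case: fam => [|q hq].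
  move=> h /=; rewrite [X in X != 0](_ : _ = (v%:R - w%:R) * (c + d - b + (v%:Z + w%:Z + N%:Z + 1)%:~R)); last first.
    by rewrite !int_nat !rmorphD /=; ring.
  apply: mulf_neq0; first by rewrite subr_eq0 eqr_nat.
  by have [_ []] := h (v%:Z + w%:Z + N%:Z + 1).
move=> [[b0 c0 d0] h] /=; have q0 : q%:C != 0 :> C := qC_neq0 hq.
have qn k : q%:C ^+ k != 0 :> C by rewrite expf_neq0.
have := h (- (v%:Z + w%:Z + N%:Z + 1)) => -[_ [_ _ _ +]].
rewrite -!invr_expz !expfzDr // expr1z -!exprnP => ne.
rewrite [X in X != 0](_ : _ = (q%:C ^+ v - q%:C ^+ w) * (c * d - b * (q%:C ^+ v * q%:C ^+ w * q%:C ^+ N * q%:C)^-1) / d); last first.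
  by field; rewrite !qn ?q0 ?b0 ?c0 ?d0.
rewrite !mulf_neq0 ?invr_eq0 // subr_eq0 //.
by apply: contra vw => /eqP E; have [->] := @qC_expfz_inj _ _ hq v%:Z w%:Z E.
Qed.

Let energy_venergy_neq (n v : nat) : energy fam n l - venergy fam v l != 0.
Proof.
have int_nat (k : nat) : k%:R = (k%:Z)%:~R :> C by [].
move: reg; rewrite /l /a /aN /regular /energy /venergy; case: fam => [|q hq].
  move=> h /=; rewrite [X in X != 0](_ : _ = - (c + (n%:Z + v%:Z)%:~R) * (d - b + (N%:Z + v%:Z + 1 - n%:Z)%:~R)); last first.
    by rewrite !int_nat !rmorphD !rmorphN /=; ring.
  rewrite mulNr oppr_eq0; apply: mulf_neq0; first by have [[]] := h (n%:Z + v%:Z).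
  by have [_ []] := h (N%:Z + v%:Z + 1 - n%:Z).
move=> [[b0 c0 d0] h] /=; have q0 : q%:C != 0 :> C := qC_neq0 hq.
have qn k : q%:C ^+ k != 0 :> C by rewrite expf_neq0.
have [[_ ne1 _] _] := h (- (n%:Z + v%:Z)).
rewrite -!invr_expz !expfzDr // -!exprnP in ne1.
have [_ [ne2 _ _ _]] := h (n%:Z - (N%:Z + 1 + v%:Z)).
rewrite expfzDr // -!invr_expz !expfzDr // expr1z -!exprnP in ne2.
rewrite [X in X != 0](_ : _ = - ((c - (q%:C ^+ n * q%:C ^+ v)^-1) * q%:C ^+ v *
    (d - b * (q%:C ^+ n / (q%:C ^+ N * q%:C * q%:C ^+ v))) / d)); last first.
  by field; rewrite !qn ?q0 ?b0 ?c0 ?d0.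
by rewrite oppr_eq0 !mulf_neq0 ?invr_eq0 // subr_eq0.
Qed.

Lemma constXi_neq0 : constXi fam D l != 0.
Proof.
rewrite mulf_neq0 ?invr_eq0 ?(varphi_neq0 M 0) // prodf_seq_neq0; apply/allP => k _ /=.
rewrite prodf_seq_neq0; apply/allP => j _ /=; apply/implyP => jk.
apply: mulf_neq0; last by rewrite invr_eq0 (mulf_neq0 alpha_neq0 (Bprime_neq0 j)).
by apply: venergy_neq; rewrite inj_eq // -val_eqE /= ltn_eqF.
Qed.

Lemma constP_neq0 n : constP fam D n l != 0.
Proof.
rewrite /constP; apply: mulf_neq0.
  apply: mulf_neq0; last by rewrite mulf_neq0 ?invr_eq0 ?(varphi_neq0 _ 0).
  apply: mulf_neq0; last exact: constXi_neq0.
  by rewrite expf_neq0 // oppr_eq0 oner_neq0.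
rewrite prodf_seq_neq0; apply/allP => j _ /=.
by apply: mulf_neq0; [exact: energy_venergy_neq | rewrite invr_eq0 (mulf_neq0 alpha_neq0 (Bprime_neq0 j))].
Qed.

End Indices.

End Constants.

Lemma pochs2S (F : fieldType) (z w : F) n :
  pochs [:: z; w] n.+1 = pochs [:: z; w] n * ((z + n%:R) * (w + n%:R)).
Proof. by rewrite pochsS !big_cons big_nil mulr1. Qed.

Lemma pochs2Sl (F : fieldType) (z w : F) n :
  pochs [:: z; w] n.+1 = z * w * pochs [:: z + 1; w + 1] n.
Proof.
elim: n => [|n IHn]; first by rewrite pochs2S /pochs !big_cons !big_nil !big_ord0; ring.
by rewrite pochs2S IHn [in RHS]pochs2S -natr1; ring.
Qed.

Lemma qpochs2S (F : fieldType) (q z w : F) n :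
  qpochs q [:: z; w] n.+1 = qpochs q [:: z; w] n * ((1 - z * q ^+ n) * (1 - w * q ^+ n)).
Proof. by rewrite qpochsS !big_cons big_nil mulr1. Qed.

Lemma qpochs2Sl (F : fieldType) (q z w : F) n :
  qpochs q [:: z; w] n.+1 = (1 - z) * (1 - w) * qpochs q [:: z * q; w * q] n.
Proof.
elim: n => [|n IHn]; first by rewrite qpochs2S /qpochs !big_cons !big_nil !big_ord0; ring.
by rewrite qpochs2S IHn [in RHS]qpochs2S exprS; ring.
Qed.

(** * The denominator polynomial, the map I and the last column *)

Section Assembly.

Variables (R : realType) (fam : racah_case R) (N : nat).
Local Notation C := R[i].
Variables (b c d : C).
Hypothesis reg : regular fam b c d.

Let a := aN fam N.
Let l := Params a b c d.
Let L := lattice_of fam d.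

Let etax_twist x : etax fam x (twist fam l) = lev L 0 x.
Proof. by rewrite /L etax_lev0; case: fam. Qed.

Variables (r : nat) (D : r.+1.-tuple nat).
Hypothesis D_inj : injective (tnth D).

Definition xi_poly (k : 'I_r.+1) : {poly C} := hyp_poly fam (tnth D k) (twist fam l).

Let size_xi k : size (xi_poly k) = (tnth D k).+1.
Proof. exact/size_hyp_poly/regular_hyp_twist. Qed.

Let xiE k x : checkxi fam (tnth D k) x l = (xi_poly k).[lev L 0 x].
Proof. by rewrite /checkxi hyp_polyE etax_twist. Qed.

Let Wdet (y : C) := \det (\matrix_(j < r.+1, k < r.+1) (xi_poly k).[lev L 0 (y + j%:R)]).
Let Vdm (y : C) := vdm (fun j : 'I_r.+1 => lev L 0 (y + j%:R)).

(** The factor [e] combines the normalization constant with the ratio between the Vandermonde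
    product and [varphi]; the degree is exact by [window_alternant]. *)
Lemma XiD_spec : exists2 e : C, e != 0 &
  [/\ size (XiD fam D l) = (ell D).+1,
     (ell D + \sum_(j < r.+1) j = \sum_k tnth D k)%N &
     forall y, e * Wdet y = Vdm y * (XiD fam D l).[lev L r%:Z y]].
Proof.
have [p [dp tp Ep]] := window_alternant L xi_poly.
have degE k : (size (xi_poly k)).-1 = tnth D k by rewrite size_xi.
have {tp} tp : wtop (\sum_(j < r.+1) j) (\sum_k (size (xi_poly k)).-1) p != 0.
  apply: tp => [k|k1 k2]; first by rewrite -size_poly_eq0 size_xi.
  by rewrite !degE => /D_inj.
have sdeg : (\sum_k (size (xi_poly k)).-1 = \sum_k tnth D k)%N by apply: eq_bigr => k _; exact: degE.
rewrite sdeg in dp tp.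
have le_l : (\sum_(j < r.+1) j <= \sum_k tnth D k)%N.
  by move: tp; rewrite /wtop; case: ifP => // _; rewrite eqxx.
have ellE : (ell D + \sum_(j < r.+1) j = \sum_k tnth D k)%N.
  rewrite /ell (_ : (r.+1 * (r.+1 - 1)) %/ 2 = \sum_(j < r.+1) j)%N ?subnK //.
  by rewrite -(big_mkord xpredT id) bin2_sum bin2 divn2 subn1.
have sp : size p = (ell D).+1.
  have pE : p`_(ell D) != 0 by move: tp; rewrite /wtop le_l -ellE addnK.
  apply: size_exact => // i hi; apply: dp; rewrite -ellE; lia.
pose e := (constXi fam D l)^-1 * varphi_scale fam N b c d r.+1.
have e0 : e != 0.
  by rewrite mulf_neq0 ?invr_eq0 ?(constXi_neq0 N reg D_inj) // (varphi_scale_neq0 N reg).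
have Xset : forall x, varphi fam r.+1 x l != 0 ->
    (e *: p).[etax fam x (shift_params fam l (r.+1%:Z - 1))] = checkXiD fam D x l.
  move=> x vx; rewrite -[in LHS]lev_etax /= hornerZ /checkXiD.
  have -> : \det (\matrix_(j < r.+1, k < r.+1) checkxi fam (tnth D k) (x + j%:R) l) = Wdet x.
    by congr (\det _); apply/matrixP => j k; rewrite !mxE xiE.
  rewrite /Wdet Ep -/(Vdm x); move: vx; rewrite (varphi_vdm fam N) -/L -/(Vdm x) => vx.
  have V0 : Vdm x != 0 by apply: contraNneq vx => ->; rewrite mul0r.
  rewrite (_ : r.+1%:Z - 1 = r%:Z); last by lia.
  by rewrite /e; field; rewrite V0 (varphi_scale_neq0 N reg) (constXi_neq0 N reg D_inj).
(* The chosen polynomial is identified by its values: [varphi] does not vanish at integers, and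
   these give infinitely many distinct nodes. *)
have XE : XiD fam D l = e *: p.
  have hX : (forall x, varphi fam r.+1 x l != 0 ->
    (XiD fam D l).[etax fam x (shift_params fam l (r.+1%:Z - 1))] = checkXiD fam D x l).
    rewrite /XiD; case: xgetP => [q -> //|/(_ (e *: p))]; by case.
  apply: (@poly_eq_nat _ _ _ (fun n : nat => lev L r%:Z n%:R)).
    by move=> m n /(@regular_lev_inj _ _ _ _ _ reg r%:Z m%:Z n%:Z) [].
  move=> n; have vn := varphi_neq0 N reg r.+1 n.
  have := hX _ vn; rewrite -(Xset _ vn) -[in LHS]lev_etax -[in RHS]lev_etax /=.
  by rewrite (_ : r.+1%:Z - 1 = r%:Z) //; lia.
exists e => //; split=> //; first by rewrite XE size_scale.
by move=> y; rewrite /Wdet Ep XE hornerZ -/(Vdm y); ring.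
Qed.

(** [lev_difference_inv] exhibits a polynomial with the defining properties, so the chosen one has
    them. Where the divided difference is undefined, both sides of the cleared equation vanish. *)
Lemma Imap_spec (p : {poly C}) : p != 0 ->
  let X := Imap fam (shift_params fam l r.+1%:Z) p in
  size X = (size p).+1 /\ forall y,
    X.[lev L r.+1%:Z y] - X.[lev L r.+1%:Z (y - 1)]
    = (lev L r.+1%:Z y - lev L r.+1%:Z (y - 1)) * p.[lev L r%:Z y].
Proof.
move=> p0 X.
have eM x : etax fam x (shift_params fam l r.+1%:Z) = lev L r.+1%:Z x by rewrite -lev_etax.
have em x : etax fam x (shift_params fam (shift_params fam l r.+1%:Z) (- 1)) = lev L r%:Z x.
  rewrite -lev_etax /L /=; case: (fam) => [|q hq] /=.
    by congr (_ * (_ + _)); rewrite -addrA -rmorphD /=; congr (_ + _%:~R); lia.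
  rewrite -[d * _ * _]mulrA -expfzDr ?(qC_neq0 hq) //.
  by congr (_ * (1 - _ * _ ^ _ * _)); lia.
have [Q [Q0 sQ hQ]] := lev_difference_inv L r%:Z p0.
have r1 : r%:Z + 1 = r.+1%:Z by lia.
rewrite r1 in hQ.
have [X0 sX hX] : [/\ X.[0] = 0, size X = (size p).+1
      & forall x, etax fam x (shift_params fam l r.+1%:Z) - etax fam (x - 1) (shift_params fam l r.+1%:Z) != 0 ->
          (X.[etax fam x (shift_params fam l r.+1%:Z)] - X.[etax fam (x - 1) (shift_params fam l r.+1%:Z)])
           / (etax fam x (shift_params fam l r.+1%:Z) - etax fam (x - 1) (shift_params fam l r.+1%:Z))
          = p.[etax fam x (shift_params fam (shift_params fam l r.+1%:Z) (- 1))]].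
  rewrite /X /Imap; case: xgetP => [q -> //|/(_ Q)[]]; split=> // x.
  by rewrite !eM em hQ => x0; rewrite mulrAC divff // mul1r.
split=> // y; have [E|ne] := eqVneq (lev L r.+1%:Z y - lev L r.+1%:Z (y - 1)) 0.
  by rewrite E mul0r; move/eqP: E; rewrite subr_eq0 => /eqP ->; rewrite subrr.
have := hX y; rewrite !eM em => /(_ ne) <-.
by rewrite mulrCA mulfV ?mulr1.
Qed.

Lemma rcoef_step (M j : nat) x : (j < M)%N ->
  rcoef fam M j.+1 x l * dn_val fam d a b (x + j.+1%:R)
  = rcoef fam M j x l * up_val fam d a b (x + j%:R).
Proof.
move=> jM; rewrite /rcoef /dn_val /up_val /l.
have -> : (M - j = (M - j.+1).+1)%N by lia.
move: (M - j.+1)%N => m; have := regular_l_neq0 N reg; rewrite /= -/a.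
case: (fam) => [_|q hq [a0 b0 c0 d0]].
  rewrite pochs2S pochs2Sl -!natr1.
  rewrite (_ : x + d - a + (j%:R + 1) + 1 = x + d - a + (j%:R + 1 + 1)); last by ring.
  rewrite (_ : x + d - b + (j%:R + 1) + 1 = x + d - b + (j%:R + 1 + 1)); last by ring.
  by ring.
have q0 : q%:C != 0 :> C := qC_neq0 hq.
rewrite qpochs2S qpochs2Sl -!natr1 !addrA !qpowD !qpow1 // qpow_nat //.
have := expf_neq0 j q0; have := qpow_neq0 q x.
move: (q%:C ^+ j) (qpow q x) (qpow q (M%:R * x)) => qj qx qMx qx0 qj0.
rewrite exprS; do ![rewrite invfM].
rewrite !mulrA -exprVn; move: (qpochs _ _ M)^-1 (qpochs _ _ _) (qpochs _ _ _) ((a * b / d / q%:C)^-1 ^+ j) qMx^-1 => *.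
by field; rewrite a0 b0 q0 d0 qx0 qj0.
Qed.

(** The quotient of consecutive coefficients is the shift quotient of [pair_nu]. Up to a factor
    depending on [x] only, the last column of the determinant is therefore [pair_nu] times the
    (q-)Racah polynomial. *)
Lemma rcoef_nu (j x : nat) : (x <= N)%N -> (j <= r.+1)%N ->
  rcoef fam r.+1 j x%:R l
  = rcoef fam r.+1 0 x%:R l / pair_nu fam d a b x * pair_nu fam d a b (x + j).
Proof.
move=> xN; have nu0 := regular_nu_neq0 reg xN.
elim: j => [|j IHj] jr; first by rewrite addn0 divfK.
have dn0 := dn_val_neq0 (x + j) (regular_good_ab N reg).
apply: (mulIf dn0); rewrite -[in RHS]addnS -[in LHS]addnS [in LHS]natrD rcoef_step // IHj 1?ltnW // -natrD addnS.
rewrite /pair_nu big_ord_recr /= -/(pair_nu fam d a b (x + j)).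
by rewrite -!mulrA [_^-1 * dn_val _ _ _ _ _]mulVf ?mulr1.
Qed.

End Assembly.

(** * The recurrence relations *)

Section Recurrence.

Variables (R : realType) (fam : racah_case R) (N : nat).
Local Notation C := R[i].
Variables (b c d : C).
Hypothesis reg : regular fam b c d.

Let a := aN fam N.
Let l := Params a b c d.
Let L := lattice_of fam d.

Variables (r : nat) (D : r.+1.-tuple nat).
Hypothesis D_inj : injective (tnth D).

Let xi := xi_poly fam N b c d D.
Let xiw (y : nat) (k : 'I_r.+1) := (xi k).[node L y].
Let nuP n (y : nat) := pair_nu fam d a b y * (hyp_poly fam n l).[node L y].

Let node_nat (x j : nat) : node L (x + j)%N = lev L 0 (x%:R + j%:R).
Proof. by rewrite /node -[_%:~R]/((x + j)%:R) natrD. Qed.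

Let checkPD_cas (n x : nat) : (x <= N)%N ->
  checkPD fam D n x%:R l
  = (constP fam D n l)^-1 *
    ((varphi fam r.+2 x%:R l)^-1 * (rcoef fam r.+1 0 x%:R l / pair_nu fam d a b x)
     * cas_ext xiw (nuP n) x).
Proof.
move=> xN; rewrite /checkPD -!mulrA; congr (_ * (_ * _)).
pose s := rcoef fam r.+1 0 x%:R l / pair_nu fam d a b x.
rewrite [RHS]mulrA -/s; have -> : s * cas_ext xiw (nuP n) x = cas_ext xiw (fun y => s * nuP n y) x.
  rewrite (@cas_ext_sum _ _ xiw _ [:: tt] (fun=> s) (fun=> nuP n) (fun y => s * nuP n y)).
    by rewrite big_seq1.
  by move=> y; rewrite big_seq1.
congr (\det _); apply/matrixP => j k; rewrite !mxE; case: unliftP => [i _|_].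
  by rewrite /checkxi hyp_polyE /xiw node_nat; congr (_.[_]); rewrite etax_lev0 /L; case: fam.
rewrite (rcoef_nu reg) ?leq_ord // hyp_polyE /nuP -!mulrA /s; congr (_ * (_ * (_ * _))).
by rewrite etax_lev0 node_nat.
Qed.

Lemma multi_indexed_recurrence (Y : {poly C}) : Y != 0 ->
  let X := Imap fam (shift_params fam l r.+1%:Z) (XiD fam D l * Y) in
  let L := (size X).-1 in
  L = (ell D + (size Y).-1 + 1)%N /\
  exists th : nat -> int -> C,
    forall n : nat, (n <= N)%N -> forall x : nat, (x <= N)%N ->
      X.[etax fam x%:R (shift_params fam l r.+1%:Z)] * checkPD fam D n x%:R l
      = \sum_(n - minn L n <= m < (n + minn L (N - n)).+1)
          th n (m%:Z - n%:Z) * checkPD fam D m x%:R l.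
Proof.
move=> Y0 X deg.
have [e e0 [sXi sumD hXi]] := XiD_spec N reg D_inj.
have Xi0 : XiD fam D l != 0 by rewrite -size_poly_eq0 sXi.
have p0 : XiD fam D l * Y != 0 by rewrite mulf_neq0.
have [sX hX] := Imap_spec fam N b c d r p0.
have sY : (0 < size Y)%N by rewrite size_poly_gt0.
have degE : deg = (ell D + size Y)%N by rewrite /deg /X sX size_mul // sXi.
split; first by rewrite degE -addnA addn1 prednK.
pose be := llb L 1 0 0.
(* The increment of eta contributes 2 [be] times the odd function, and [e] converts the denominator
   polynomial into the determinant over the Vandermonde product. *)
pose Cp := (2 * be * e) *: Y.
have lin y : lev L r.+1%:Z y - lev L r.+1%:Z (y - 1) = 2 * be * asym L r%:Z y.
  have r1 : r.+1%:Z = r%:Z + 1 by lia.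
  have -> : y - 1 = y + (r%:Z - r.+1%:Z - 0)%:~R by congr (_ + _); rewrite -[LHS]/((-1)%:~R); congr _%:~R; lia.
  by rewrite levJ -[X in lev L _ X - _](addr0 y) (levE L r.+1%:Z 0 r%:Z) r1 llb_step -/be; ring.
have winE (y : int) : \det (xi_window L xi y) =
   \det (\matrix_(j < r.+1, k < r.+1) (xi k).[lev L 0 (y%:~R + j%:R)]).
  by congr (\det _); apply/matrixP => j k; rewrite !mxE /node rmorphD.
have vdE (y : int) : vdm (fun j : 'I_r.+1 => node L (y + j%:Z)) =
   vdm (fun j : 'I_r.+1 => lev L 0 (y%:~R + j%:R)).
  by congr vdm; apply/funext => j; rewrite /node rmorphD.
have X_step (y : int) : X.[lev L r.+1%:Z y%:~R] - X.[lev L r.+1%:Z (y - 1)%:~R]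
  = asym L r%:Z y%:~R * Cp.[lev L r%:Z y%:~R] *
    (\det (xi_window L xi y) / vdm (fun j : 'I_r.+1 => node L (y + j%:Z))).
  rewrite rmorphB /= hX lin hornerM hornerZ winE vdE.
  have v0 := vdm_node_neq0 reg r.+1 y; have := hXi y%:~R.
  rewrite -/xi -/L; move: (vdm _) v0 (\det _) ((XiD fam D l).[_]) => v v0 w p E.
  by rewrite (_ : p = e * w / v); [ring | rewrite E mulrAC mulfV // mul1r].
have X_deg : (size X <= (ell D + size Y).+1)%N by rewrite /X sX size_mul // sXi.
have C_deg : (size Cp + \sum_k (size (xi k)).-1 <= ell D + size Y + \sum_(i < r.+1) i)%N.
  have -> : (\sum_k (size (xi k)).-1 = \sum_k tnth D k)%N.
    by apply: eq_bigr => k _; rewrite size_hyp_poly //; exact: (regular_hyp_twist N reg).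
  rewrite -sumD addnCA -[leqRHS]addnA leq_add2l leq_add2r; exact: size_scale_leq.
have w_neq0 x : (x <= N)%N ->
   asym L 0 x%:~R * pair_nu fam d a b x * pair_nu fam d c d x != 0.
  move=> xN; rewrite mulf_neq0 ?(regular_rho_neq0 reg) // mulf_neq0 ?(regular_nu_neq0 reg) //.
  exact: (regular_asym_neq0 reg 0 x).
have [th hth] := grid_recurrence (regular_lev_inj reg (r := 0)) X_step X_deg C_deg
  (nu := pair_weight (regular_good_ab N reg)) (rho := pair_weight (regular_good_cd reg))
  (P := fun n => hyp_poly fam n l) (N := N) (fun y => @regular_nu_eq0 _ fam N b d y)
  (etrans (pair_weight_dn _ 0) (regular_dn_cd0 reg)) w_neq0
  (fun n nN => size_hyp_poly (regular_hyp reg nN)) (fun n m => regular_orth reg (n := n) (m := m)).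
(* The coefficients for the Casoratians are conjugated by the normalization constants; [n + k] is
   the natural number m for the k that occur. *)
exists (fun n (k : int) => let m := absz (n%:Z + k)%R in (constP fam D n l)^-1 * th n m * constP fam D m l).
move=> n nN x xN.
have -> : etax fam x%:R (shift_params fam l r.+1%:Z) = lev L r.+1%:Z x%:~R by rewrite -lev_etax.
rewrite checkPD_cas // mulrCA [_ * (_ * cas_ext _ _ _)]mulrCA hth //.
pose G m := (constP fam D n l)^-1 *
  ((varphi fam r.+2 x%:R l)^-1 * (rcoef fam r.+1 0 x%:R l / pair_nu fam d a b x)
   * (th n m * cas_ext xiw (nuP m) x)).
transitivity (\sum_(n - minn deg n <= m < (n + minn deg (N - n)).+1) G m).
  rewrite !mulr_sumr -degE -(big_mkord (fun m => (n <= m + deg)%N && (m <= n + deg)%N) G).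
  rewrite [RHS](@big_nat_widen _ _ _ (n - minn deg n) _ N.+1); last by rewrite ltnS; lia.
  rewrite [RHS](@big_nat_widenl _ _ _ (n - minn deg n) 0) //.
  by apply: congr_big_nat => // m; lia.
apply: eq_bigr => m _; rewrite /G checkPD_cas // addrC subrK absz_nat.
by rewrite -[RHS]mulrA -/l mulVKf ?(constP_neq0 N reg D_inj) //; ring.
Qed.

End Recurrence.

(** * Generic conditions *)

Section Generic.

Variables (F : fieldType) (n : nat).
Implicit Types (f g : ('I_n -> F) -> F) (P Q : ('I_n -> F) -> Prop).

Lemma generically_mono P Q : (forall v, P v -> Q v) -> generically P -> generically Q.
Proof. by move=> PQ [G [G0 GP]]; exists G; split=> // v /GP /PQ. Qed.

(** Pairs of a condition and an index are coded by natural numbers, and the codes of no pair receive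
    the polynomial 1. *)
Lemma generically_forall (T : countType) (P : T -> ('I_n -> F) -> Prop) :
  (forall t, generically (P t)) -> generically (fun v => forall t, P t v).
Proof.
move=> /choice[G GP].
exists (fun i => if unpickle i is Some (t, k) then G t k else 1); split.
  by move=> i; case: unpickle => [[t k]|]; [case: (GP t) => G0 _; exact: G0 | rewrite oner_neq0].
move=> v hv t; case: (GP t) => _; apply=> k.
by have := hv (pickle (t, k)); rewrite pickleK.
Qed.

Lemma generically_and P Q :
  generically P -> generically Q -> generically (fun v => P v /\ Q v).
Proof.
move=> gP gQ.
apply: (@generically_mono (fun v => forall t : bool, if t then P v else Q v)).
  by move=> v h; split; [exact: (h true) | exact: (h false)].
by apply: generically_forall => -[].
Qed.

Definition polynomial_fun f := exists p : mpoly n F, forall v, meval v p = f v.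

Lemma polynomial_var i : polynomial_fun (fun v => v i).
Proof. by exists (mpolyX F (mnm1 i)) => v; rewrite mevalXU. Qed.

Lemma polynomial_const (k : F) : polynomial_fun (fun=> k).
Proof. by exists (mpolyC n k) => v; rewrite mevalC. Qed.

Lemma polynomialD f g :
  polynomial_fun f -> polynomial_fun g -> polynomial_fun (fun v => f v + g v).
Proof. by move=> [p fE] [q gE]; exists (p + q) => v; rewrite mevalD fE gE. Qed.

Lemma polynomialN f : polynomial_fun f -> polynomial_fun (fun v => - f v).
Proof. by move=> [p fE]; exists (- p) => v; rewrite mevalN fE. Qed.

Lemma polynomialM f g :
  polynomial_fun f -> polynomial_fun g -> polynomial_fun (fun v => f v * g v).
Proof. by move=> [p fE] [q gE]; exists (p * q) => v; rewrite mevalM fE gE. Qed.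

(** The point [v] witnesses that the difference of the two polynomials is not the zero
    polynomial. *)
Lemma generically_neq f g v :
  polynomial_fun f -> polynomial_fun g -> f v != g v -> generically (fun v => f v != g v).
Proof.
move=> [p fE] [q gE] ne; exists (fun=> p - q); split=> [_|u /(_ 0)]; last first.
  by rewrite mevalB fE gE subr_eq0.
by apply: contraNneq ne => /(congr1 (meval v)); rewrite mevalB meval0 fE gE => /eqP; rewrite subr_eq0.
Qed.

End Generic.

Ltac polynomial := repeat first [exact: polynomial_const | exact: polynomial_var
  | apply: polynomialD | apply: polynomialN | apply: polynomialM].

Lemma generically_regular (R : realType) (fam : racah_case R) :
  generically (fun u : 'I_3 -> R[i] => regular fam (u 0) (u 1) (u 2)).
Proof.
(* Test points for [generically_neq]: at each of them one of the inequalities holds by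
   inspection. *)
pose pt (x y z : R[i]) (i : 'I_3) := nth 0 [:: x; y; z] i.
rewrite /regular; case: fam => [|q hq].
  apply: generically_forall => k.
  have P := @generically_neq R[i] 3.
  have k1 : 1 - k%:~R + k%:~R != 0 :> R[i] by rewrite subrK oner_neq0.
  apply: (generically_mono (P := fun u : 'I_3 -> R[i] =>
    (u 0 + k%:~R != 0 /\ (u 1 + k%:~R != 0 /\ u 2 + k%:~R != 0)) /\
    ((u 2 - u 0 + k%:~R != 0 /\ u 2 - u 1 + k%:~R != 0) /\
     (u 0 + u 1 - u 2 + k%:~R != 0 /\ u 1 + u 2 - u 0 + k%:~R != 0)))).
    by move=> u [[? [? ?]] [[? ?] [? ?]]].
  repeat apply: generically_and.
  - by apply: (P _ _ (pt (1 - k%:~R) 0 0)); [polynomial | polynomial |].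
  - by apply: (P _ _ (pt 0 (1 - k%:~R) 0)); [polynomial | polynomial |].
  - by apply: (P _ _ (pt 0 0 (1 - k%:~R))); [polynomial | polynomial |].
  - by apply: (P _ _ (pt 0 0 (1 - k%:~R))); [polynomial | polynomial |]; rewrite /pt /= subr0.
  - by apply: (P _ _ (pt 0 0 (1 - k%:~R))); [polynomial | polynomial |]; rewrite /pt /= subr0.
  - by apply: (P _ _ (pt (1 - k%:~R) 0 0)); [polynomial | polynomial |]; rewrite /pt /= subr0 addr0.
  - by apply: (P _ _ (pt 0 (1 - k%:~R) 0)); [polynomial | polynomial |]; rewrite /pt /= subr0 addr0.
have P := @generically_neq R[i] 3.
have o0 : 1 != 0 :> R[i] := oner_neq0 _.
have q0 k : q%:C ^ k != 0 :> R[i] by rewrite expfz_neq0 // (qC_neq0 hq).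
apply: generically_and.
  apply: (generically_mono (P := fun u : 'I_3 -> R[i] => u 0 != 0 /\ (u 1 != 0 /\ u 2 != 0))).
    by move=> u [? []].
  by repeat apply: generically_and; apply: (P _ _ (pt 1 1 1)); [polynomial | polynomial | |
    polynomial | polynomial | | polynomial | polynomial |].
apply: generically_forall => k; have q0' : 0 != q%:C ^ k :> R[i] by rewrite eq_sym.
apply: (generically_mono (P := fun u : 'I_3 -> R[i] =>
    (u 0 != q%:C ^ k /\ (u 1 != q%:C ^ k /\ u 2 != q%:C ^ k)) /\
    ((u 2 != u 0 * q%:C ^ k /\ u 2 != u 1 * q%:C ^ k) /\
     (u 0 * u 1 != u 2 * q%:C ^ k /\ u 1 * u 2 != u 0 * q%:C ^ k)))).
  by move=> u [[? [? ?]] [[? ?] [? ?]]].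
repeat apply: generically_and.
- by apply: (P _ _ (pt 0 0 0)); [polynomial | polynomial |].
- by apply: (P _ _ (pt 0 0 0)); [polynomial | polynomial |].
- by apply: (P _ _ (pt 0 0 0)); [polynomial | polynomial |].
- by apply: (P _ _ (pt 0 0 1)); [polynomial | polynomial |]; rewrite /pt /= mul0r.
- by apply: (P _ _ (pt 0 0 1)); [polynomial | polynomial |]; rewrite /pt /= mul0r.
- by apply: (P _ _ (pt 0 0 1)); [polynomial | polynomial |]; rewrite /pt /= mul0r mul1r.
- by apply: (P _ _ (pt 1 0 0)); [polynomial | polynomial |]; rewrite /pt /= mul0r mul1r.
Qed.

Theorem theorem3 (R : realType) (fam : racah_case R)
    (M : nat) (hM : (1 <= M)%N) (D : M.-tuple nat)
    (hDsorted : sorted ltn D) (hDpos : all (leq 1) D)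
    (hA : hypA fam D) (N : nat) (hN : (1 <= N)%N) :
  generically (fun u : 'I_3 -> R[i] =>
    let l := Params (aN fam N) (u 0) (u 1) (u 2) in
    forall Y : {poly R[i]}, Y != 0 ->
    let X := Imap fam (shift_params fam l M%:Z) (XiD fam D l * Y) in
    let L := (size X).-1 in
    L = (ell D + (size Y).-1 + 1)%N /\
    exists r : nat -> int -> R[i],
      forall n : nat, (n <= N)%N -> forall x : nat, (x <= N)%N ->
        X.[etax fam x%:R (shift_params fam l M%:Z)] * checkPD fam D n x%:R l
        = \sum_(n - minn L n <= m < (n + minn L (N - n)).+1)
            r n (m%:Z - n%:Z) * checkPD fam D m x%:R l).
Proof.
case: M hM D hDsorted hDpos hA => // r _ D hDsorted _ _.
have D_inj : injective (tnth D).
  have /uniqP u : uniq D by apply: sorted_uniq hDsorted; [exact: ltn_trans | exact: ltnn].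
  move=> i j; rewrite !(tnth_nth 0%N) => E; apply/val_inj/(u 0%N) => //; by rewrite inE size_tuple ltn_ord.
apply: generically_mono (generically_regular fam) => u reg l Y Y0.
exact: multi_indexed_recurrence.
Qed.
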